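(* Let $c,q\in C^\infty(\mathbb{T}^1)$ be complex-valued smooth functions and let $L=\partial_t+c(t)\partial_x+q(t)$ on $\mathbb{T}^1\times\mathbb{R}$. Set $c_0=\frac{1}{2\pi}\int_0^{2\pi}c(t)\,dt$, $q_0=\frac{1}{2\pi}\int_0^{2\pi}q(t)\,dt$ and $b=\operatorname{Im}(c)$. Then: (i) if $c_0=0$, $q$ is a constant function whose value lies in $i\mathbb{Z}$, and for every $r\in\mathbb{R}$ the sublevel set $$\Omega_r=\Big\{t\in\mathbb{T}^1 : \int_0^t b(\tau)\,d\tau<r\Big\}$$ is connected, then $L$ is Schwartz globally solvable; (ii) if $b\not\equiv 0$ and ($c_0\neq 0$ or $q_0\notin i\mathbb{Z}$), then $L$ is Schwartz globally solvable if and only if $b$ does not change sign on $\mathbb{T}^1$.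
   Context: $\mathbb{T}^1=\mathbb{R}/2\pi\mathbb{Z}$, identified with $[0,2\pi)$; functions on $\mathbb{T}^1$ are $2\pi$-periodic functions on $\mathbb{R}$. $\mathcal{S}(\mathbb{T}^1\times\mathbb{R})$ is the space of $f\in C^\infty(\mathbb{T}^1\times\mathbb{R})$ with $\sup_{t,x}|x^\gamma\partial_t^\alpha\partial_x^\beta f(t,x)|<\infty$ for all $\alpha,\beta,\gamma\in\mathbb{N}_0$ (Fréchet topology from these seminorms), and $\mathcal{S}'(\mathbb{T}^1\times\mathbb{R})$ its dual, with pairing $\langle v,f\rangle$. The transpose of $L$ is the operator $L^t$ on $\mathcal{S}'(\mathbb{T}^1\times\mathbb{R})$ defined by $\langle L^tv,\varphi\rangle=\langle v,L\varphi\rangle$, i.e. $L^tv=-\partial_tv-c(t)\partial_xv+q(t)v$. Let $\ker L^t=\{v\in\mathcal{S}'(\mathbb{T}^1\times\mathbb{R}):L^tv=0\}$ and $(\ker L^t)^0=\{f\in\mathcal{S}(\mathbb{T}^1\times\mathbb{R}):\langle v,f\rangle=0\ \forall v\in\ker L^t\}$. $L$ is (Schwartz) globally solvable if for every $f\in(\ker L^t)^0$ there exists $u\in\mathcal{S}(\mathbb{T}^1\times\mathbb{R})$ with $Lu=f$. *)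

(* Defs.v *)
From Stdlib Require Import Reals ZArith List.
From Coquelicot Require Import Coquelicot.
Open Scope R_scope.

Definition dC (f : R -> C) : R -> C :=
  fun t => (Derive (fun s => fst (f s)) t, Derive (fun s => snd (f s)) t).

Definition diffC (f : R -> C) : Prop :=
  forall t, ex_derive (fun s => fst (f s)) t /\ ex_derive (fun s => snd (f s)) t.

(** Functions on T^1 = R/2piZ are 2pi-periodic functions on R. *)
Definition periodic1 (f : R -> C) : Prop := forall t, f (t + 2 * PI) = f t.

Definition smooth_T1 (f : R -> C) : Prop :=
  periodic1 f /\ forall n : nat, diffC (Nat.iter n dC f).

Definition dt (f : R -> R -> C) : R -> R -> C := fun t x => dC (fun s => f s x) t.
Definition dx (f : R -> R -> C) : R -> R -> C := fun t x => dC (fun y => f t y) x.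

Fixpoint Dword (w : list bool) (f : R -> R -> C) : R -> R -> C :=
  match w with
  | nil => f
  | b :: w' => (if b then dt else dx) (Dword w' f)
  end.

Definition cont2 (f : R -> R -> C) : Prop :=
  forall t x eps, 0 < eps -> exists del, 0 < del /\
    forall t' x', Rabs (t' - t) < del -> Rabs (x' - x) < del ->
      Cmod (Cminus (f t' x') (f t x)) < eps.

Definition smooth2 (f : R -> R -> C) : Prop :=
  forall w : list bool, cont2 (Dword w f) /\
    forall t x,
      ex_derive (fun s => fst (Dword w f s x)) t /\
      ex_derive (fun s => snd (Dword w f s x)) t /\
      ex_derive (fun y => fst (Dword w f t y)) x /\
      ex_derive (fun y => snd (Dword w f t y)) x.

Definition periodic2 (f : R -> R -> C) : Prop :=
  forall t x, f (t + 2 * PI) x = f t x.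

Definition Dab (a b : nat) (f : R -> R -> C) : R -> R -> C :=
  Nat.iter a dt (Nat.iter b dx f).

Definition schwartz (f : R -> R -> C) : Prop :=
  periodic2 f /\ smooth2 f /\
  forall a b g : nat, exists M, forall t x,
    Rabs x ^ g * Cmod (Dab a b f t x) <= M.

(** * Tempered distributions S'(T^1 x R): continuous linear functionals on S,
    continuity w.r.t. the (Frechet) topology generated by the seminorms
    p_{a,b,g}(f) = sup |x^g d_t^a d_x^b f|: basic neighbourhoods of f are
    { h | p_{a,b,g}(h - f) <= del for all a,b,g <= N }. *)
Definition fsub (f g : R -> R -> C) : R -> R -> C := fun t x => Cminus (f t x) (g t x).

Definition tempered (v : (R -> R -> C) -> C) : Prop :=
  (forall f g, schwartz f -> schwartz g ->
     v (fun t x => Cplus (f t x) (g t x)) = Cplus (v f) (v g)) /\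
  (forall (a : C) f, schwartz f -> v (fun t x => Cmult a (f t x)) = Cmult a (v f)) /\
  (forall f, schwartz f -> forall eps, 0 < eps -> exists (N : nat) del, 0 < del /\
     forall h, schwartz h ->
       (forall a b g : nat, (a <= N)%nat -> (b <= N)%nat -> (g <= N)%nat ->
          forall t x, Rabs x ^ g * Cmod (Dab a b (fsub h f) t x) <= del) ->
       Cmod (Cminus (v h) (v f)) < eps).

Definition Lop (c q : R -> C) (u : R -> R -> C) : R -> R -> C :=
  fun t x => Cplus (Cplus (dt u t x) (Cmult (c t) (dx u t x))) (Cmult (q t) (u t x)).

(** ker L^t : tempered v with <L^t v, phi> = <v, L phi> = 0 for all phi in S. *)
Definition in_ker_Lt (c q : R -> C) (v : (R -> R -> C) -> C) : Prop :=
  tempered v /\ forall phi, schwartz phi -> v (Lop c q phi) = RtoC 0.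

Definition in_annih (c q : R -> C) (f : R -> R -> C) : Prop :=
  schwartz f /\ forall v, in_ker_Lt c q v -> v f = RtoC 0.

Definition schwartz_globally_solvable (c q : R -> C) : Prop :=
  forall f, in_annih c q f -> exists u, schwartz u /\ forall t x, Lop c q u t x = f t x.

Definition avg (f : R -> C) : C :=
  (RInt (fun t => fst (f t)) 0 (2 * PI) / (2 * PI),
   RInt (fun t => snd (f t)) 0 (2 * PI) / (2 * PI)).

Definition in_iZ (z : C) : Prop := exists k : Z, z = (0, IZR k).

Definition modT (t : R) : R := t - 2 * PI * IZR (Int_part (t / (2 * PI))).

(** Omega_r, lifted to a 2pi-periodic subset of R. *)
Definition Omega (b : R -> R) (r : R) : R -> Prop :=
  fun t => RInt b 0 (modT t) < r.

(** Topology of T^1: open sets = 2pi-periodic subsets of R that are open in R. *)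
Definition periodic_set (U : R -> Prop) : Prop := forall t, U t <-> U (t + 2 * PI).
Definition openR (U : R -> Prop) : Prop :=
  forall t, U t -> exists e, 0 < e /\ forall s, Rabs (s - t) < e -> U s.
Definition open_T1 (U : R -> Prop) : Prop := periodic_set U /\ openR U.

(** Connectedness of a subset A of T^1 (given by its periodic lift)
    in the subspace topology. *)
Definition connected_T1 (A : R -> Prop) : Prop :=
  ~ exists U V, open_T1 U /\ open_T1 V /\
      (forall t, A t -> U t \/ V t) /\
      (exists t, A t /\ U t) /\ (exists t, A t /\ V t) /\
      (forall t, A t -> U t -> V t -> False).

(* Main.v *)
(** Under the Fourier transform in [x], [L u = f] becomes a family of periodic linear equations
    [V' + (i xi c + q) V = F] in [t], one for each frequency [xi], solved by
    [V = exp (- Lam) (kappa + int_0^t exp Lam F)] where [Lam] is the primitive of [i xi c + q].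
    A periodic solution exists unless [exp (- Lam (2 PI)) = 1], and at such a resonance the
    compatibility condition is exactly that one element of [ker L^t] vanishes on [f]. So everything
    rests on whether [V] decays in [xi]: once the values of periodic solutions are bounded by those
    of [F] uniformly for large [|xi|], the derivatives are too, since [V_xi] solves the same equation.

    If [b] has constant sign, [|exp Lam|] is almost monotone, and the only possible resonance is a
    simple zero that can be divided out. In (i) every frequency is resonant; connectedness of the
    sublevel sets makes the primitive of [b] unimodal, so starting from its minimum for [xi < 0]
    and from its maximum for [xi > 0] one integrates along paths where the kernel is at most [1].

    If [b] changes sign, its primitive has a dip along some arc. A cutoff of a homogeneous solution
    that is large in the dip and small where the cutoff varies gives [f] in the annihilator (by
    Gaussian regularization in [xi]) whose only candidate solution grows exponentially. *)

Require Import Defs.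
From Stdlib Require Import Reals ZArith List.
From Coquelicot Require Import Coquelicot.
From Stdlib Require Import Lia Lra Psatz FunctionalExtensionality ClassicalEpsilon.
Open Scope R_scope.

(** * Calculus for complex-valued functions *)

(** Smoothness and decay are proved together, on families [f i t x] all of whose mixed derivatives
    lie in a weight class ([Cinf W]); differentiation under an integral reduces to a second-order
    Taylor remainder.

    The initial value [kappa] of the periodic solution must be smooth in the frequency, although the
    equation that fixes it degenerates at resonances. For [b] of one sign the degeneracy is a simple
    zero, cancelled by a Hadamard quotient. In (i) the equation leaves [kappa] free at every
    frequency, so it is prescribed for [xi >= 1] and for [xi <= -1] and interpolated between: decay
    is an issue for large [|xi|] only.

    In the counterexample the datum is shown to lie in the annihilator without describing [ker L^t]:
    it is a limit, in the Schwartz topology, of functions [L u_n]. The homogeneous solution that is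
    cut off has to be periodic, which requires [c] and [q] of mean zero; both are therefore altered,
    but only where the cutoff vanishes. The condition on [c_0] and [q_0] supplies non-resonant
    frequencies arbitrarily close to minus infinity, where the periodic solution is unique. *)

Definition is_dC (f : R -> C) (t : R) (l : C) : Prop :=
  is_derive (fun s => fst (f s)) t (fst l) /\ is_derive (fun s => snd (f s)) t (snd l).

Definition cexp (z : C) : C := (exp (fst z) * cos (snd z), exp (fst z) * sin (snd z)).

Lemma dC_is_dC f t l : is_dC f t l -> dC f t = l.
Proof.
  intros [H1 H2]; apply injective_projections; simpl; now apply is_derive_unique.
Qed.

Lemma is_dC_dC f t : ex_derive (fun s => fst (f s)) t /\ ex_derive (fun s => snd (f s)) t ->
  is_dC f t (dC f t).
Proof. intros [H1 H2]; split; simpl; now apply Derive_correct. Qed.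

Lemma is_dC_eq f t l l' : is_dC f t l -> l = l' -> is_dC f t l'.
Proof. now intros ? <-. Qed.

Lemma is_dC_ext f g t l : (forall s, f s = g s) -> is_dC f t l -> is_dC g t l.
Proof.
  intros E H; replace g with f; auto. now apply functional_extensionality.
Qed.

Lemma is_derive_Rconst (c t : R) : is_derive (fun _ => c) t 0.
Proof. exact (is_derive_const (K := R_AbsRing) (V := R_NormedModule) c t). Qed.

Lemma is_dC_const (c : C) t : is_dC (fun _ => c) t (RtoC 0).
Proof. split; simpl; apply is_derive_Rconst. Qed.

Lemma is_dC_plus f g t l m : is_dC f t l -> is_dC g t m ->
  is_dC (fun s => (f s + g s)%C) t (l + m)%C.
Proof.
  intros [H1 H2] [H3 H4]; split; simpl;
    apply (is_derive_plus (K := R_AbsRing) (V := R_NormedModule)); assumption.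
Qed.

Lemma is_derive_Rmult (f g : R -> R) t l m : is_derive f t l -> is_derive g t m ->
  is_derive (fun s => f s * g s) t (l * g t + f t * m).
Proof. intros; apply (is_derive_mult (K := R_AbsRing)); auto. intros; apply Rmult_comm. Qed.

Lemma is_derive_Rplus (f g : R -> R) t l m : is_derive f t l -> is_derive g t m ->
  is_derive (fun s => f s + g s) t (l + m).
Proof. intros; apply (is_derive_plus (K := R_AbsRing) (V := R_NormedModule)); auto. Qed.

Lemma is_derive_Rminus (f g : R -> R) t l m : is_derive f t l -> is_derive g t m ->
  is_derive (fun s => f s - g s) t (l - m).
Proof. intros; apply (is_derive_minus (K := R_AbsRing) (V := R_NormedModule)); auto. Qed.

Lemma is_derive_eq (f : R -> R) t l m : is_derive f t l -> l = m -> is_derive f t m.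
Proof. now intros ? <-. Qed.

Lemma is_dC_mult f g t l m : is_dC f t l -> is_dC g t m ->
  is_dC (fun s => (f s * g s)%C) t (l * g t + f t * m)%C.
Proof.
  intros [H1 H2] [H3 H4]; split; simpl.
  - eapply is_derive_eq; [apply is_derive_Rminus; apply is_derive_Rmult; eassumption|simpl; ring].
  - eapply is_derive_eq; [apply is_derive_Rplus; apply is_derive_Rmult; eassumption|simpl; ring].
Qed.

Lemma is_dC_scal (c : C) g t m : is_dC g t m -> is_dC (fun s => (c * g s)%C) t (c * m)%C.
Proof.
  intros H; eapply is_dC_eq; [apply is_dC_mult; [apply is_dC_const|exact H]|cbv beta; ring].
Qed.

Lemma is_dC_opp g t m : is_dC g t m -> is_dC (fun s => (- g s)%C) t (- m)%C.
Proof.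
  intros H. eapply is_dC_ext; [|eapply is_dC_eq; [apply (is_dC_scal (-1)%C); exact H|]].
  - intros s; simpl. ring.
  - ring.
Qed.

Lemma is_dC_minus f g t l m : is_dC f t l -> is_dC g t m ->
  is_dC (fun s => (f s - g s)%C) t (l - m)%C.
Proof. intros; apply is_dC_plus; auto. now apply is_dC_opp. Qed.

Lemma is_dC_RtoC (f : R -> R) t l : is_derive f t l -> is_dC (fun s => RtoC (f s)) t (RtoC l).
Proof. intros; split; simpl; auto. apply is_derive_Rconst. Qed.

Lemma is_dC_id t : is_dC (fun s => RtoC s) t (RtoC 1).
Proof. apply is_dC_RtoC, (is_derive_id (K := R_AbsRing)). Qed.

Lemma is_dC_comp (g : R -> C) (y : R -> R) t l m : is_dC g (y t) l -> is_derive y t m ->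
  is_dC (fun s => g (y s)) t (RtoC m * l)%C.
Proof.
  intros [H1 H2] H; split; simpl.
  - eapply is_derive_eq; [apply (is_derive_comp (fun s => fst (g s)) y t); eassumption|].
    unfold scal; simpl; unfold mult; simpl; ring.
  - eapply is_derive_eq; [apply (is_derive_comp (fun s => snd (g s)) y t); eassumption|].
    unfold scal; simpl; unfold mult; simpl; ring.
Qed.

Lemma is_dC_cexp f t l : is_dC f t l -> is_dC (fun s => cexp (f s)) t (l * cexp (f t))%C.
Proof.
  intros [H1 H2].
  assert (He : is_derive (fun s => exp (fst (f s))) t (fst l * exp (fst (f t)))).
  { apply (is_derive_comp exp (fun s => fst (f s)) t); auto. apply is_derive_exp. }
  assert (Hc : is_derive (fun s => cos (snd (f s))) t (snd l * - sin (snd (f t)))).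
  { apply (is_derive_comp cos (fun s => snd (f s)) t); auto. apply is_derive_cos. }
  assert (Hs : is_derive (fun s => sin (snd (f s))) t (snd l * cos (snd (f t)))).
  { apply (is_derive_comp sin (fun s => snd (f s)) t); auto. apply is_derive_sin. }
  split; simpl.
  - eapply is_derive_eq; [apply is_derive_Rmult; eassumption|simpl; ring].
  - eapply is_derive_eq; [apply is_derive_Rmult; eassumption|simpl; ring].
Qed.

Lemma cexp_plus z w : cexp (z + w)%C = (cexp z * cexp w)%C.
Proof.
  unfold cexp; apply injective_projections; simpl; rewrite exp_plus, ?cos_plus, ?sin_plus; ring.
Qed.

Lemma cexp_0 : cexp (RtoC 0) = RtoC 1.
Proof. unfold cexp; simpl; rewrite exp_0, cos_0, sin_0; apply injective_projections; simpl; ring. Qed.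

Lemma Cmod_cexp z : Cmod (cexp z) = exp (fst z).
Proof.
  unfold Cmod, cexp; simpl.
  replace (_ + _) with (exp (fst z) ^ 2 * (Rsqr (sin (snd z)) + Rsqr (cos (snd z)))).
  2: unfold Rsqr; ring.
  rewrite sin2_cos2, Rmult_1_r. rewrite sqrt_pow2; auto. left; apply exp_pos.
Qed.

Lemma cexp_neq_0 z : cexp z <> RtoC 0.
Proof.
  intros H. assert (H1 := Cmod_cexp z). rewrite H, Cmod_0 in H1.
  assert (H2 := exp_pos (fst z)). lra.
Qed.

Lemma cexp_opp z : (cexp (- z) * cexp z)%C = RtoC 1.
Proof. rewrite <- cexp_plus, <- cexp_0. f_equal. ring. Qed.

Lemma abs_fst_Cmod z : Rabs (fst z) <= Cmod z.
Proof. eapply Rle_trans; [|apply Rmax_Cmod]. apply Rmax_l. Qed.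

Lemma abs_snd_Cmod z : Rabs (snd z) <= Cmod z.
Proof. eapply Rle_trans; [|apply Rmax_Cmod]. apply Rmax_r. Qed.

Lemma Cmod_le_parts z : Cmod z <= Rabs (fst z) + Rabs (snd z).
Proof.
  assert (z = (RtoC (fst z) + (0, snd z)))%C as E.
  { apply injective_projections; simpl; ring. }
  rewrite E at 1. eapply Rle_trans; [apply Cmod_triangle|].
  rewrite Cmod_R. apply Rplus_le_compat_l.
  unfold Cmod; simpl. rewrite !Rmult_0_l, Rplus_0_l, Rmult_1_r.
  fold (Rsqr (snd z)); rewrite sqrt_Rsqr_abs; lra.
Qed.

Lemma Cmod_minus_sym z w : Cmod (z - w) = Cmod (w - z).
Proof. rewrite <- Cmod_opp. f_equal. ring. Qed.

Lemma Cmod_bound_parts z M : Rabs (fst z) <= M -> Rabs (snd z) <= M -> Cmod z <= 2 * M.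
Proof. intros. assert (H2 := Cmod_le_parts z). lra. Qed.

Lemma is_derive_cont (f : R -> R) t l : is_derive f t l -> continuous f t.
Proof. intros H; apply (ex_derive_continuous f t). now exists l. Qed.

Lemma is_dC_ex f t l : is_dC f t l ->
  ex_derive (fun s => fst (f s)) t /\ ex_derive (fun s => snd (f s)) t.
Proof. intros [H1 H2]; split; eexists; eassumption. Qed.

Lemma is_dC_inv f t l : is_dC f t l -> f t <> RtoC 0 ->
  is_dC (fun s => (/ f s)%C) t (- l * (/ f t * / f t))%C.
Proof.
  intros [H1 H2] Hn.
  assert (Hd : fst (f t) ^ 2 + snd (f t) ^ 2 <> 0).
  { intros E. apply Hn. apply injective_projections; simpl; nra. }
  set (N := fun s => fst (f s) ^ 2 + snd (f s) ^ 2).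
  assert (HN : is_derive N t (2 * fst (f t) * fst l + 2 * snd (f t) * snd l)).
  { unfold N. apply (is_derive_ext (fun s => fst (f s) * fst (f s) + snd (f s) * snd (f s))).
    - intros; simpl; ring.
    - eapply is_derive_eq; [apply is_derive_Rplus; apply is_derive_Rmult; eassumption|]. simpl; ring. }
  assert (HI := is_derive_inv N t _ HN Hd).
  split; simpl.
  - eapply is_derive_eq.
    + apply (is_derive_Rmult (fun s => fst (f s)) (fun s => / N s)); eassumption.
    + unfold N; simpl. field. intros E0; apply Hd; rewrite <- E0; ring.
  - eapply is_derive_eq.
    + apply (is_derive_Rmult (fun s => - snd (f s)) (fun s => / N s)).
      apply (is_derive_opp (K := R_AbsRing) (V := R_NormedModule)); eassumption. eassumption.
    + unfold N, opp; simpl. field. intros E0; apply Hd; rewrite <- E0; ring.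
Qed.

Lemma is_dC_cont f t l : is_dC f t l ->
  continuous (fun s => fst (f s)) t /\ continuous (fun s => snd (f s)) t.
Proof. intros [H1 H2]; split; [exact (is_derive_cont _ _ _ H1)|exact (is_derive_cont _ _ _ H2)]. Qed.

(** The factor 2 comes from treating the two components separately. *)
Lemma is_dC_mvt f f1 a b M : a <= b -> (forall t, a <= t <= b -> is_dC f t (f1 t)) ->
  (forall t, a <= t <= b -> Cmod (f1 t) <= M) -> Cmod (f b - f a) <= 2 * (M * (b - a)).
Proof.
  intros Hab Hd HM.
  apply Cmod_bound_parts; simpl.
  - destruct (MVT_gen (fun s => fst (f s)) a b (fun s => fst (f1 s))) as [c [Hc E]];
      rewrite ?Rmin_left, ?Rmax_right in *; auto.
    + intros u Hu; exact (proj1 (Hd u ltac:(lra))).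
    + intros u Hu; apply continuity_pt_filterlim. exact (proj1 (is_dC_cont _ _ _ (Hd u Hu))).
    + simpl in E. replace (_ + _) with (fst (f1 c) * (b - a)) by (rewrite <- E; ring).
      rewrite Rabs_mult, (Rabs_right (b - a)) by lra.
      apply Rmult_le_compat_r; [lra|]. eapply Rle_trans; [apply abs_fst_Cmod|]. now apply HM.
  - destruct (MVT_gen (fun s => snd (f s)) a b (fun s => snd (f1 s))) as [c [Hc E]];
      rewrite ?Rmin_left, ?Rmax_right in *; auto.
    + intros u Hu; exact (proj2 (Hd u ltac:(lra))).
    + intros u Hu; apply continuity_pt_filterlim. exact (proj2 (is_dC_cont _ _ _ (Hd u Hu))).
    + simpl in E. replace (_ + _) with (snd (f1 c) * (b - a)) by (rewrite <- E; ring).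
      rewrite Rabs_mult, (Rabs_right (b - a)) by lra.
      apply Rmult_le_compat_r; [lra|]. eapply Rle_trans; [apply abs_snd_Cmod|]. now apply HM.
Qed.

Lemma is_dC_mvt_abs f f1 a b M : (forall t, Rmin a b <= t <= Rmax a b -> is_dC f t (f1 t)) ->
  (forall t, Rmin a b <= t <= Rmax a b -> Cmod (f1 t) <= M) ->
  Cmod (f b - f a) <= 2 * (M * Rabs (b - a)).
Proof.
  intros Hd HM. destruct (Rle_dec a b).
  - rewrite Rmin_left, Rmax_right in * by lra. rewrite Rabs_right by lra. eapply is_dC_mvt; eauto.
  - rewrite Rmin_right, Rmax_left in * by lra. rewrite Rabs_left by lra.
    rewrite Cmod_minus_sym. replace (- (b - a)) with (a - b) by ring. eapply is_dC_mvt; eauto; lra.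
Qed.

(** The mean value inequality is used twice, for [f - s f1(y)] and then for its derivative
    [f1 - f1(y)]; each use costs a factor 2. *)
Lemma is_dC_taylor f f1 f2 y M : (forall s, Rabs (s - y) <= 1 -> is_dC f s (f1 s)) ->
  (forall s, Rabs (s - y) <= 1 -> is_dC f1 s (f2 s)) ->
  (forall s, Rabs (s - y) <= 1 -> Cmod (f2 s) <= M) ->
  forall h, Rabs h <= 1 -> Cmod (f (y + h)%R - f y - RtoC h * f1 y)%C <= 4 * (M * h ^ 2).
Proof.
  intros H1 H2 HM h Hh.
  assert (HM0 : 0 <= M).
  { eapply Rle_trans; [apply Cmod_ge_0|apply (HM y)]. rewrite Rminus_diag, Rabs_R0; lra. }
  assert (Hs : forall s, Rmin y (y + h) <= s <= Rmax y (y + h) -> Rabs (s - y) <= Rabs h).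
  { intros s. unfold Rmin, Rmax. destruct (Rle_dec y (y + h)); intros; unfold Rabs;
      destruct (Rcase_abs (s - y)), (Rcase_abs h); lra. }
  set (g := fun s => (f s - RtoC s * f1 y)%C).
  replace (f (y + h)%R - f y - RtoC h * f1 y)%C with (g (y + h)%R - g y)%C.
  2: unfold g; rewrite RtoC_plus; ring.
  replace (4 * (M * h ^ 2)) with (2 * ((2 * (M * Rabs h)) * Rabs (y + h - y))).
  2:{ replace (y + h - y) with h by ring. rewrite <- (pow2_abs h); ring. }
  apply is_dC_mvt_abs with (f1 := fun s => (f1 s - f1 y)%C).
  - intros s Hss. unfold g. eapply is_dC_eq.
    + apply is_dC_minus. apply H1. apply Hs in Hss; lra.
      apply is_dC_mult. apply is_dC_id. apply is_dC_const.
    + cbv beta; ring.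
  - intros s Hss. eapply Rle_trans.
    + apply is_dC_mvt_abs with (f1 := f2).
      * intros u Hu. apply H2. apply Hs in Hss.
        assert (Rabs (u - y) <= Rabs (s - y)); [|lra].
        revert Hu. unfold Rmin, Rmax. destruct (Rle_dec y s); intros; unfold Rabs;
          destruct (Rcase_abs (s - y)), (Rcase_abs (u - y)); lra.
      * intros u Hu. apply HM. apply Hs in Hss.
        assert (Rabs (u - y) <= Rabs (s - y)); [|lra].
        revert Hu. unfold Rmin, Rmax. destruct (Rle_dec y s); intros; unfold Rabs;
          destruct (Rcase_abs (s - y)), (Rcase_abs (u - y)); lra.
    + apply Hs in Hss. nra.
Qed.

Lemma ball_Rabs (x d y : R) : ball x d y -> - d < y - x < d.
Proof. intros H. now apply Rabs_lt_between. Qed.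

(** A quadratic remainder survives integration in a parameter, which a pointwise limit of difference
    quotients need not do. Every differentiation under an integral sign below goes through this
    criterion. *)
Lemma is_derive_quadratic (f : R -> R) y l M :
  (forall h, Rabs h <= 1 -> Rabs (f (y + h) - f y - h * l) <= M * h ^ 2) -> is_derive f y l.
Proof.
  intros H.
  assert (HM0 : 0 <= M).
  { assert (H1 := H 1 ltac:(rewrite Rabs_R1; lra)). assert (H2 := Rabs_pos (f (y + 1) - f y - 1 * l)). lra. }
  apply is_derive_Reals. intros eps Heps.
  assert (Hd : 0 < Rmin 1 (eps / (M + 1))).
  { apply Rmin_pos; [lra|]. apply Rdiv_lt_0_compat; lra. }
  exists (mkposreal _ Hd); simpl; intros h Hh0 Hh.
  assert (Hh1 : Rabs h < 1) by (eapply Rlt_le_trans; [exact Hh|apply Rmin_l]).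
  assert (Hh2 : Rabs h < eps / (M + 1)) by (eapply Rlt_le_trans; [exact Hh|apply Rmin_r]).
  replace ((f (y + h) - f y) / h - l) with ((f (y + h) - f y - h * l) / h) by (field; auto).
  unfold Rdiv. rewrite Rabs_mult, Rabs_inv.
  assert (Hp : 0 < Rabs h) by now apply Rabs_pos_lt.
  apply Rmult_lt_reg_r with (Rabs h); auto.
  rewrite Rmult_assoc, Rinv_l, Rmult_1_r by lra.
  eapply Rle_lt_trans; [apply H; lra|].
  rewrite <- (pow2_abs h).
  assert (Rabs h * (M + 1) < eps).
  { apply Rmult_lt_reg_r with (/ (M + 1)). apply Rinv_0_lt_compat; lra.
    rewrite Rmult_assoc, Rinv_r, Rmult_1_r by lra. exact Hh2. }
  nra.
Qed.

Lemma is_dC_quadratic f y l M :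
  (forall h, Rabs h <= 1 -> Cmod (f (y + h)%R - f y - RtoC h * l)%C <= M * h ^ 2) -> is_dC f y l.
Proof.
  intros H; split; apply is_derive_quadratic with M; intros h Hh; (eapply Rle_trans; [|apply H; exact Hh]).
  - eapply Rle_trans; [|apply abs_fst_Cmod]. simpl. right; f_equal; ring.
  - eapply Rle_trans; [|apply abs_snd_Cmod]. simpl. right; f_equal; ring.
Qed.

Lemma is_dC_zero_const f a b : (forall t, is_dC f t (RtoC 0)) -> f a = f b.
Proof.
  intros H. assert (H1 := is_dC_mvt_abs f (fun _ => RtoC 0) b a 0 ltac:(intros; apply H)
    ltac:(intros; cbv beta; rewrite Cmod_0; lra)).
  rewrite Rmult_0_l, Rmult_0_r in H1.
  assert (E : (f a - f b)%C = 0).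
  { apply Cmod_eq_0. apply Rle_antisym; auto. apply Cmod_ge_0. }
  replace (f a) with ((f a - f b) + f b)%C by ring. rewrite E; ring.
Qed.

Definition ccont (f : R -> C) : Prop :=
  forall t, continuous (fun s => fst (f s)) t /\ continuous (fun s => snd (f s)) t.

Lemma is_dC_ccont f f1 : (forall t, is_dC f t (f1 t)) -> ccont f.
Proof. intros H t; exact (is_dC_cont _ _ _ (H t)). Qed.

Lemma ccont_const c : ccont (fun _ => c).
Proof. intros t; split; apply continuous_const. Qed.

Lemma ccont_fst f t : ccont f -> continuous (fun s => fst (f s)) t.
Proof. intros H; exact (proj1 (H t)). Qed.

Lemma ccont_snd f t : ccont f -> continuous (fun s => snd (f s)) t.
Proof. intros H; exact (proj2 (H t)). Qed.

Lemma continuous_Rplus (f g : R -> R) t : continuous f t -> continuous g t ->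
  continuous (fun s => f s + g s) t.
Proof. exact (continuous_plus (K := R_AbsRing) (V := R_NormedModule) f g t). Qed.

Lemma continuous_Rminus (f g : R -> R) t : continuous f t -> continuous g t ->
  continuous (fun s => f s - g s) t.
Proof. exact (continuous_minus (K := R_AbsRing) (V := R_NormedModule) f g t). Qed.

Lemma continuous_Rmult (f g : R -> R) t : continuous f t -> continuous g t ->
  continuous (fun s => f s * g s) t.
Proof. exact (continuous_mult (K := R_AbsRing) f g t). Qed.

Lemma ccont_plus f g : ccont f -> ccont g -> ccont (fun s => f s + g s)%C.
Proof.
  intros H1 H2 t; split; simpl; apply continuous_Rplus; auto using ccont_fst, ccont_snd.
Qed.

Lemma ccont_mult f g : ccont f -> ccont g -> ccont (fun s => f s * g s)%C.
Proof.
  intros H1 H2 t; split; simpl.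
  - apply continuous_Rminus; apply continuous_Rmult; auto using ccont_fst, ccont_snd.
  - apply continuous_Rplus; apply continuous_Rmult; auto using ccont_fst, ccont_snd.
Qed.

Ltac ccont_tac := lazymatch goal with
  | |- ccont (fun s => Cplus (@?f s) (@?g s)) => apply (ccont_plus f g); ccont_tac
  | |- ccont (fun s => Cmult (@?f s) (@?g s)) => apply (ccont_mult f g); ccont_tac
  | |- ccont (fun _ => ?c) => apply (ccont_const c)
  | _ => auto
  end.

Lemma cont_bounded (f : R -> R) a b : (forall t, continuous f t) ->
  exists M, forall t, a <= t <= b -> Rabs (f t) <= M.
Proof.
  intros H. destruct (Rle_dec a b).
  - destruct (continuity_ab_maj (fun t => Rabs (f t)) a b) as [m [Hm _]]; auto.
    + intros c _. apply continuity_pt_filterlim.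
      apply (continuous_comp f Rabs); [apply H|apply continuous_Rabs].
    + exists (Rabs (f m)). auto.
  - exists 0; intros; lra.
Qed.

Lemma ccont_bounded f a b : ccont f -> exists M, forall t, a <= t <= b -> Cmod (f t) <= M.
Proof.
  intros H.
  destruct (cont_bounded (fun s => fst (f s)) a b) as [M1 H1]; [auto using ccont_fst|].
  destruct (cont_bounded (fun s => snd (f s)) a b) as [M2 H2]; [auto using ccont_snd|].
  exists (M1 + M2); intros t Ht. eapply Rle_trans; [apply Cmod_le_parts|].
  apply Rplus_le_compat; auto.
Qed.

Definition CInt (f : R -> C) (a b : R) : C :=
  (RInt (fun s => fst (f s)) a b, RInt (fun s => snd (f s)) a b).

Lemma ex_RInt_cont (f : R -> R) a b : (forall t, continuous f t) -> ex_RInt f a b.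
Proof. intros; apply (ex_RInt_continuous (V := R_CompleteNormedModule)); auto. Qed.

Lemma RInt_Rplus (f g : R -> R) a b : (forall t, continuous f t) -> (forall t, continuous g t) ->
  RInt (fun s => f s + g s) a b = RInt f a b + RInt g a b.
Proof.
  intros H1 H2. exact (RInt_plus (V := R_CompleteNormedModule) f g a b
    (ex_RInt_cont f a b H1) (ex_RInt_cont g a b H2)).
Qed.

Lemma RInt_Rscal (f : R -> R) a b l : (forall t, continuous f t) ->
  RInt (fun s => l * f s) a b = l * RInt f a b.
Proof.
  intros H1. exact (RInt_scal (V := R_CompleteNormedModule) f a b l (ex_RInt_cont f a b H1)).
Qed.

Lemma RInt_Rminus (f g : R -> R) a b : (forall t, continuous f t) -> (forall t, continuous g t) ->
  RInt (fun s => f s - g s) a b = RInt f a b - RInt g a b.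
Proof.
  intros H1 H2. exact (RInt_minus (V := R_CompleteNormedModule) f g a b
    (ex_RInt_cont f a b H1) (ex_RInt_cont g a b H2)).
Qed.

Lemma RInt_Rconst a b l : RInt (fun _ => l) a b = l * (b - a).
Proof. rewrite (RInt_const (V := R_CompleteNormedModule)). apply Rmult_comm. Qed.

Lemma RInt_RChasles (f : R -> R) a b c : (forall t, continuous f t) ->
  RInt f a b + RInt f b c = RInt f a c.
Proof.
  intros H. exact (RInt_Chasles (V := R_CompleteNormedModule) f a b c (ex_RInt_cont f a b H) (ex_RInt_cont f b c H)).
Qed.

Lemma continuous_Rscal (f : R -> R) l t : continuous f t -> continuous (fun s => l * f s) t.
Proof. intros; apply continuous_Rmult; auto. apply continuous_const. Qed.

Lemma CInt_plus f g a b : ccont f -> ccont g ->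
  CInt (fun s => f s + g s)%C a b = (CInt f a b + CInt g a b)%C.
Proof.
  intros H1 H2; apply injective_projections; simpl.
  - apply (RInt_Rplus (fun s => fst (f s)) (fun s => fst (g s))); auto using ccont_fst.
  - apply (RInt_Rplus (fun s => snd (f s)) (fun s => snd (g s))); auto using ccont_snd.
Qed.

Lemma CInt_scal c g a b : ccont g -> CInt (fun s => c * g s)%C a b = (c * CInt g a b)%C.
Proof.
  intros H.
  apply injective_projections; simpl.
  - rewrite (RInt_Rminus (fun s => fst c * fst (g s)) (fun s => snd c * snd (g s)));
      auto using continuous_Rscal, ccont_fst, ccont_snd.
    rewrite (RInt_Rscal (fun s => fst (g s))), (RInt_Rscal (fun s => snd (g s)));
      auto using ccont_fst, ccont_snd.
  - rewrite (RInt_Rplus (fun s => fst c * snd (g s)) (fun s => snd c * fst (g s)));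
      auto using continuous_Rscal, ccont_fst, ccont_snd.
    rewrite (RInt_Rscal (fun s => fst (g s))), (RInt_Rscal (fun s => snd (g s)));
      auto using ccont_fst, ccont_snd.
Qed.

Lemma RInt_abs_bound (f : R -> R) a b M : (forall t, continuous f t) ->
  (forall t, Rmin a b <= t <= Rmax a b -> Rabs (f t) <= M) -> Rabs (RInt f a b) <= M * Rabs (b - a).
Proof.
  assert (Hm : forall a b, a <= b -> (forall t, continuous f t) ->
    (forall t, a <= t <= b -> Rabs (f t) <= M) -> Rabs (RInt f a b) <= M * (b - a)).
  { clear. intros a b Hab Hc HM. rewrite Rmult_comm.
    apply (norm_RInt_le_const (V := R_NormedModule) f a b (RInt f a b) M); auto.
    apply (RInt_correct (V := R_CompleteNormedModule)). now apply ex_RInt_cont. }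
  intros Hc HM. destruct (Rle_dec a b).
  - rewrite Rmin_left, Rmax_right in HM by lra. rewrite (Rabs_right (b - a)) by lra. auto.
  - rewrite Rmin_right, Rmax_left in HM by lra. rewrite (Rabs_left (b - a)) by lra.
    rewrite <- (opp_RInt_swap (V := R_CompleteNormedModule)) by now apply ex_RInt_cont.
    unfold opp; simpl. rewrite Rabs_Ropp. replace (- (b - a)) with (a - b) by ring. apply Hm; auto; lra.
Qed.

Lemma CInt_bound f a b M : ccont f ->
  (forall t, Rmin a b <= t <= Rmax a b -> Cmod (f t) <= M) -> Cmod (CInt f a b) <= 2 * (M * Rabs (b - a)).
Proof.
  intros Hc HM. apply Cmod_bound_parts; simpl; apply RInt_abs_bound; auto using ccont_fst, ccont_snd.
  - intros; eapply Rle_trans; [apply abs_fst_Cmod|auto].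
  - intros; eapply Rle_trans; [apply abs_snd_Cmod|auto].
Qed.

Lemma is_derive_RInt_cont (f : R -> R) a t : (forall t, continuous f t) ->
  is_derive (fun b => RInt f a b) t (f t).
Proof.
  intros H. apply (is_derive_RInt (V := R_NormedModule) f) with a; [|apply H].
  apply filter_forall; intros. now apply (RInt_correct (V := R_CompleteNormedModule)), ex_RInt_cont.
Qed.

Lemma is_dC_CInt f a t : ccont f -> is_dC (fun b => CInt f a b) t (f t).
Proof.
  intros H; split; simpl.
  - apply (is_derive_RInt_cont (fun s => fst (f s))); auto using ccont_fst.
  - apply (is_derive_RInt_cont (fun s => snd (f s))); auto using ccont_snd.
Qed.

Lemma CInt_point f a : CInt f a a = RtoC 0.
Proof. unfold CInt. now rewrite !RInt_point. Qed.

Lemma CInt_derive f f1 a b : (forall t, is_dC f t (f1 t)) -> ccont f1 -> CInt f1 a b = (f b - f a)%C.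
Proof.
  intros H Hc.
  assert (E := is_dC_zero_const (fun t => CInt f1 a t - f t)%C b a).
  simpl in E. rewrite CInt_point in E.
  replace (CInt f1 a b) with ((CInt f1 a b - f b) + f b)%C by ring. rewrite E.
  - ring.
  - intros t. eapply is_dC_eq; [apply is_dC_minus; [now apply is_dC_CInt|apply H]|ring].
Qed.

Lemma CInt_ext f g a b : (forall t, f t = g t) -> CInt f a b = CInt g a b.
Proof. intros H; replace g with f; auto. now apply functional_extensionality. Qed.

(** The integrand's Taylor remainder in the parameter is integrated, and [is_dC_quadratic] applies
    to the result. *)
Lemma is_dC_CInt_param (K K1 K2 : R -> R -> C) a b y M :
  (forall y, ccont (K y)) -> (forall y, ccont (K1 y)) ->
  (forall y s, is_dC (fun z => K z s) y (K1 y s)) ->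
  (forall y s, is_dC (fun z => K1 z s) y (K2 y s)) ->
  (forall z s, Rabs (z - y) <= 1 -> Rmin a b <= s <= Rmax a b -> Cmod (K2 z s) <= M) ->
  is_dC (fun z => CInt (K z) a b) y (CInt (K1 y) a b).
Proof.
  intros Hc Hc1 H1 H2 HM.
  apply is_dC_quadratic with (2 * (4 * M * Rabs (b - a))).
  intros h Hh.
  replace (_ - _)%C with (CInt (fun s => (K (y + h)%R s + (-1) * K y s) + (- RtoC h) * K1 y s)%C a b).
  - eapply Rle_trans; [apply CInt_bound with (M := 4 * (M * h ^ 2))|].
    + ccont_tac.
    + intros s Hs.
      eapply Rle_trans; [|apply (is_dC_taylor (fun z => K z s) (fun z => K1 z s) (fun z => K2 z s) y M); auto].
      right; f_equal; ring.
    + right; ring.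
  - rewrite !CInt_plus, !CInt_scal;
      try solve [ccont_tac].
    ring.
Qed.

(** * Weighted classes of smooth families *)

(** Families of functions on the plane; a weight bounds a whole family uniformly in its index. *)
Definition fam (I : Type) := I -> R -> R -> C.
Definition Dt {I} (f : fam I) : fam I := fun i => dt (f i).
Definition Dx {I} (f : fam I) : fam I := fun i => dx (f i).

Definition dif {I} (f : fam I) : Prop := forall i t x,
  is_dC (fun s => f i s x) t (Dt f i t x) /\ is_dC (fun y => f i t y) x (Dx f i t x).

(** Both partial derivatives are taken at each level, so every word in [Dt] and [Dx] of length at
    most [n] is covered and the Leibniz rule can be iterated without commuting derivatives. *)
Fixpoint Cn {I} (W : fam I -> Prop) (n : nat) (f : fam I) : Prop :=
  W f /\ match n with
         | O => True
         | S m => dif f /\ Cn W m (Dt f) /\ Cn W m (Dx f)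
         end.

Definition Cinf {I} (W : fam I -> Prop) (f : fam I) : Prop := forall n, Cn W n f.

Section Weights.
Context {I : Type}.
Implicit Types (f g : fam I) (W : fam I -> Prop).

Definition Wloc f := forall T X, exists M, forall i t x,
  Rabs t <= T -> Rabs x <= X -> Cmod (f i t x) <= M.
Definition Wtame f := forall T, exists M k, forall i t x,
  Rabs t <= T -> Cmod (f i t x) <= M * (1 + Rabs x) ^ k.
Definition Wrapid f := forall T k, exists M, forall i t x,
  Rabs t <= T -> (1 + Rabs x) ^ k * Cmod (f i t x) <= M.
(** This class and the next are made to be multiplied: a factor vanishing for [t] outside [D] times
    a factor that decays in [x] only for [t] in [D] decays everywhere. The datum of the
    counterexample is such a product. *)
Definition Wsupp (D : R -> Prop) f := forall T, exists M, forall i t x,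
  Rabs t <= T -> Cmod (f i t x) <= M /\ (~ D t -> f i t x = RtoC 0).
Definition Wrapid_on (D : R -> Prop) f := forall T k, exists M, forall i t x,
  Rabs t <= T -> D t -> (1 + Rabs x) ^ k * Cmod (f i t x) <= M.

Definition Wadd W := forall f g, W f -> W g -> W (fun i t x => f i t x + g i t x)%C.
Definition Wmul (W1 W2 W3 : fam I -> Prop) :=
  forall f g, W1 f -> W2 g -> W3 (fun i t x => f i t x * g i t x)%C.

Lemma w_ge1 x : 1 <= 1 + Rabs x.
Proof. assert (H := Rabs_pos x); lra. Qed.

Lemma wpow_ge1 x k : 1 <= (1 + Rabs x) ^ k.
Proof. apply pow_R1_Rle, w_ge1. Qed.

Lemma wpow_mono x k l : (k <= l)%nat -> (1 + Rabs x) ^ k <= (1 + Rabs x) ^ l.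
Proof. intros; apply Rle_pow; auto. apply w_ge1. Qed.

Lemma Wloc_add : Wadd Wloc.
Proof.
  intros f g H1 H2 T X. destruct (H1 T X) as [M1 K1], (H2 T X) as [M2 K2].
  exists (M1 + M2); intros. eapply Rle_trans; [apply Cmod_triangle|]. apply Rplus_le_compat; auto.
Qed.

Lemma Wloc_mul : Wmul Wloc Wloc Wloc.
Proof.
  intros f g H1 H2 T X. destruct (H1 T X) as [M1 K1], (H2 T X) as [M2 K2].
  exists (M1 * M2); intros. rewrite Cmod_mult.
  apply Rmult_le_compat; auto using Cmod_ge_0.
Qed.

Lemma Wtame_pos f : Wtame f -> forall T, exists M k, 0 <= M /\ forall i t x,
  Rabs t <= T -> Cmod (f i t x) <= M * (1 + Rabs x) ^ k.
Proof.
  intros H T. destruct (H T) as [M [k K]]. exists (Rabs M), k; split; [apply Rabs_pos|].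
  intros; eapply Rle_trans; [apply K; auto|].
  apply Rmult_le_compat_r; [|apply Rle_abs]. assert (Hw := wpow_ge1 x k); lra.
Qed.

Lemma Wtame_add : Wadd Wtame.
Proof.
  intros f g H1 H2 T. destruct (Wtame_pos f H1 T) as [M1 [k1 [P1 K1]]], (Wtame_pos g H2 T) as [M2 [k2 [P2 K2]]].
  exists (M1 + M2), (k1 + k2)%nat; intros. eapply Rle_trans; [apply Cmod_triangle|].
  rewrite Rmult_plus_distr_r. apply Rplus_le_compat.
  - eapply Rle_trans; [apply K1; auto|]. apply Rmult_le_compat_l; auto. apply wpow_mono; lia.
  - eapply Rle_trans; [apply K2; auto|]. apply Rmult_le_compat_l; auto. apply wpow_mono; lia.
Qed.

Lemma Wtame_mul : Wmul Wtame Wtame Wtame.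
Proof.
  intros f g H1 H2 T. destruct (H1 T) as [M1 [k1 K1]], (H2 T) as [M2 [k2 K2]].
  exists (M1 * M2), (k1 + k2)%nat; intros. rewrite Cmod_mult, pow_add.
  replace (M1 * M2 * _) with ((M1 * (1 + Rabs x) ^ k1) * (M2 * (1 + Rabs x) ^ k2)) by ring.
  apply Rmult_le_compat; auto using Cmod_ge_0.
Qed.

Lemma Wrapid_add : Wadd Wrapid.
Proof.
  intros f g H1 H2 T k. destruct (H1 T k) as [M1 K1], (H2 T k) as [M2 K2].
  exists (M1 + M2); intros.
  eapply Rle_trans; [apply Rmult_le_compat_l; [|apply Cmod_triangle]|].
  - assert (Hw := wpow_ge1 x k); lra.
  - rewrite Rmult_plus_distr_l. apply Rplus_le_compat; auto.
Qed.

Lemma Wtame_Wrapid : Wmul Wtame Wrapid Wrapid.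
Proof.
  intros f g H1 H2 T k. destruct (Wtame_pos f H1 T) as [M1 [k1 [P1 K1]]], (H2 T (k + k1)%nat) as [M2 K2].
  exists (M1 * M2); intros i t x Ht. rewrite Cmod_mult.
  specialize (K1 i t x Ht). specialize (K2 i t x Ht). rewrite pow_add in K2.
  assert (Hw := wpow_ge1 x k). assert (Hg := Cmod_ge_0 (g i t x)).
  replace ((1 + Rabs x) ^ k * (Cmod (f i t x) * Cmod (g i t x)))
    with (Cmod (f i t x) * ((1 + Rabs x) ^ k * Cmod (g i t x))) by ring.
  eapply Rle_trans; [apply Rmult_le_compat_r; [|exact K1]|].
  - apply Rmult_le_pos; lra.
  - rewrite Rmult_assoc. apply Rmult_le_compat_l; auto.
    eapply Rle_trans; [|exact K2]. right; ring.
Qed.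

Lemma Wrapid_on_add D : Wadd (Wrapid_on D).
Proof.
  intros f g H1 H2 T k. destruct (H1 T k) as [M1 K1], (H2 T k) as [M2 K2].
  exists (M1 + M2); intros.
  eapply Rle_trans; [apply Rmult_le_compat_l; [|apply Cmod_triangle]|].
  - assert (Hw := wpow_ge1 x k); lra.
  - rewrite Rmult_plus_distr_l. apply Rplus_le_compat; auto.
Qed.

Lemma Wtame_Wrapid_on D : Wmul Wtame (Wrapid_on D) (Wrapid_on D).
Proof.
  intros f g H1 H2 T k. destruct (Wtame_pos f H1 T) as [M1 [k1 [P1 K1]]], (H2 T (k + k1)%nat) as [M2 K2].
  exists (M1 * M2); intros i t x Ht HD. rewrite Cmod_mult.
  specialize (K1 i t x Ht). specialize (K2 i t x Ht HD). rewrite pow_add in K2.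
  assert (Hw := wpow_ge1 x k). assert (Hg := Cmod_ge_0 (g i t x)).
  replace ((1 + Rabs x) ^ k * (Cmod (f i t x) * Cmod (g i t x)))
    with (Cmod (f i t x) * ((1 + Rabs x) ^ k * Cmod (g i t x))) by ring.
  eapply Rle_trans; [apply Rmult_le_compat_r; [|exact K1]|].
  - apply Rmult_le_pos; lra.
  - rewrite Rmult_assoc. apply Rmult_le_compat_l; auto.
    eapply Rle_trans; [|exact K2]. right; ring.
Qed.

Lemma Wsupp_Wrapid_on D : Wmul (Wsupp D) (Wrapid_on D) Wrapid.
Proof.
  intros f g H1 H2 T k. destruct (H1 T) as [M1 K1], (H2 T k) as [M2 K2].
  exists (Rabs M1 * Rabs M2); intros i t x Ht. rewrite Cmod_mult.
  destruct (K1 i t x Ht) as [A B]. destruct (classic (D t)) as [d|d].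
  - specialize (K2 i t x Ht d).
    replace ((1 + Rabs x) ^ k * (Cmod (f i t x) * Cmod (g i t x)))
    with (Cmod (f i t x) * ((1 + Rabs x) ^ k * Cmod (g i t x))) by ring.
    apply Rmult_le_compat; auto using Cmod_ge_0.
    + apply Rmult_le_pos; auto using Cmod_ge_0. assert (Hw := wpow_ge1 x k); lra.
    + eapply Rle_trans; [exact A|apply Rle_abs].
    + eapply Rle_trans; [exact K2|apply Rle_abs].
  - rewrite B, Cmod_0 by auto. rewrite Rmult_0_l, Rmult_0_r. apply Rmult_le_pos; apply Rabs_pos.
Qed.

Lemma Wloc_Wtame f : Wtame f -> Wloc f.
Proof.
  intros H T X. destruct (Wtame_pos f H T) as [M [k [P K]]].
  exists (M * (1 + X) ^ k); intros. eapply Rle_trans; [apply K; auto|].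
  apply Rmult_le_compat_l; auto. apply pow_incr. assert (Hw := w_ge1 x); lra.
Qed.

Lemma Wtame_Wrapid_weak f : Wrapid f -> Wtame f.
Proof.
  intros H T. destruct (H T O) as [M K]. exists M, O; intros. simpl in *.
  rewrite Rmult_1_r. rewrite <- (Rmult_1_l (Cmod _)); auto.
Qed.

Lemma Wtame_const c : Wtame (fun _ _ _ => c).
Proof. intros T; exists (Cmod c), O; intros; simpl; lra. Qed.

Lemma Wloc_const c : Wloc (fun _ _ _ => c).
Proof. apply Wloc_Wtame, Wtame_const. Qed.

Lemma Dt_eq f ft : (forall i t x, is_dC (fun s => f i s x) t (ft i t x)) -> Dt f = ft.
Proof.
  intros H; apply functional_extensionality; intros i; apply functional_extensionality; intros t;
  apply functional_extensionality; intros x. apply dC_is_dC, H.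
Qed.

Lemma Dx_eq f fx : (forall i t x, is_dC (fun y => f i t y) x (fx i t x)) -> Dx f = fx.
Proof.
  intros H; apply functional_extensionality; intros i; apply functional_extensionality; intros t;
  apply functional_extensionality; intros x. apply dC_is_dC, H.
Qed.

Lemma Cn_W W n f : Cn W n f -> W f.
Proof. destruct n; simpl; tauto. Qed.

Lemma Cn_intro W n f ft fx : W f ->
  (forall i t x, is_dC (fun s => f i s x) t (ft i t x)) ->
  (forall i t x, is_dC (fun y => f i t y) x (fx i t x)) ->
  Cn W n ft -> Cn W n fx -> Cn W (S n) f.
Proof.
  intros H H1 H2 H3 H4. simpl.
  split; [auto|split]; [|rewrite (Dt_eq f ft H1), (Dx_eq f fx H2); auto].
  intros i t x. rewrite (Dt_eq f ft H1), (Dx_eq f fx H2). auto.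
Qed.

Lemma Cn_S W n f : Cn W (S n) f -> Cn W n f.
Proof.
  revert f; induction n; intros f H.
  - simpl in *; tauto.
  - destruct H as [H1 [H2 [H3 H4]]]. exact (conj H1 (conj H2 (conj (IHn _ H3) (IHn _ H4)))).
Qed.

Lemma Cn_weaken W W' n f : (forall f, W f -> W' f) -> Cn W n f -> Cn W' n f.
Proof.
  intros H; revert f; induction n; intros f Hf.
  - destruct Hf; split; auto.
  - destruct Hf as [H1 [H2 [H3 H4]]]. exact (conj (H _ H1) (conj H2 (conj (IHn _ H3) (IHn _ H4)))).
Qed.

Lemma Cinf_weaken W W' f : (forall f, W f -> W' f) -> Cinf W f -> Cinf W' f.
Proof. intros H Hf n; eapply Cn_weaken; eauto. Qed.

Lemma Cinf_W W f : Cinf W f -> W f.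
Proof. intros H; exact (Cn_W W O f (H O)). Qed.

Lemma Cinf_dif W f : Cinf W f -> dif f.
Proof. intros H; apply (H 1%nat). Qed.

Lemma Cinf_is_dC_t W f i t x : Cinf W f -> is_dC (fun s => f i s x) t (Dt f i t x).
Proof. intros H; exact (proj1 (Cinf_dif W f H i t x)). Qed.

Lemma Cinf_is_dC_x W f i t x : Cinf W f -> is_dC (fun y => f i t y) x (Dx f i t x).
Proof. intros H; exact (proj2 (Cinf_dif W f H i t x)). Qed.

Lemma Cinf_Dt W f : Cinf W f -> Cinf W (Dt f).
Proof. intros H n. exact (proj1 (proj2 (proj2 (H (S n))))). Qed.

Lemma Cinf_Dx W f : Cinf W f -> Cinf W (Dx f).
Proof. intros H n. exact (proj2 (proj2 (proj2 (H (S n))))). Qed.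

Lemma Cinf_intro W f ft fx : W f ->
  (forall i t x, is_dC (fun s => f i s x) t (ft i t x)) ->
  (forall i t x, is_dC (fun y => f i t y) x (fx i t x)) ->
  Cinf W ft -> Cinf W fx -> Cinf W f.
Proof.
  intros; intros n. destruct n.
  - split; auto.
  - eapply Cn_intro; eauto.
Qed.

Lemma Cinf_ext W f g : (forall i t x, f i t x = g i t x) -> Cinf W f -> Cinf W g.
Proof.
  intros E H. replace g with f; auto.
  apply functional_extensionality; intros i; apply functional_extensionality; intros t;
  apply functional_extensionality; intros x; auto.
Qed.

Lemma Cn_plus W n f g : Wadd W -> Cn W n f -> Cn W n g -> Cn W n (fun i t x => f i t x + g i t x)%C.
Proof.
  intros HW; revert f g; induction n; intros f g Hf Hg.
  - split; auto. apply HW; [apply Hf|apply Hg].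
  - destruct Hf as [F1 [F2 [F3 F4]]], Hg as [G1 [G2 [G3 G4]]].
    apply (Cn_intro W n _ (fun i t x => Dt f i t x + Dt g i t x)%C
      (fun i t x => Dx f i t x + Dx g i t x)%C); auto; intros i t x.
    + exact (is_dC_plus _ _ _ _ _ (proj1 (F2 i t x)) (proj1 (G2 i t x))).
    + exact (is_dC_plus _ _ _ _ _ (proj2 (F2 i t x)) (proj2 (G2 i t x))).
Qed.

Lemma Cn_mul W1 W2 W3 n f g : Wadd W3 -> Wmul W1 W2 W3 -> Cn W1 n f -> Cn W2 n g ->
  Cn W3 n (fun i t x => f i t x * g i t x)%C.
Proof.
  intros HW Hm; revert f g; induction n; intros f g Hf Hg.
  - split; auto. apply Hm; [apply Hf|apply Hg].
  - assert (Hf' := Cn_S _ _ _ Hf). assert (Hg' := Cn_S _ _ _ Hg).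
    destruct Hf as [F1 [F2 [F3 F4]]], Hg as [G1 [G2 [G3 G4]]].
    apply (Cn_intro W3 n _ (fun i t x => Dt f i t x * g i t x + f i t x * Dt g i t x)%C
      (fun i t x => Dx f i t x * g i t x + f i t x * Dx g i t x)%C); auto.
    + intros i t x. exact (is_dC_mult _ _ _ _ _ (proj1 (F2 i t x)) (proj1 (G2 i t x))).
    + intros i t x. exact (is_dC_mult _ _ _ _ _ (proj2 (F2 i t x)) (proj2 (G2 i t x))).
    + apply (Cn_plus W3 n (fun i t x => Dt f i t x * g i t x)%C (fun i t x => f i t x * Dt g i t x)%C); auto.
    + apply (Cn_plus W3 n (fun i t x => Dx f i t x * g i t x)%C (fun i t x => f i t x * Dx g i t x)%C); auto.
Qed.

Lemma Cinf_plus W f g : Wadd W -> Cinf W f -> Cinf W g -> Cinf W (fun i t x => f i t x + g i t x)%C.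
Proof. intros HW Hf Hg n; now apply Cn_plus. Qed.

Lemma Cinf_mul W1 W2 W3 f g : Wadd W3 -> Wmul W1 W2 W3 -> Cinf W1 f -> Cinf W2 g ->
  Cinf W3 (fun i t x => f i t x * g i t x)%C.
Proof. intros HW Hm Hf Hg n; now apply (Cn_mul W1 W2 W3). Qed.

Lemma Cn_const W n c : (forall c, W (fun _ _ _ => c)) -> Cn W n (fun _ _ _ => c).
Proof.
  intros H; revert c; induction n; intros c; [split; auto|].
  apply (Cn_intro W n _ (fun _ _ _ => RtoC 0) (fun _ _ _ => RtoC 0)); auto;
  intros; apply is_dC_const.
Qed.

Lemma Cn_zero W n : W (fun _ _ _ => RtoC 0) -> Cn W n (fun _ _ _ => RtoC 0).
Proof.
  intros H; induction n; [split; auto|].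
  apply (Cn_intro W n _ (fun _ _ _ => RtoC 0) (fun _ _ _ => RtoC 0)); auto;
  intros; apply is_dC_const.
Qed.

Lemma Cinf_const c : Cinf Wtame (fun _ _ _ => c).
Proof. intros n; apply Cn_const, Wtame_const. Qed.

Lemma Cinf_x : Cinf Wtame (fun (_ : I) _ x => RtoC x).
Proof.
  apply (Cinf_intro Wtame _ (fun _ _ _ => RtoC 0) (fun _ _ _ => RtoC 1)); try apply Cinf_const.
  - intros T; exists 1, 1%nat; intros. rewrite Cmod_R. simpl. assert (H1 := Rabs_pos x). lra.
  - intros; apply is_dC_const.
  - intros; apply is_dC_id.
Qed.

Lemma Cinf_t : Cinf Wtame (fun (_ : I) t _ => RtoC t).
Proof.
  apply (Cinf_intro Wtame _ (fun _ _ _ => RtoC 1) (fun _ _ _ => RtoC 0)); try apply Cinf_const.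
  - intros T; exists T, 0%nat; intros. rewrite Cmod_R. simpl. lra.
  - intros; apply is_dC_id.
  - intros; apply is_dC_const.
Qed.

Lemma Cinf_tame_rapid f g : Cinf Wtame f -> Cinf Wrapid g -> Cinf Wrapid (fun i t x => f i t x * g i t x)%C.
Proof. exact (Cinf_mul Wtame Wrapid Wrapid f g Wrapid_add Wtame_Wrapid). Qed.

(** Each derivative of the exponential is a derivative of [g] times the same exponential, so the
    zeroth-order bound is the only estimate on it. The exponent may live in a different class
    [Wa]. *)
Lemma Cn_exp Wa W n g : Wadd W -> Wmul Wa W W -> Cinf Wa g -> W (fun i t x => cexp (g i t x)) ->
  Cn W n (fun i t x => cexp (g i t x)).
Proof.
  intros HW Hm Hg Hb; induction n; [split; auto|].
  apply (Cn_intro W n _ (fun i t x => Dt g i t x * cexp (g i t x))%C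
    (fun i t x => Dx g i t x * cexp (g i t x))%C); auto.
  - intros; exact (is_dC_cexp _ _ _ (Cinf_is_dC_t Wa g i t x Hg)).
  - intros; exact (is_dC_cexp _ _ _ (Cinf_is_dC_x Wa g i t x Hg)).
  - apply (Cn_mul Wa W W); auto. now apply Cinf_Dt.
  - apply (Cn_mul Wa W W); auto. now apply Cinf_Dx.
Qed.

Lemma Cinf_exp Wa W g : Wadd W -> Wmul Wa W W -> Cinf Wa g -> W (fun i t x => cexp (g i t x)) ->
  Cinf W (fun i t x => cexp (g i t x)).
Proof. intros; intros n; eapply Cn_exp; eauto. Qed.

Lemma Wloc_exp g : Wloc g -> Wloc (fun i t x => cexp (g i t x)).
Proof.
  intros H T X. destruct (H T X) as [M K]. exists (exp M); intros. rewrite Cmod_cexp.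
  assert (Hf := abs_fst_Cmod (g i t x)). assert (Hk := K i t x H0 H1).
  destruct (Rle_lt_or_eq_dec (fst (g i t x)) M) as [h|h].
  - eapply Rle_trans; [apply Rle_abs|]. lra.
  - left; now apply exp_increasing.
  - rewrite h; lra.
Qed.

Lemma Cinf0_exp g : Cinf Wloc g -> Cinf Wloc (fun i t x => cexp (g i t x)).
Proof.
  intros H; apply (Cinf_exp Wloc Wloc); auto using Wloc_add, Wloc_mul. apply Wloc_exp. exact (Cinf_W _ _ H).
Qed.

Lemma Cn_inv W n f : Wadd W -> Wmul W W W -> (forall c, W (fun _ _ _ => c)) -> Cinf W f ->
  (forall i t x, f i t x <> RtoC 0) -> W (fun i t x => / f i t x)%C ->
  Cn W n (fun i t x => / f i t x)%C.
Proof.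
  intros HW Hm Hc Hf Hn Hb; induction n; [split; auto|].
  assert (Hq : forall h, Cn W n h -> Cn W n (fun i t x => - h i t x * (/ f i t x * / f i t x))%C).
  { intros h Hh. apply (Cn_mul W W W n (fun i t x => - h i t x)%C (fun i t x => / f i t x * / f i t x)%C); auto.
    - replace (fun i t x => - h i t x)%C with (fun i t x => (-1)%C * h i t x)%C.
      + apply (Cn_mul W W W n (fun _ _ _ => (-1)%C)); auto. now apply Cn_const.
      + do 3 (apply functional_extensionality; intros). ring.
    - apply (Cn_mul W W W); auto. }
  apply (Cn_intro W n _ (fun i t x => - Dt f i t x * (/ f i t x * / f i t x))%C
    (fun i t x => - Dx f i t x * (/ f i t x * / f i t x))%C); auto.
  - intros; exact (is_dC_inv _ _ _ (Cinf_is_dC_t W f i t x Hf) (Hn i t x)).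
  - intros; exact (is_dC_inv _ _ _ (Cinf_is_dC_x W f i t x Hf) (Hn i t x)).
  - apply Hq. now apply Cinf_Dt.
  - apply Hq. now apply Cinf_Dx.
Qed.

Lemma Cinf0_inv f : Cinf Wloc f -> (forall i t x, f i t x <> RtoC 0) ->
  Wloc (fun i t x => / f i t x)%C -> Cinf Wloc (fun i t x => / f i t x)%C.
Proof. intros; intros n; apply Cn_inv; auto using Wloc_add, Wloc_mul, Wloc_const. Qed.

Lemma Wloc_of_x (h : R -> C) : ccont h -> Wloc (fun (_ : I) _ x => h x).
Proof.
  intros H T X. destruct (ccont_bounded h (- X) X H) as [M HM]. exists M; intros.
  apply HM. now apply Rabs_le_between.
Qed.

Lemma Wloc_of_t (h : R -> C) : ccont h -> Wloc (fun (_ : I) t _ => h t).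
Proof.
  intros H T X. destruct (ccont_bounded h (- T) T H) as [M HM]. exists M; intros.
  apply HM. now apply Rabs_le_between.
Qed.

Lemma Cinf0_ccont_t f i x : Cinf Wloc f -> ccont (fun t => f i t x).
Proof. intros H; apply (is_dC_ccont _ (fun t => Dt f i t x)). intros t; exact (Cinf_is_dC_t Wloc f i t x H). Qed.

Lemma Cinf0_ccont_x f i t : Cinf Wloc f -> ccont (fun x => f i t x).
Proof. intros H; apply (is_dC_ccont _ (fun x => Dx f i t x)). intros x; exact (Cinf_is_dC_x Wloc f i t x H). Qed.

(** Joint continuity is not part of [Cn]; it follows from local bounds on the two partial
    derivatives, moving one variable at a time. *)
Lemma Cinf0_cont2 f i : Cinf Wloc f -> cont2 (f i).
Proof.
  intros H t x eps Heps.
  destruct (Cinf_W _ _ (Cinf_Dt _ _ H) (Rabs t + 1) (Rabs x + 1)) as [M1 K1].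
  destruct (Cinf_W _ _ (Cinf_Dx _ _ H) (Rabs t + 1) (Rabs x + 1)) as [M2 K2].
  set (M := Rabs M1 + Rabs M2 + 1).
  assert (HM : 0 < M) by (assert (h1 := Rabs_pos M1); assert (h2 := Rabs_pos M2); unfold M; lra).
  assert (Hd : 0 < eps / (4 * M)) by (apply Rdiv_lt_0_compat; lra).
  exists (Rmin 1 (eps / (4 * M))); split; [apply Rmin_pos; lra|].
  intros t' x' Ht Hx.
  assert (Ht1 := Rlt_le_trans _ _ _ Ht (Rmin_l _ _)). assert (Ht2 := Rlt_le_trans _ _ _ Ht (Rmin_r _ _)).
  assert (Hx1 := Rlt_le_trans _ _ _ Hx (Rmin_l _ _)). assert (Hx2 := Rlt_le_trans _ _ _ Hx (Rmin_r _ _)).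
  assert (Hbox : forall a a' b, Rabs (a' - a) < 1 -> Rmin a a' <= b <= Rmax a a' -> Rabs b <= Rabs a + 1).
  { intros a a' b Ha. unfold Rmin, Rmax. destruct (Rle_dec a a'); intros; revert Ha;
    unfold Rabs; destruct (Rcase_abs (a' - a)), (Rcase_abs a), (Rcase_abs b); lra. }
  replace (Cminus (f i t' x') (f i t x))
    with ((f i t' x' - f i t x') + (f i t x' - f i t x))%C by ring.
  eapply Rle_lt_trans; [apply Cmod_triangle|].
  assert (A1 : Cmod (f i t' x' - f i t x') <= 2 * (M * Rabs (t' - t))).
  { apply (is_dC_mvt_abs (fun s => f i s x') (fun s => Dt f i s x') t t' M).
    - intros s _. exact (Cinf_is_dC_t Wloc f i s x' H).
    - intros s Hs. eapply Rle_trans; [apply K1|].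
      + eapply Hbox; eauto.
      + apply (Hbox x x' x'); auto. split; [apply Rmin_r|apply Rmax_r].
      + unfold M. assert (h1 := Rle_abs M1); assert (h2 := Rabs_pos M2). lra. }
  assert (A2 : Cmod (f i t x' - f i t x) <= 2 * (M * Rabs (x' - x))).
  { apply (is_dC_mvt_abs (fun s => f i t s) (fun s => Dx f i t s) x x' M).
    - intros s _. exact (Cinf_is_dC_x Wloc f i t s H).
    - intros s Hs. eapply Rle_trans; [apply K2|].
      + lra.
      + eapply Hbox; eauto.
      + unfold M. assert (h1 := Rle_abs M2); assert (h2 := Rabs_pos M1). lra. }
  assert (B1 : M * Rabs (t' - t) < eps / 4).
  { apply Rlt_le_trans with (M * (eps / (4 * M))). now apply Rmult_lt_compat_l. right; field; lra. }
  assert (B2 : M * Rabs (x' - x) < eps / 4).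
  { apply Rlt_le_trans with (M * (eps / (4 * M))). now apply Rmult_lt_compat_l. right; field; lra. }
  lra.
Qed.

(** * Primitives in [t] and Hadamard quotients in [x] *)

Definition prim (a : R) f : fam I := fun i t x => CInt (fun s => f i s x) a t.

Lemma Rabs_le_1_shift x z : Rabs (z - x) <= 1 -> Rabs z <= Rabs x + 1.
Proof.
  intros. replace z with (z - x + x) by ring. eapply Rle_trans; [apply Rabs_triang|]. lra.
Qed.

Lemma between_abs a b s : Rmin a b <= s <= Rmax a b -> Rabs s <= Rabs a + Rabs b.
Proof.
  unfold Rmin, Rmax; destruct (Rle_dec a b); intros;
    unfold Rabs; destruct (Rcase_abs b), (Rcase_abs a), (Rcase_abs s); lra.
Qed.

Lemma Wloc_prim a f : Cinf Wloc f -> Wloc (prim a f).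
Proof.
  intros H T X; destruct (Cinf_W _ _ H (Rabs a + T) X) as [M K].
  exists (2 * (Rabs M * (T + Rabs a))); intros i t x Ht Hx; unfold prim.
  eapply Rle_trans; [apply CInt_bound with (M := Rabs M); [now apply Cinf0_ccont_t|]|].
  - intros s Hs; eapply Rle_trans; [apply K; auto|apply Rle_abs].
    apply between_abs in Hs; lra.
  - apply Rmult_le_compat_l; [lra|]; apply Rmult_le_compat_l; [apply Rabs_pos|].
    eapply Rle_trans; [apply Rabs_triang|]; rewrite Rabs_Ropp; lra.
Qed.

(** The derivative in [t] is [f] itself and the derivative in [x] is the primitive of [Dx f]; hence
    the induction over all [f]. *)
Lemma Cn_prim a n f : Cinf Wloc f -> Cn Wloc n (prim a f).
Proof.
  revert f; induction n; intros f H; assert (Hb := Wloc_prim a f H).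
  - split; auto.
  - apply (Cn_intro Wloc n _ f (prim a (Dx f))); auto.
    + intros i t x. apply (is_dC_CInt (fun s => f i s x)). now apply Cinf0_ccont_t.
    + intros i t x. unfold prim.
      destruct (Cinf_W _ _ (Cinf_Dx _ _ (Cinf_Dx _ _ H)) (Rabs a + Rabs t) (Rabs x + 1)) as [M K].
      apply (is_dC_CInt_param (fun z s => f i s z) (fun z s => Dx f i s z) (fun z s => Dx (Dx f) i s z) a t x M).
      * intros; now apply Cinf0_ccont_t.
      * intros; now apply Cinf0_ccont_t, Cinf_Dx.
      * intros; exact (Cinf_is_dC_x Wloc f i s y H).
      * intros; exact (Cinf_is_dC_x Wloc (Dx f) i s y (Cinf_Dx _ _ H)).
      * intros z s Hz Hs. apply K.
        -- now apply between_abs.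
        -- now apply Rabs_le_1_shift.
    + apply IHn. now apply Cinf_Dx.
Qed.

Lemma Cinf_prim a f : Cinf Wloc f -> Cinf Wloc (prim a f).
Proof. intros H n; now apply Cn_prim. Qed.

(** The averages [hadamard x0 m f] are stable under differentiation, and those of [Dx f]
    are the quotients of [f - f(x0)] by [x - x0]. *)
Definition hadamard (x0 : R) (m : nat) f : fam I :=
  fun i t x => CInt (fun s => RtoC (s ^ m) * f i t (x0 + s * (x - x0))%R)%C 0 1.

Lemma seg_bound x0 x s : 0 <= s <= 1 -> Rabs (x0 + s * (x - x0)) <= Rabs x0 + Rabs x.
Proof.
  intros. replace (x0 + s * (x - x0)) with ((1 - s) * x0 + s * x) by ring.
  eapply Rle_trans; [apply Rabs_triang|]. rewrite !Rabs_mult, (Rabs_right (1 - s)), (Rabs_right s) by lra.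
  assert (h1 := Rabs_pos x0); assert (h2 := Rabs_pos x). nra.
Qed.

Lemma pow_is_dC m s : exists l, is_dC (fun s => RtoC (s ^ m)) s l.
Proof.
  exists (RtoC (INR m * s ^ pred m)). apply is_dC_RtoC. auto_derive; auto. ring.
Qed.

Lemma hadamard_ccont x0 m f i t x : Cinf Wloc f ->
  ccont (fun s => RtoC (s ^ m) * f i t (x0 + s * (x - x0))%R)%C.
Proof.
  intros H. apply (ccont_mult (fun s => RtoC (s ^ m)) (fun s => f i t (x0 + s * (x - x0)))).
  - intros s. destruct (pow_is_dC m s) as [l Hl]. exact (is_dC_cont _ _ _ Hl).
  - apply (is_dC_ccont _ (fun s => RtoC (x - x0) * Dx f i t (x0 + s * (x - x0))%R)%C). intros s.
    apply (is_dC_comp (fun y => f i t y) (fun s => x0 + s * (x - x0))).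
    + exact (Cinf_is_dC_x Wloc f i t _ H).
    + auto_derive; auto. ring.
Qed.

Lemma pow_le_1 s m : 0 <= s <= 1 -> 0 <= s ^ m <= 1.
Proof.
  intros; split; [apply pow_le; lra|]. rewrite <- (pow1 m). apply pow_incr; lra.
Qed.

Lemma Wloc_hadamard x0 m f : Cinf Wloc f -> Wloc (hadamard x0 m f).
Proof.
  intros H T X; destruct (Cinf_W _ _ H T (Rabs x0 + X)) as [M K].
  exists (2 * (Rabs M * Rabs (1 - 0))); intros i t x Ht Hx; unfold hadamard.
  apply CInt_bound; [now apply hadamard_ccont|].
  rewrite Rmin_left, Rmax_right by lra; intros s Hs; rewrite Cmod_mult, Cmod_R.
  destruct (pow_le_1 s m Hs); rewrite Rabs_right by lra.
  assert (h := K i t (x0 + s * (x - x0)) Ht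
      ltac:(eapply Rle_trans; [now apply seg_bound|lra])).
  assert (h2 := Cmod_ge_0 (f i t (x0 + s * (x - x0)))); assert (h3 := Rle_abs M); nra.
Qed.

(** A derivative in [x] brings out the inner derivative [s], which raises the exponent [m] by one;
    hence the weight [s ^ m] and the induction over all [m]. *)
Lemma Cn_hadamard x0 m n f : Cinf Wloc f -> Cn Wloc n (hadamard x0 m f).
Proof.
  revert m f; induction n; intros m f H; assert (Hb := Wloc_hadamard x0 m f H).
  - split; auto.
  - apply (Cn_intro Wloc n _ (hadamard x0 m (Dt f)) (hadamard x0 (S m) (Dx f))); auto.
    + intros i t x. unfold hadamard.
      destruct (Cinf_W _ _ (Cinf_Dt _ _ (Cinf_Dt _ _ H)) (Rabs t + 1) (Rabs x0 + Rabs x)) as [M K].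
      apply (is_dC_CInt_param (fun z s => RtoC (s ^ m) * f i z (x0 + s * (x - x0))%R)%C
         (fun z s => RtoC (s ^ m) * Dt f i z (x0 + s * (x - x0))%R)%C
         (fun z s => RtoC (s ^ m) * Dt (Dt f) i z (x0 + s * (x - x0))%R)%C 0 1 t (Rabs M)).
      * intros; now apply hadamard_ccont.
      * intros; now apply hadamard_ccont, Cinf_Dt.
      * intros; apply is_dC_scal. exact (Cinf_is_dC_t Wloc f i y _ H).
      * intros; apply is_dC_scal. exact (Cinf_is_dC_t Wloc (Dt f) i y _ (Cinf_Dt _ _ H)).
      * rewrite Rmin_left, Rmax_right by lra. intros z s Hz Hs. rewrite Cmod_mult, Cmod_R.
        destruct (pow_le_1 s m Hs); rewrite Rabs_right by lra.
        assert (h := K i z (x0 + s * (x - x0)) ltac:(now apply Rabs_le_1_shift) ltac:(now apply seg_bound)).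
        assert (h2 := Cmod_ge_0 (Dt (Dt f) i z (x0 + s * (x - x0)))); assert (h3 := Rle_abs M); nra.
    + intros i t x. unfold hadamard.
      destruct (Cinf_W _ _ (Cinf_Dx _ _ (Cinf_Dx _ _ H)) (Rabs t) (Rabs x0 + (Rabs x + 1))) as [M K].
      assert (Hco : forall g j y s, Cinf Wloc g ->
        is_dC (fun z => RtoC (s ^ j) * g i t (x0 + s * (z - x0))%R)%C y
            (RtoC (s ^ S j) * Dx g i t (x0 + s * (y - x0))%R)%C).
      { intros g j y s Hg. eapply is_dC_eq.
        - apply is_dC_scal. apply (is_dC_comp (fun y => g i t y) (fun z => x0 + s * (z - x0))).
          + exact (Cinf_is_dC_x Wloc g i t _ Hg).
          + instantiate (1 := s). auto_derive; auto. ring.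
        - simpl. rewrite RtoC_mult. ring. }
      apply (is_dC_CInt_param (fun z s => RtoC (s ^ m) * f i t (x0 + s * (z - x0))%R)%C
         (fun z s => RtoC (s ^ S m) * Dx f i t (x0 + s * (z - x0))%R)%C
         (fun z s => RtoC (s ^ S (S m)) * Dx (Dx f) i t (x0 + s * (z - x0))%R)%C 0 1 x (Rabs M)).
      * intros; now apply hadamard_ccont.
      * intros; now apply hadamard_ccont, Cinf_Dx.
      * intros; now apply Hco.
      * intros; now apply Hco, Cinf_Dx.
      * rewrite Rmin_left, Rmax_right by lra. intros z s Hz Hs. rewrite Cmod_mult, Cmod_R.
        destruct (pow_le_1 s (S (S m)) Hs); rewrite Rabs_right by lra.
        assert (h := K i t (x0 + s * (z - x0)) ltac:(lra)
          ltac:(eapply Rle_trans; [now apply seg_bound|]; apply Rabs_le_1_shift in Hz; lra)).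
        assert (h2 := Cmod_ge_0 (Dx (Dx f) i t (x0 + s * (z - x0)))); assert (h3 := Rle_abs M); nra.
    + apply IHn. now apply Cinf_Dt.
    + apply IHn. now apply Cinf_Dx.
Qed.

(** The fundamental theorem of calculus along the segment from [x0] to [x]. *)
Lemma hadamard_div x0 f i t x : Cinf Wloc f ->
  f i t x = (f i t x0 + RtoC (x - x0) * hadamard x0 0 (Dx f) i t x)%C.
Proof.
  intros H. unfold hadamard.
  rewrite <- CInt_scal by now apply hadamard_ccont, Cinf_Dx.
  assert (Hd : forall s, is_dC (fun s => f i t (x0 + s * (x - x0)))%R s
      (RtoC (x - x0) * (RtoC (s ^ 0) * Dx f i t (x0 + s * (x - x0))%R))%C).
  { intros s. eapply is_dC_eq.
    - apply (is_dC_comp (fun y => f i t y) (fun s => x0 + s * (x - x0))).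
      + exact (Cinf_is_dC_x Wloc f i t _ H).
      + instantiate (1 := x - x0). auto_derive; auto. ring.
    - simpl. ring. }
  rewrite (CInt_derive _ _ 0 1 Hd).
  - replace (x0 + 1 * (x - x0)) with x by ring. replace (x0 + 0 * (x - x0)) with x0 by ring. ring.
  - apply (ccont_mult (fun _ => RtoC (x - x0))); [apply ccont_const|]. now apply hadamard_ccont, Cinf_Dx.
Qed.

(** * Functions of [t] alone *)

Definition xfree f := forall i t x y, f i t x = f i t y.

Lemma xfree_Dt f : xfree f -> xfree (Dt f).
Proof.
  intros H i t x y. unfold Dt, dt. f_equal. apply functional_extensionality; auto.
Qed.

Lemma xfree_Dx f : xfree f -> Dx f = fun _ _ _ => RtoC 0.
Proof.
  intros H. apply Dx_eq. intros i t x. apply is_dC_ext with (fun _ => f i t 0); auto. apply is_dC_const.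
Qed.

Lemma Wtame_xfree f : Cinf Wloc f -> xfree f -> Wtame f.
Proof.
  intros H Hf T; destruct (Cinf_W _ _ H T 0) as [M K]; exists M, O; intros i t x Ht.
  rewrite (Hf i t x 0); simpl; rewrite Rmult_1_r; apply K; auto; rewrite Rabs_R0; lra.
Qed.

(** Without dependence on [x] a local bound is a polynomial bound of degree 0. This turns
    coefficients and cutoffs in [t] into multipliers of [Wrapid]. *)
Lemma Cinf_xfree f : Cinf Wloc f -> xfree f -> Cinf Wtame f.
Proof.
  intros H Hf n; revert f H Hf; induction n; intros f H Hf; assert (Hb := Wtame_xfree f H Hf).
  - split; auto.
  - split; [|split; [|split]]; auto.
    + eapply Cinf_dif; eauto.
    + apply IHn; [now apply Cinf_Dt|now apply xfree_Dt].
    + rewrite xfree_Dx; auto. apply Cinf_const.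
Qed.

(** [D] must be closed, so that the derivatives of [f] vanish off [D] as well. *)
Lemma Cinf_xfree_supp D f : (forall t, ~ D t -> locally t (fun s => ~ D s)) ->
  Cinf Wloc f -> xfree f -> (forall i t x, ~ D t -> f i t x = RtoC 0) -> Cinf (Wsupp D) f.
Proof.
  intros HD H Hf Hz n; revert f H Hf Hz; induction n; intros f H Hf Hz.
  all: assert (Hb : Wsupp D f) by
   (intros T; destruct (Cinf_W _ _ H T 0) as [M K]; exists M; intros i t x Ht; split;
    [rewrite (Hf i t x 0); apply K; auto; rewrite Rabs_R0; lra|apply Hz]).
  - split; auto.
  - split; [|split; [|split]]; auto.
    + eapply Cinf_dif; eauto.
    + apply IHn; [now apply Cinf_Dt|now apply xfree_Dt|].
      intros i t x Ht. apply dC_is_dC.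
      split; simpl; (apply is_derive_ext_loc with (fun _ => 0); [|apply is_derive_Rconst]);
        (eapply filter_imp; [|apply (HD t Ht)]); intros s Hs; simpl; rewrite (Hz i s x Hs); auto.
    + rewrite xfree_Dx; auto. apply Cn_zero.
      intros T; exists 0; intros; rewrite Cmod_0; split; auto; lra.
Qed.

End Weights.

(** * Integration over the line *)

(** Total by convention: [Lim_seq] is always defined and [real] sends infinite values to 0. It is
    used as an integral under a decay bound, as in [RIntR_lim]. *)
Definition RIntR (h : R -> R) : R := real (Lim_seq (fun n => RInt h (- INR n) (INR n))).

Lemma continuous_cauchy_density M x : continuous (fun x => M / (1 + x ^ 2)) x.
Proof.
  apply (ex_derive_continuous (fun x => M / (1 + x ^ 2))). auto_derive. nra.
Qed.

Lemma RInt_cauchy_density M a b : RInt (fun x => M / (1 + x ^ 2)) a b = M * (atan b - atan a).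
Proof.
  apply is_RInt_unique.
  replace (M * (atan b - atan a)) with (minus (M * atan b) (M * atan a))
    by (unfold minus, plus, opp; simpl; ring).
  apply (is_RInt_derive (V := R_CompleteNormedModule) (fun x => M * atan x)).
  - intros x _. auto_derive; auto. unfold Rsqr. simpl. field. nra.
  - intros x _. apply continuous_cauchy_density.
Qed.

Lemma RInt_decay_bound h M a b : a <= b -> (forall x, continuous h x) ->
  (forall x, Rabs (h x) <= M / (1 + x ^ 2)) -> Rabs (RInt h a b) <= M * PI.
Proof.
  intros Hab Hc HM.
  assert (M0 : 0 <= M).
  { assert (H := HM 0). assert (H2 := Rabs_pos (h 0)). replace (M / (1 + 0 ^ 2)) with M in H by field. lra. }
  apply Rle_trans with (M * (atan b - atan a)).
  - rewrite <- RInt_cauchy_density.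
    apply (norm_RInt_le (V := R_NormedModule) h (fun x => M / (1 + x ^ 2)) a b); auto.
    + apply (RInt_correct (V := R_CompleteNormedModule)). now apply ex_RInt_cont.
    + apply (RInt_correct (V := R_CompleteNormedModule)). apply ex_RInt_cont. intros; apply continuous_cauchy_density.
  - apply Rmult_le_compat_l; auto. assert (H1 := atan_bound a). assert (H2 := atan_bound b). lra.
Qed.

Lemma nonneg_lim (g : R -> R) B : (forall x, continuous g x) -> (forall x, 0 <= g x) ->
  (forall n, RInt g (- INR n) (INR n) <= B) -> ex_finite_lim_seq (fun n => RInt g (- INR n) (INR n)).
Proof.
  intros Hc Hp HB. apply ex_finite_lim_seq_incr with B; auto.
  intros n. rewrite S_INR.
  assert (E : forall a b, a <= b -> 0 <= RInt g a b).
  { intros a b Hab. apply RInt_ge_0; auto. now apply ex_RInt_cont. }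
  assert (C : forall a b c, RInt g a b + RInt g b c = RInt g a c).
  { intros; now apply RInt_RChasles. }
  rewrite <- (C (- (INR n + 1)) (- INR n) (INR n + 1)), <- (C (- INR n) (INR n) (INR n + 1)).
  assert (E1 := E (- (INR n + 1)) (- INR n) ltac:(lra)).
  assert (E2 := E (INR n) (INR n + 1) ltac:(lra)). lra.
Qed.

Lemma pos_INR_opp n : - INR n <= INR n.
Proof. assert (H := pos_INR n); lra. Qed.

(** Convergence by monotonicity: [M / (1 + x ^ 2)] and [h + M / (1 + x ^ 2)] are both nonnegative
    with bounded integrals, and [h] is their difference. *)
Lemma RIntR_lim h M : (forall x, continuous h x) -> (forall x, Rabs (h x) <= M / (1 + x ^ 2)) ->
  is_lim_seq (fun n => RInt h (- INR n) (INR n)) (RIntR h).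
Proof.
  intros Hc HM.
  assert (M0 : 0 <= M).
  { assert (H := HM 0). assert (H2 := Rabs_pos (h 0)). replace (M / (1 + 0 ^ 2)) with M in H by field. lra. }
  assert (Hk : forall x, Rabs (M / (1 + x ^ 2)) <= M / (1 + x ^ 2)).
  { intros x. rewrite Rabs_right; [lra|]. apply Rle_ge, Rdiv_le_0_compat; nra. }
  assert (L1 : ex_finite_lim_seq (fun n => RInt (fun x => M / (1 + x ^ 2)) (- INR n) (INR n))).
  { apply nonneg_lim with (M * PI).
    - intros; apply continuous_cauchy_density.
    - intros; apply Rdiv_le_0_compat; nra.
    - intros n; eapply Rle_trans; [apply Rle_abs|]. apply RInt_decay_bound; auto using pos_INR_opp.
      intros; apply continuous_cauchy_density. }
  assert (L2 : ex_finite_lim_seq (fun n => RInt (fun x => h x + M / (1 + x ^ 2)) (- INR n) (INR n))).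
  { apply nonneg_lim with (M * PI + M * PI).
    - intros; apply continuous_Rplus; auto. apply continuous_cauchy_density.
    - intros x. assert (H1 := HM x). assert (H2 := Rle_abs (- h x)). rewrite Rabs_Ropp in H2. lra.
    - intros n; rewrite (RInt_Rplus h); auto using continuous_cauchy_density. apply Rplus_le_compat.
      + eapply Rle_trans; [apply Rle_abs|]. apply RInt_decay_bound; auto using pos_INR_opp.
      + eapply Rle_trans; [apply Rle_abs|]. apply RInt_decay_bound; auto using pos_INR_opp.
        intros; apply continuous_cauchy_density. }
  destruct L1 as [l1 L1], L2 as [l2 L2].
  assert (L : is_lim_seq (fun n => RInt h (- INR n) (INR n)) (l2 - l1)).
  { eapply is_lim_seq_ext; [|apply is_lim_seq_minus'; [exact L2|exact L1]].
    intros n; simpl. rewrite (RInt_Rplus h); auto using continuous_cauchy_density. ring. }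
  unfold RIntR. rewrite (is_lim_seq_unique _ _ L). exact L.
Qed.

Lemma RIntR_unique h l : is_lim_seq (fun n => RInt h (- INR n) (INR n)) (Finite l) -> RIntR h = l.
Proof. intros H; unfold RIntR; now rewrite (is_lim_seq_unique _ _ H). Qed.

Lemma RIntR_bound h M : (forall x, continuous h x) -> (forall x, Rabs (h x) <= M / (1 + x ^ 2)) ->
  Rabs (RIntR h) <= M * PI.
Proof.
  intros Hc HM. assert (L := RIntR_lim h M Hc HM).
  assert (HB : forall n, - (M * PI) <= RInt h (- INR n) (INR n) <= M * PI).
  { intros n. apply Rabs_le_between, RInt_decay_bound; auto using pos_INR_opp. }
  apply Rabs_le. split.
  - apply (is_lim_seq_le (fun _ => - (M * PI)) _ (Finite (- (M * PI))) (Finite (RIntR h))) in L; auto using is_lim_seq_const.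
    intros n; apply HB.
  - apply (is_lim_seq_le _ (fun _ => M * PI) (Finite (RIntR h)) (Finite (M * PI))) in L; auto using is_lim_seq_const.
    intros n; apply HB.
Qed.

(** The weight is that of [Wrapid] for exponent 2, and it dominates [1 + x ^ 2], so that the Cauchy
    density controls the integral. *)
Definition majorized (f : R -> C) (M : R) : Prop := ccont f /\ forall x, (1 + Rabs x) ^ 2 * Cmod (f x) <= M.

Definition CIntR (f : R -> C) : C := (RIntR (fun x => fst (f x)), RIntR (fun x => snd (f x))).

Lemma majorized_cauchy f M x : majorized f M -> Cmod (f x) <= M / (1 + x ^ 2).
Proof.
  intros [_ H]. specialize (H x). assert (H2 := Rabs_pos x). assert (H3 := Cmod_ge_0 (f x)).
  apply Rmult_le_reg_r with (1 + x ^ 2); [nra|].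
  replace (M / (1 + x ^ 2) * (1 + x ^ 2)) with M by (field; nra).
  rewrite <- (pow2_abs x). nra.
Qed.

Lemma majorized_fst f M x : majorized f M -> Rabs (fst (f x)) <= M / (1 + x ^ 2).
Proof. intros H; eapply Rle_trans; [apply abs_fst_Cmod|now apply majorized_cauchy]. Qed.

Lemma majorized_snd f M x : majorized f M -> Rabs (snd (f x)) <= M / (1 + x ^ 2).
Proof. intros H; eapply Rle_trans; [apply abs_snd_Cmod|now apply majorized_cauchy]. Qed.

Lemma CIntR_fst_lim f M : majorized f M -> is_lim_seq (fun n => fst (CInt f (- INR n) (INR n))) (fst (CIntR f)).
Proof.
  intros H; simpl. apply (RIntR_lim (fun x => fst (f x)) M).
  - intros; apply ccont_fst, H.
  - intros; now apply majorized_fst.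
Qed.

Lemma CIntR_snd_lim f M : majorized f M -> is_lim_seq (fun n => snd (CInt f (- INR n) (INR n))) (snd (CIntR f)).
Proof.
  intros H; simpl. apply (RIntR_lim (fun x => snd (f x)) M).
  - intros; apply ccont_snd, H.
  - intros; now apply majorized_snd.
Qed.

Lemma CIntR_unique f (l : C) : is_lim_seq (fun n => fst (CInt f (- INR n) (INR n))) (fst l) ->
  is_lim_seq (fun n => snd (CInt f (- INR n) (INR n))) (snd l) -> CIntR f = l.
Proof.
  intros; apply injective_projections; now apply RIntR_unique.
Qed.

Lemma CIntR_bound f M : majorized f M -> Cmod (CIntR f) <= 2 * (M * PI).
Proof.
  intros H; apply Cmod_bound_parts; simpl; apply RIntR_bound.
  - intros; apply ccont_fst, H.
  - intros; now apply majorized_fst.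
  - intros; apply ccont_snd, H.
  - intros; now apply majorized_snd.
Qed.

Lemma majorized_plus f g M N : majorized f M -> majorized g N -> majorized (fun x => f x + g x)%C (M + N).
Proof.
  intros [H1 H2] [H3 H4]; split; [now apply ccont_plus|].
  intros x. specialize (H2 x); specialize (H4 x).
  eapply Rle_trans; [apply Rmult_le_compat_l; [|apply Cmod_triangle]|lra].
  assert (Hw := wpow_ge1 x 2); lra.
Qed.

Lemma majorized_scal c g N : majorized g N -> majorized (fun x => c * g x)%C (Cmod c * N).
Proof.
  intros [H3 H4]; split; [apply (ccont_mult (fun _ => c)); auto using ccont_const|].
  intros x. rewrite Cmod_mult. specialize (H4 x). assert (H := Cmod_ge_0 c).
  replace (_ * (_ * _)) with (Cmod c * ((1 + Rabs x) ^ 2 * Cmod (g x))) by ring.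
  now apply Rmult_le_compat_l.
Qed.

Lemma CIntR_plus f g M N : majorized f M -> majorized g N -> CIntR (fun x => f x + g x)%C = (CIntR f + CIntR g)%C.
Proof.
  intros H1 H2; apply CIntR_unique; simpl.
  - eapply is_lim_seq_ext; [|apply is_lim_seq_plus'; [exact (CIntR_fst_lim f M H1)|exact (CIntR_fst_lim g N H2)]].
    intros n; simpl. symmetry. apply (f_equal fst (CInt_plus f g (- INR n) (INR n) (proj1 H1) (proj1 H2))).
  - eapply is_lim_seq_ext; [|apply is_lim_seq_plus'; [exact (CIntR_snd_lim f M H1)|exact (CIntR_snd_lim g N H2)]].
    intros n; simpl. symmetry. apply (f_equal snd (CInt_plus f g (- INR n) (INR n) (proj1 H1) (proj1 H2))).
Qed.

Lemma is_lim_seq_Rscal (u : nat -> R) a (l : R) : is_lim_seq u l -> is_lim_seq (fun n => a * u n) (a * l).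
Proof. intros; apply is_lim_seq_mult'; auto. apply is_lim_seq_const. Qed.

Lemma CIntR_scal c g N : majorized g N -> CIntR (fun x => c * g x)%C = (c * CIntR g)%C.
Proof.
  intros H; apply CIntR_unique.
  - eapply is_lim_seq_ext; [|apply is_lim_seq_minus'; apply is_lim_seq_Rscal;
      [exact (CIntR_fst_lim g N H)|exact (CIntR_snd_lim g N H)]].
    intros n. symmetry. apply (f_equal fst (CInt_scal c g (- INR n) (INR n) (proj1 H))).
  - eapply is_lim_seq_ext; [|apply is_lim_seq_plus'; apply is_lim_seq_Rscal;
      [exact (CIntR_snd_lim g N H)|exact (CIntR_fst_lim g N H)]].
    intros n. symmetry. apply (f_equal snd (CInt_scal c g (- INR n) (INR n) (proj1 H))).
Qed.

Lemma CIntR_ext f g : (forall x, f x = g x) -> CIntR f = CIntR g.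
Proof. intros H; replace g with f; auto. now apply functional_extensionality. Qed.

Lemma lim_bounded_by_inv (u : nat -> R) M :
  (forall n, Rabs (u n) <= M / (INR n + 1)) -> is_lim_seq u 0.
Proof.
  intros H.
  assert (L : is_lim_seq (fun n => / (INR n + 1)) 0).
  { apply (is_lim_seq_ext (fun n => / (INR (S n)))). intros; now rewrite S_INR.
    apply -> (is_lim_seq_incr_1 (fun n => / INR n)).
    replace (Finite 0) with (Rbar_inv p_infty) by reflexivity.
    apply is_lim_seq_inv; [apply is_lim_seq_INR|discriminate]. }
  apply is_lim_seq_le_le with (fun n => - M * / (INR n + 1)) (fun n => M * / (INR n + 1)).
  - intros n. specialize (H n). apply Rabs_le_between in H. unfold Rdiv in H. lra.
  - replace (Finite 0) with (Finite (- M * 0)) by (f_equal; ring). now apply is_lim_seq_Rscal.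
  - replace (Finite 0) with (Finite (M * 0)) by (f_equal; ring). now apply is_lim_seq_Rscal.
Qed.

(** The boundary terms at [n] and [-n] are of size [1 / (n + 1)]. This is integration by parts for
    the Fourier transform. *)
Lemma CIntR_derive f f1 M : (forall x, is_dC f x (f1 x)) -> ccont f1 ->
  (forall x, (1 + Rabs x) * Cmod (f x) <= M) -> CIntR f1 = RtoC 0.
Proof.
  intros H Hc HM.
  assert (HB : forall n, Cmod (CInt f1 (- INR n) (INR n)) <= 2 * M / (INR n + 1)).
  { intros n. rewrite (CInt_derive f f1) by auto.
    assert (H1 := HM (INR n)). assert (H2 := HM (- INR n)).
    rewrite Rabs_Ropp in H2. assert (Hn := pos_INR n). rewrite Rabs_right in H1, H2 by lra.
    apply Rmult_le_reg_l with (1 + INR n); [lra|].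
    replace ((1 + INR n) * (2 * M / (INR n + 1))) with (2 * M) by (field; lra).
    eapply Rle_trans; [apply Rmult_le_compat_l; [lra|apply Cmod_triangle]|]. rewrite Cmod_opp. lra. }
  apply CIntR_unique; simpl; apply lim_bounded_by_inv with (2 * M); intros n;
    (eapply Rle_trans; [|apply HB]).
  - apply (abs_fst_Cmod (CInt f1 (- INR n) (INR n))).
  - apply (abs_snd_Cmod (CInt f1 (- INR n) (INR n))).
Qed.

Lemma is_dC_CIntR (K K1 K2 : R -> R -> C) y M :
  (forall z s, is_dC (fun z => K z s) z (K1 z s)) ->
  (forall z s, is_dC (fun z => K1 z s) z (K2 z s)) ->
  (forall z, exists N, majorized (K z) N) -> (forall z, exists N, majorized (K1 z) N) ->
  (forall z s, Rabs (z - y) <= 1 -> (1 + Rabs s) ^ 2 * Cmod (K2 z s) <= M) ->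
  is_dC (fun z => CIntR (K z)) y (CIntR (K1 y)).
Proof.
  intros H1 H2 D0 D1 HM.
  apply is_dC_quadratic with (2 * (4 * M * PI)).
  intros h Hh. destruct (D0 (y + h)) as [N1 E1], (D0 y) as [N2 E2], (D1 y) as [N3 E3].
  replace (_ - _)%C with (CIntR (fun s => (K (y + h)%R s + (-1) * K y s) + (- RtoC h) * K1 y s)%C).
  - eapply Rle_trans; [apply CIntR_bound with (M := 4 * (M * h ^ 2))|].
    + split.
      * destruct E1 as [E1 _], E2 as [E2 _], E3 as [E3 _]. ccont_tac.
      * intros s. assert (Hw := wpow_ge1 s 2). assert (Hr := Rabs_pos s).
        (* The second derivative is bounded pointwise in [s] by [M / (1 + |s|)^2], so the remainder
           comes out with an integrable weight and the same factor [h ^ 2]. *)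
        assert (HT := is_dC_taylor (fun z => K z s) (fun z => K1 z s) (fun z => K2 z s) y
           (M / (1 + Rabs s) ^ 2) ltac:(auto) ltac:(auto)).
        cbv beta in HT.
        replace (K (y + h)%R s + -1 * K y s + - h * K1 y s)%C
          with (K (y + h)%R s - K y s - h * K1 y s)%C by ring.
        eapply Rle_trans; [apply Rmult_le_compat_l; [lra|apply HT; auto]|].
        -- intros z Hz. apply Rmult_le_reg_l with ((1 + Rabs s) ^ 2); [lra|].
           eapply Rle_trans; [apply HM; auto|]. right; field. lra.
        -- right; field. lra.
    + right; ring.
  - rewrite (CIntR_plus (fun s => K (y + h)%R s + (-1) * K y s)%C (fun s => (- RtoC h) * K1 y s)%C
      (N1 + Cmod (-1)%C * N2) (Cmod (- RtoC h)%C * N3)); auto using majorized_plus, majorized_scal.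
    rewrite (CIntR_plus (K (y + h)%R) (fun s => (-1) * K y s)%C N1 (Cmod (-1)%C * N2)); auto using majorized_plus, majorized_scal.
    rewrite (CIntR_scal _ _ N2), (CIntR_scal _ _ N3); auto. ring.
Qed.

(** * The Fourier transform *)

Ltac fext3 := apply functional_extensionality; intros ?i;
  apply functional_extensionality; intros ?t; apply functional_extensionality; intros ?x.

Ltac cinf_tac := lazymatch goal with
  | |- Cinf Wrapid (fun i t x => Cplus (@?f i t x) (@?g i t x)) => apply (Cinf_plus Wrapid f g Wrapid_add); cinf_tac
  | |- Cinf Wtame (fun i t x => Cplus (@?f i t x) (@?g i t x)) => apply (Cinf_plus Wtame f g Wtame_add); cinf_tac
  | |- Cinf Wloc (fun i t x => Cplus (@?f i t x) (@?g i t x)) => apply (Cinf_plus Wloc f g Wloc_add); cinf_tac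
  | |- Cinf Wtame (fun i t x => Cmult (@?f i t x) (@?g i t x)) => apply (Cinf_mul Wtame Wtame Wtame f g Wtame_add Wtame_mul); cinf_tac
  | |- Cinf Wloc (fun i t x => Cmult (@?f i t x) (@?g i t x)) => apply (Cinf_mul Wloc Wloc Wloc f g Wloc_add Wloc_mul); cinf_tac
  | |- Cinf Wrapid (fun i t x => Cmult (@?f i t x) (@?g i t x)) => apply (Cinf_mul Wtame Wrapid Wrapid f g Wrapid_add Wtame_Wrapid); cinf_tac
  | |- Cinf Wtame (fun _ _ _ => ?c) => apply (Cinf_const c)
  | |- Cinf Wtame (fun _ _ x => RtoC x) => apply Cinf_x
  | |- Cinf Wtame (fun _ t _ => RtoC t) => apply Cinf_t
  | _ => auto
  end.

(** The exponential is split into factors [exp (- e |x|)], each of which beats one factor [1 + |x|]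
    up to the constant [c = 1 + / e]. Dividing by [k + 1] rather than [k] covers [k = 0]. *)
Lemma poly_exp k eps : 0 < eps -> exists M, forall x, (1 + Rabs x) ^ k * exp (- (eps * Rabs x)) <= M.
Proof.
  intros He. set (e := eps / (INR k + 1)).
  assert (Hk := pos_INR k). assert (He0 : 0 < e) by (apply Rdiv_lt_0_compat; lra).
  set (c := 1 + / e). assert (Hc : 1 <= c) by (assert (H := Rinv_0_lt_compat e He0); unfold c; lra).
  exists (c ^ k). intros x. assert (Hx := Rabs_pos x).
  assert (H1 : 1 + Rabs x <= c * exp (e * Rabs x)).
  { apply Rle_trans with (c * (1 + e * Rabs x)).
    - unfold c. replace ((1 + / e) * (1 + e * Rabs x)) with (1 + Rabs x + / e + e * Rabs x) by (field; lra).
      assert (H := Rinv_0_lt_compat e He0). nra.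
    - apply Rmult_le_compat_l; [lra|]. apply exp_ineq1_le. }
  assert (H2 : forall j, (1 + Rabs x) ^ j * exp (- (INR j * (e * Rabs x))) <= c ^ j).
  { induction j.
    - simpl. rewrite Rmult_0_l, Ropp_0, exp_0. lra.
    - rewrite S_INR. replace (- ((INR j + 1) * (e * Rabs x))) with (- (INR j * (e * Rabs x)) + - (e * Rabs x)) by ring.
      rewrite exp_plus. simpl.
      replace ((1 + Rabs x) * (1 + Rabs x) ^ j * (exp (- (INR j * (e * Rabs x))) * exp (- (e * Rabs x))))
       with (((1 + Rabs x) * exp (- (e * Rabs x))) * ((1 + Rabs x) ^ j * exp (- (INR j * (e * Rabs x))))) by ring.
      apply Rmult_le_compat; auto.
      + apply Rmult_le_pos; [lra|]. left; apply exp_pos.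
      + apply Rmult_le_pos; [|left; apply exp_pos]. assert (H := wpow_ge1 x j); lra.
      + apply Rmult_le_reg_r with (exp (e * Rabs x)); [apply exp_pos|].
        rewrite Rmult_assoc, <- exp_plus. replace (- (e * Rabs x) + e * Rabs x) with 0 by ring.
        rewrite exp_0. lra. }
  eapply Rle_trans; [|apply (H2 k)].
  apply Rmult_le_compat_l; [assert (H := wpow_ge1 x k); lra|].
  assert (H3 : INR k * (e * Rabs x) <= eps * Rabs x).
  { rewrite <- Rmult_assoc. apply Rmult_le_compat_r; auto. unfold e.
    replace (INR k * (eps / (INR k + 1))) with (eps * (INR k / (INR k + 1))) by (field; lra).
    rewrite <- (Rmult_1_r eps) at 2. apply Rmult_le_compat_l; [lra|].
    apply Rmult_le_reg_r with (INR k + 1); [lra|]. unfold Rdiv. rewrite Rmult_assoc, Rinv_l by lra. lra. }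
  destruct (Rle_lt_or_eq_dec _ _ H3) as [h|h].
  - left. apply exp_increasing. lra.
  - rewrite h; lra.
Qed.

Definition eix (s x xi : R) : C := cexp (0, s * x * xi).

Lemma Cmod_eix s x xi : Cmod (eix s x xi) = 1.
Proof. unfold eix; rewrite Cmod_cexp; simpl. apply exp_0. Qed.

Lemma is_dC_imag (u : R -> R) x l : is_derive u x l -> is_dC (fun y => (0, u y) : C) x (0, l).
Proof. intros; split; simpl; auto. apply is_derive_Rconst. Qed.

Lemma is_dC_eix_x s x xi : is_dC (fun y => eix s y xi) x ((0, (s * xi)%R) * eix s x xi)%C.
Proof.
  unfold eix. apply (is_dC_cexp (fun y => (0, s * y * xi))). apply is_dC_imag. auto_derive; auto. ring.
Qed.

Lemma is_dC_eix_xi s x xi : is_dC (fun y => eix s x y) xi ((0, (s * x)%R) * eix s x xi)%C.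
Proof.
  unfold eix. apply (is_dC_cexp (fun y => (0, s * x * y))). apply is_dC_imag. auto_derive; auto. ring.
Qed.

(** [s] is the sign in the kernel, [1] or [-1]; there is no normalizing factor. *)
Definition FT {I} (s : R) (f : fam I) : fam I := fun i t xi => CIntR (fun x => f i t x * eix s x xi)%C.

Definition mul_is {I} (s : R) (f : fam I) : fam I := fun i t x => ((0, (s * x)%R) * f i t x)%C.

Section Fourier.
Context {I : Type}.
Implicit Types (f g : fam I).

Lemma Cinf_mul_is s f : Cinf Wrapid f -> Cinf Wrapid (mul_is s f).
Proof.
  intros H. apply (Cinf_ext Wrapid (fun i t x => ((0, s) * RtoC x) * f i t x)%C).
  - intros; unfold mul_is. f_equal. apply injective_projections; simpl; ring.
  - cinf_tac.
Qed.

Lemma Cinf_Wrapid_Wloc f : Cinf Wrapid f -> Cinf Wloc f.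
Proof. intros H; apply (Cinf_weaken Wrapid); auto. intros g Hg. now apply Wloc_Wtame, Wtame_Wrapid_weak. Qed.

Lemma Cinf_Wtame_Wloc f : Cinf Wtame f -> Cinf Wloc f.
Proof. apply Cinf_weaken, Wloc_Wtame. Qed.

Lemma kernel_ccont s f i t xi : Cinf Wrapid f -> ccont (fun x => f i t x * eix s x xi)%C.
Proof.
  intros H. apply (ccont_mult (fun x => f i t x) (fun x => eix s x xi)).
  - now apply Cinf0_ccont_x, Cinf_Wrapid_Wloc.
  - apply (is_dC_ccont _ (fun x => (0, (s * xi)%R) * eix s x xi)%C). intros; apply is_dC_eix_x.
Qed.

Lemma kernel_majorized s f T : Cinf Wrapid f -> exists M, forall i t xi, Rabs t <= T ->
  majorized (fun x => f i t x * eix s x xi)%C M.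
Proof.
  intros H. destruct (Cinf_W _ _ H T 2%nat) as [M K]. exists M. intros i t xi Ht. split.
  - now apply kernel_ccont.
  - intros x. rewrite Cmod_mult, Cmod_eix, Rmult_1_r. auto.
Qed.

Lemma kernel_majorized_at s f i t xi : Cinf Wrapid f -> exists M, majorized (fun x => f i t x * eix s x xi)%C M.
Proof.
  intros H. destruct (kernel_majorized s f (Rabs t) H) as [M K]. exists M; apply K; lra.
Qed.

Lemma FT_plus s f g i t xi : Cinf Wrapid f -> Cinf Wrapid g ->
  FT s (fun i t x => f i t x + g i t x)%C i t xi = (FT s f i t xi + FT s g i t xi)%C.
Proof.
  intros Hf Hg. destruct (kernel_majorized_at s f i t xi Hf) as [M HM], (kernel_majorized_at s g i t xi Hg) as [N HN].
  unfold FT. rewrite <- (CIntR_plus _ _ M N) by auto. apply CIntR_ext. intros; ring.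
Qed.

Lemma FT_scal s (c : I -> R -> C) f i t xi : Cinf Wrapid f ->
  FT s (fun i t x => c i t * f i t x)%C i t xi = (c i t * FT s f i t xi)%C.
Proof.
  intros Hf. destruct (kernel_majorized_at s f i t xi Hf) as [M HM].
  unfold FT. rewrite <- (CIntR_scal _ _ M) by auto. apply CIntR_ext. intros; ring.
Qed.

Lemma FT_is_dC_t s f i t xi : Cinf Wrapid f -> is_dC (fun z => FT s f i z xi) t (FT s (Dt f) i t xi).
Proof.
  intros H. unfold FT.
  destruct (Cinf_W _ _ (Cinf_Dt _ _ (Cinf_Dt _ _ H)) (Rabs t + 1) 2%nat) as [M K].
  apply (is_dC_CIntR (fun z x => f i z x * eix s x xi)%C (fun z x => Dt f i z x * eix s x xi)%C
     (fun z x => Dt (Dt f) i z x * eix s x xi)%C t M).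
  - intros z x. eapply is_dC_eq; [apply (is_dC_mult (fun z => f i z x) (fun _ => eix s x xi));
      [exact (Cinf_is_dC_t _ _ _ _ _ H)|apply is_dC_const]|cbv beta; ring].
  - intros z x. eapply is_dC_eq; [apply (is_dC_mult (fun z => Dt f i z x) (fun _ => eix s x xi));
      [exact (Cinf_is_dC_t _ _ _ _ _ (Cinf_Dt _ _ H))|apply is_dC_const]|cbv beta; ring].
  - intros; now apply kernel_majorized_at.
  - intros; now apply kernel_majorized_at, Cinf_Dt.
  - intros z x Hz. rewrite Cmod_mult, Cmod_eix, Rmult_1_r. apply K. now apply Rabs_le_1_shift.
Qed.

Lemma FT_is_dC_x s f i t xi : Cinf Wrapid f -> is_dC (fun z => FT s f i t z) xi (FT s (mul_is s f) i t xi).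
Proof.
  intros H. unfold FT.
  destruct (Cinf_W _ _ (Cinf_mul_is s _ (Cinf_mul_is s _ H)) (Rabs t) 2%nat) as [M K].
  assert (Hd : forall g z x, is_dC (fun z => g i t x * eix s x z)%C z (mul_is s g i t x * eix s x z)%C).
  { intros g z x. unfold mul_is. eapply is_dC_eq; [apply (is_dC_scal (g i t x)), is_dC_eix_xi|ring]. }
  apply (is_dC_CIntR (fun z x => f i t x * eix s x z)%C (fun z x => mul_is s f i t x * eix s x z)%C
     (fun z x => mul_is s (mul_is s f) i t x * eix s x z)%C xi M); auto.
  - intros; now apply kernel_majorized_at.
  - intros; now apply kernel_majorized_at, Cinf_mul_is.
  - intros z x Hz. rewrite Cmod_mult, Cmod_eix, Rmult_1_r. apply K. lra.
Qed.

Lemma FT_Dx s f i t xi : Cinf Wrapid f -> FT s (Dx f) i t xi = ((0, (- s * xi)%R) * FT s f i t xi)%C.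
Proof.
  intros H.
  destruct (kernel_majorized_at s f i t xi H) as [M HM].
  destruct (kernel_majorized_at s (Dx f) i t xi (Cinf_Dx _ _ H)) as [N HN].
  assert (E : CIntR (fun x => Dx f i t x * eix s x xi + (0, (s * xi)%R) * (f i t x * eix s x xi))%C = RtoC 0).
  { apply (CIntR_derive (fun x => f i t x * eix s x xi)%C _ M).
    - intros x. eapply is_dC_eq; [apply (is_dC_mult (fun x => f i t x) (fun x => eix s x xi));
       [exact (Cinf_is_dC_x _ _ _ _ _ H)|apply is_dC_eix_x]|ring].
    - apply (ccont_plus (fun x => Dx f i t x * eix s x xi)%C (fun x => (0, (s * xi)%R) * (f i t x * eix s x xi))%C).
      + apply HN.
      + apply (ccont_mult (fun x => (0, s * xi))); [apply ccont_const|apply HM].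
    - intros x. destruct HM as [_ HM]. specialize (HM x). eapply Rle_trans; [|exact HM].
      apply Rmult_le_compat_r; [apply Cmod_ge_0|]. rewrite <- (pow_1 (1 + Rabs x)) at 1. apply wpow_mono; lia. }
  rewrite (CIntR_plus _ _ N (Cmod (0, s * xi) * M)), (CIntR_scal _ _ M) in E; auto using majorized_scal.
  unfold FT at 1.
  match type of E with (?a + ?b * ?c)%C = _ => replace a with ((a + b * c) - b * c)%C by ring end.
  rewrite E. unfold FT. apply injective_projections; simpl; ring.
Qed.

Lemma FT_Wrapid s f : s * s = 1 -> Cinf Wrapid f -> Wrapid (FT s f).
Proof.
  intros Hs H T k. revert f H. induction k; intros f H.
  - destruct (kernel_majorized s f T H) as [M K]. exists (2 * (M * PI)). intros i t x Ht.
    simpl. rewrite Rmult_1_l. apply CIntR_bound. auto.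
  - destruct (IHk f H) as [M1 K1], (IHk (Dx f) (Cinf_Dx _ _ H)) as [M2 K2].
    exists (M1 + M2). intros i t x Ht. specialize (K1 i t x Ht). specialize (K2 i t x Ht).
    rewrite FT_Dx in K2 by auto. rewrite Cmod_mult in K2.
    replace (Cmod (0, - s * x)) with (Rabs x) in K2.
    + simpl. rewrite Rmult_plus_distr_r, Rmult_1_l, Rmult_plus_distr_r.
      apply Rplus_le_compat; auto. eapply Rle_trans; [|exact K2]. right; ring.
    + unfold Cmod; simpl. rewrite !Rmult_0_l, Rplus_0_l, Rmult_1_r.
      replace (- s * x * (- s * x)) with (Rsqr x). now rewrite sqrt_Rsqr_abs.
      unfold Rsqr. replace (- s * x * (- s * x)) with (s * s * (x * x)) by ring. rewrite Hs; ring.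
Qed.

Lemma Dt_FT s f : Cinf Wrapid f -> Dt (FT s f) = FT s (Dt f).
Proof. intros H; apply Dt_eq; intros; now apply FT_is_dC_t. Qed.

Lemma Dx_FT s f : Cinf Wrapid f -> Dx (FT s f) = FT s (mul_is s f).
Proof. intros H; apply Dx_eq; intros; now apply FT_is_dC_x. Qed.

Lemma Cinf_FT s f : s * s = 1 -> Cinf Wrapid f -> Cinf Wrapid (FT s f).
Proof.
  intros Hs H n. revert f H; induction n; intros f H.
  - split; auto. now apply FT_Wrapid.
  - apply (Cn_intro Wrapid n _ (FT s (Dt f)) (FT s (mul_is s f))).
    + now apply FT_Wrapid.
    + intros; now apply FT_is_dC_t.
    + intros; now apply FT_is_dC_x.
    + now apply IHn, Cinf_Dt.
    + now apply IHn, Cinf_mul_is.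
Qed.

(** Dividing by [x - x0] only shrinks [h] where [|x - x0| > 1]; on the remaining compact set the
    local bound on [k] is enough. *)
Lemma Wrapid_div x0 (k h : fam I) : Wloc k -> Wrapid h -> (forall i t x, (RtoC (x - x0) * k i t x)%C = h i t x) ->
  Wrapid k.
Proof.
  intros Hk Hh E T m.
  destruct (Hk T (Rabs x0 + 1)) as [M1 K1], (Hh T m) as [M2 K2].
  exists ((1 + (Rabs x0 + 1)) ^ m * Rabs M1 + Rabs M2); intros i t x Ht.
  assert (h1 := Rabs_pos M1); assert (h2 := Rabs_pos M2).
  assert (h3 := Rle_abs M1); assert (h4 := Rle_abs M2).
  assert (h5 := Cmod_ge_0 (k i t x)); assert (hw := wpow_ge1 x m); assert (hx := Rabs_pos x0).
  destruct (Rle_dec (Rabs (x - x0)) 1) as [d|d].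
  - assert (hx' := Rabs_le_1_shift _ _ d); specialize (K1 i t x Ht hx').
    assert (hp : (1 + Rabs x) ^ m <= (1 + (Rabs x0 + 1)) ^ m) by
       (apply pow_incr; assert (hq := Rabs_pos x); lra).
    assert ((1 + Rabs x) ^ m * Cmod (k i t x) <= (1 + (Rabs x0 + 1)) ^ m * Rabs M1) by
        (apply Rmult_le_compat; lra).
    lra.
  - specialize (K2 i t x Ht); rewrite <- E, Cmod_mult, Cmod_R in K2.
    assert ((1 + Rabs x) ^ m * Cmod (k i t x) <= (1 + Rabs x) ^ m * (Rabs (x - x0) * Cmod (k i t x))) by
       (apply Rmult_le_compat_l; nra).
    assert (0 <= (1 + (Rabs x0 + 1)) ^ m * Rabs M1) by
        (apply Rmult_le_pos; auto; apply pow_le; lra).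
    lra.
Qed.

(** Differentiating the identity gives [(x - x0) Dx k = Dx h - k], an instance of the same problem
    once [k] is known to belong to the class at the previous level. *)
Lemma Cn_div x0 n (k h : fam I) : Cinf Wloc k -> Cn Wrapid n h -> (forall i t x, (RtoC (x - x0) * k i t x)%C = h i t x) ->
  Cn Wrapid n k.
Proof.
  revert k h; induction n; intros k h Hk Hh E;
    assert (Hb := Wrapid_div x0 k h (Cinf_W _ _ Hk) (Cn_W _ _ _ Hh) E); [split; auto|].
  assert (E1 : forall i t x, (RtoC (x - x0) * Dt k i t x)%C = Dt h i t x).
  { intros i t x. symmetry. apply dC_is_dC.
    apply is_dC_ext with (fun s => RtoC (x - x0) * k i s x)%C; [intros; apply E|].
    apply is_dC_scal. exact (Cinf_is_dC_t _ _ _ _ _ Hk). }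
  assert (E2 : forall i t x, (RtoC (x - x0) * Dx k i t x)%C = (Dx h i t x + (-1) * k i t x)%C).
  { intros i t x.
    assert (Dx h i t x = (1 * k i t x + RtoC (x - x0) * Dx k i t x)%C) as ->; [|ring].
    apply dC_is_dC. apply is_dC_ext with (fun s => RtoC (s - x0) * k i t s)%C; [intros; apply E|].
    apply (is_dC_mult (fun s => RtoC (s - x0)) (fun s => k i t s)).
    - apply is_dC_RtoC. auto_derive; auto.
    - exact (Cinf_is_dC_x _ _ _ _ _ Hk). }
  assert (Hh' := Cn_S _ _ _ Hh). destruct Hh as [_ [_ [Hh3 Hh4]]].
  split; [auto|split; [exact (Cinf_dif _ _ Hk)|split]].
  - apply (IHn (Dt k) (Dt h)); auto using Cinf_Dt.
  - apply (IHn (Dx k) (fun i t x => Dx h i t x + (-1) * k i t x)%C); auto using Cinf_Dx.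
    apply Cn_plus; auto using Wrapid_add.
    apply (Cn_mul Wtame Wrapid Wrapid n (fun _ _ _ => (-1)%C) k Wrapid_add Wtame_Wrapid); [apply Cinf_const|].
    now apply (IHn k h).
Qed.

Lemma Cinf_freeze W t0 f : (forall f, W f -> W (fun i _ x => f i t0 x)) -> W (fun _ _ _ => RtoC 0) ->
  Cinf W f -> Cinf W (fun i _ x => f i t0 x).
Proof.
  intros HW Hz H n; revert f H; induction n; intros f H.
  - split; auto. now apply HW, Cinf_W.
  - apply (Cn_intro W n _ (fun _ _ _ => RtoC 0) (fun i _ x => Dx f i t0 x)).
    + now apply HW, Cinf_W.
    + intros; apply is_dC_const.
    + intros; exact (Cinf_is_dC_x _ _ _ _ _ H).
    + now apply Cn_zero.
    + apply IHn. now apply Cinf_Dx.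
Qed.

Lemma Wrapid_zero : Wrapid (fun (_ : I) _ _ => RtoC 0).
Proof. intros T k; exists 0; intros. rewrite Cmod_0. lra. Qed.

Lemma Wrapid_freeze t0 f : Wrapid f -> Wrapid (fun i _ x => f i t0 x).
Proof.
  intros H T k. destruct (H (Rabs t0) k) as [M K]. exists M; intros; apply K; lra.
Qed.

Lemma Wloc_freeze t0 f : Wloc f -> Wloc (fun i _ x => f i t0 x).
Proof.
  intros H T k. destruct (H (Rabs t0) k) as [M K]. exists M; intros; apply K; auto; lra.
Qed.

(** * The Gaussian and Fourier inversion *)

Definition gauss : fam I := fun _ _ x => cexp (RtoC (- (x ^ 2 / 2))).

Lemma gauss_bound k : exists M, forall x, (1 + Rabs x) ^ k * exp (- (x ^ 2 / 2)) <= M.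
Proof.
  destruct (poly_exp k 1 ltac:(lra)) as [M K]. exists (exp 1 * Rabs M).
  intros x. specialize (K x). assert (h := Rle_abs M).
  apply Rle_trans with ((1 + Rabs x) ^ k * (exp 1 * exp (- (1 * Rabs x)))).
  - apply Rmult_le_compat_l; [assert (hw := wpow_ge1 x k); lra|].
    rewrite <- exp_plus. assert (- (x ^ 2 / 2) <= 1 + - (1 * Rabs x)).
    { rewrite <- (pow2_abs x). nra. }
    destruct (Rle_lt_or_eq_dec _ _ H) as [h'|h']; [left; now apply exp_increasing|rewrite h'; lra].
  - assert (h3 := exp_pos 1).
    replace ((1 + Rabs x) ^ k * (exp 1 * exp (- (1 * Rabs x)))) with (exp 1 * ((1 + Rabs x) ^ k * exp (- (1 * Rabs x)))) by ring.
    apply Rmult_le_compat_l; lra.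
Qed.

Lemma gauss_Wrapid : Wrapid gauss.
Proof.
  intros T k. destruct (gauss_bound k) as [M K]. exists M.
  intros i t x _. unfold gauss. rewrite Cmod_cexp. apply K.
Qed.

Lemma Cinf_gauss : Cinf Wrapid gauss.
Proof.
  apply (Cinf_exp Wtame Wrapid (fun (_ : I) _ x => RtoC (- (x ^ 2 / 2)))).
  - apply Wrapid_add.
  - apply Wtame_Wrapid.
  - apply (Cinf_ext Wtame (fun _ _ x => RtoC (- / 2) * (RtoC x * RtoC x))%C).
    + intros. rewrite <- !RtoC_mult. f_equal. field.
    + cinf_tac.
  - apply gauss_Wrapid.
Qed.

Lemma Dx_gauss i t x : Dx gauss i t x = (RtoC (- x) * gauss i t x)%C.
Proof.
  apply dC_is_dC. apply (is_dC_cexp (fun y => RtoC (- (y ^ 2 / 2)))).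
  apply is_dC_RtoC. auto_derive; auto. field.
Qed.

(** The transform turns [g' = - x g] into the same differential equation in the frequency, so its
    product with [exp (z ^ 2 / 2)] is constant. *)
Lemma FT_gauss s i t xi : s * s = 1 -> FT s gauss i t xi = (FT s gauss i t 0%R * gauss i t xi)%C.
Proof.
  intros Hs.
  assert (D : forall y, is_dC (fun z => FT s gauss i t z) y (RtoC (- y) * FT s gauss i t y)%C).
  { intros y. eapply is_dC_eq; [apply FT_is_dC_x, Cinf_gauss|].
    assert (mul_is s gauss = fun i t x => (0, (- s)%R) * Dx gauss i t x)%C as ->.
    { fext3. rewrite Dx_gauss. unfold mul_is. rewrite Cmult_assoc. f_equal.
      apply injective_projections; simpl; ring. }
    rewrite (FT_scal s (fun _ _ => (0, - s)%R)) by apply Cinf_Dx, Cinf_gauss.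
    rewrite FT_Dx by apply Cinf_gauss. rewrite Cmult_assoc. f_equal.
    apply injective_projections; simpl; [|ring].
    replace (0 * 0 - - s * (- s * y)) with (- (s * s) * y) by ring. rewrite Hs; ring. }
  assert (E := is_dC_zero_const (fun z => FT s gauss i t z * cexp (RtoC (z ^ 2 / 2)))%C xi 0).
  cbv beta in E.
  assert (cexp (RtoC (0 ^ 2 / 2)) = RtoC 1) as E0.
  { rewrite <- cexp_0. do 2 f_equal. field. }
  rewrite E0 in E. unfold gauss at 3.
  replace (FT s gauss i t 0%R) with (FT s gauss i t 0%R * RtoC 1)%C by ring. rewrite <- E.
  - rewrite <- Cmult_assoc, <- cexp_plus, <- RtoC_plus.
    replace (xi ^ 2 / 2 + - (xi ^ 2 / 2)) with 0 by ring. rewrite cexp_0. ring.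
  - intros y. eapply is_dC_eq; [apply is_dC_mult; [apply D|]|].
    + apply (is_dC_cexp (fun z => RtoC (z ^ 2 / 2))). apply is_dC_RtoC.
      instantiate (1 := y). auto_derive; auto. field.
    + cbv beta. rewrite RtoC_opp. ring.
Qed.

Lemma FT_gauss_0 s i t : FT s gauss i t 0 = (RtoC (RIntR (fun x => exp (- (x ^ 2 / 2))))).
Proof.
  unfold FT, CIntR. f_equal.
  - apply injective_projections; simpl.
    + f_equal. apply functional_extensionality; intros x. unfold gauss, eix, cexp; simpl.
      replace (s * x * 0) with 0 by ring. rewrite exp_0, cos_0, sin_0. ring.
    + apply RIntR_unique. apply is_lim_seq_ext with (fun _ => 0); [|apply is_lim_seq_const].
      intros n. symmetry. rewrite (RInt_ext _ (fun _ => 0)).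
      * rewrite RInt_Rconst; simpl; ring.
      * intros x _. unfold gauss, eix, cexp; simpl.
        replace (s * x * 0) with 0 by ring. rewrite cos_0, sin_0. ring.
Qed.

Lemma gauss_integral_pos : 0 < RIntR (fun x => exp (- (x ^ 2 / 2))).
Proof.
  set (h := fun x => exp (- (x ^ 2 / 2))).
  assert (Hc : forall x, continuous h x).
  { intros x. apply (ex_derive_continuous h). unfold h; auto_derive; auto. }
  assert (Hex : forall a b, ex_RInt h a b) by (intros; now apply ex_RInt_cont).
  assert (Hp : forall a b, a <= b -> 0 <= RInt h a b).
  { intros; apply RInt_ge_0; auto. intros; left; apply exp_pos. }
  assert (H1 : 0 < RInt h (-1) 1).
  { apply RInt_gt_0; [lra|intros; apply exp_pos|intros; apply Hc]. }
  destruct (gauss_bound 2) as [M K].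
  assert (HB : forall x, Rabs (h x) <= M / (1 + x ^ 2)).
  { intros x. specialize (K x). fold (h x) in K.
    assert (hh : 0 < h x) by apply exp_pos. rewrite Rabs_right by lra.
    apply Rmult_le_reg_r with (1 + x ^ 2); [nra|].
    replace (M / (1 + x ^ 2) * (1 + x ^ 2)) with M by (field; nra).
    assert (hx := Rabs_pos x). rewrite <- (pow2_abs x). nra. }
  assert (L := RIntR_lim h M Hc HB).
  apply Rlt_le_trans with (1 := H1).
  apply (is_lim_seq_incr_1 (fun n => RInt h (- INR n) (INR n))) in L.
  apply (is_lim_seq_le (fun _ => RInt h (-1) 1) _ (Finite (RInt h (-1) 1)) (Finite (RIntR h))) in L;
    auto using is_lim_seq_const.
  intros n. rewrite S_INR. assert (hn := pos_INR n).
  assert (C : forall a b c, RInt h a b + RInt h b c = RInt h a c).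
  { intros; now apply RInt_RChasles. }
  rewrite <- (C (- (INR n + 1)) (-1) (INR n + 1)), <- (C (-1) 1 (INR n + 1)).
  assert (A1 := Hp (- (INR n + 1)) (-1) ltac:(lra)).
  assert (A2 := Hp 1 (INR n + 1) ltac:(lra)). lra.
Qed.

(** Equal to [2 PI], but only its positivity matters. *)
Definition inv_const : C := RtoC (RIntR (fun x => exp (- (x ^ 2 / 2))) ^ 2).

Lemma inv_const_neq_0 : inv_const <> RtoC 0.
Proof.
  intros H. apply RtoC_inj in H. assert (Hp := pow_lt _ 2 gauss_integral_pos). lra.
Qed.

Lemma FT_FT_gauss s i t x : s * s = 1 -> FT (- s) (FT s gauss) i t x = (inv_const * gauss i t x)%C.
Proof.
  intros Hs.
  assert (E : FT s gauss = fun i t x => (FT s gauss i t 0%R * gauss i t x)%C).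
  { fext3. now apply FT_gauss. }
  rewrite E. rewrite (FT_scal (- s) (fun i t => FT s gauss i t 0)) by apply Cinf_gauss.
  rewrite (FT_gauss (- s)) by (rewrite <- Hs; ring). rewrite !FT_gauss_0.
  unfold inv_const. rewrite Cmult_assoc, <- RtoC_mult. do 2 f_equal. ring.
Qed.

(** The first transform changes multiplication by [x - x0] into the operator [(0, - s) Dx - x0];
    under the second, evaluated at [x0], this becomes the factor [x0 - x0]. *)
Lemma FT_FT_vanish s x0 (k : fam I) i t : s * s = 1 -> Cinf Wrapid k ->
  FT (- s) (FT s (fun i t x => RtoC (x - x0) * k i t x)%C) i t x0 = RtoC 0.
Proof.
  intros Hs H.
  assert (E : FT s (fun i t x => RtoC (x - x0) * k i t x)%C =
    fun i t x => ((0, - s)%R * Dx (FT s k) i t x + RtoC (- x0) * FT s k i t x)%C).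
  { fext3. rewrite Dx_FT by auto.
    rewrite <- (FT_scal s (fun _ _ => (0, - s)%R)) by now apply Cinf_mul_is.
    rewrite <- (FT_scal s (fun _ _ => RtoC (- x0))) by auto.
    rewrite <- FT_plus; [| |].
    - f_equal. fext3. unfold mul_is. rewrite Cmult_assoc, <- Cmult_plus_distr_r. f_equal.
      apply injective_projections; simpl; [|ring].
      replace (0 * 0 - - s * (s * x1) + - x0) with (s * s * x1 - x0) by ring. rewrite Hs; ring.
    - apply (Cinf_tame_rapid (fun _ _ _ => (0, - s)%R) (mul_is s k));
        [apply Cinf_const|now apply Cinf_mul_is].
    - apply (Cinf_tame_rapid (fun _ _ _ => RtoC (- x0)) k); auto using Cinf_const. }
  assert (HK := Cinf_FT s k Hs H).
  rewrite E, FT_plus.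
  - rewrite (FT_scal (- s) (fun _ _ => (0, - s)%R)) by now apply Cinf_Dx.
    rewrite (FT_scal (- s) (fun _ _ => RtoC (- x0))) by auto.
    rewrite FT_Dx by auto. rewrite Cmult_assoc, <- Cmult_plus_distr_r.
    replace ((0, - s)%R * (0, (- - s * x0)%R) + RtoC (- x0))%C with (RtoC 0); [ring|].
    apply injective_projections; simpl; [|ring].
    replace (0 * 0 - - s * (- - s * x0) + - x0) with (s * s * x0 - x0) by ring. rewrite Hs; ring.
  - apply (Cinf_tame_rapid (fun _ _ _ => (0, - s)%R) (Dx (FT s k)));
        [apply Cinf_const|now apply Cinf_Dx].
  - apply (Cinf_tame_rapid (fun _ _ _ => RtoC (- x0)) (FT s k)); auto using Cinf_const.
Qed.

Lemma Cinf_reindex {J : Type} j f : Cinf Wrapid f -> Cinf Wrapid (fun (_ : J) => f j).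
Proof.
  intros H n; revert f H; induction n; intros f H.
  all: assert (Hb : Wrapid (fun (_ : J) => f j)) by
    (intros T k; destruct (Cinf_W _ _ H T k) as [M K]; exists M; auto).
  - split; auto.
  - apply (Cn_intro Wrapid n _ (fun _ => Dt f j) (fun _ => Dx f j)); auto using Cinf_Dt, Cinf_Dx.
    + intros; exact (Cinf_is_dC_t _ _ _ _ _ H).
    + intros; exact (Cinf_is_dC_x _ _ _ _ _ H).
Qed.

(** Inversion: near [x0], [f] is a multiple of the Gaussian plus [(x - x0) k], and the transform
    of the second term is, up to a phase, a derivative, which integrates to zero. *)
Lemma FT_inversion s f i t x0 : s * s = 1 -> Cinf Wrapid f -> FT (- s) (FT s f) i t x0 = (inv_const * f i t x0)%C.
Proof.
  intros Hs Hf.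
  (* Time is frozen at [t], so that subtracting a multiple of the Gaussian makes [h] vanish at [x0]
     for every value of the remaining time variable, as the division requires. *)
  set (g := fun (_ : I) (_ : R) x => f i t x).
  change (FT (- s) (FT s f) i t x0) with (FT (- s) (FT s g) i t x0).
  assert (Hg : Cinf Wrapid g).
  { apply (Cinf_freeze Wrapid t (fun _ => f i)); auto using Wrapid_freeze, Wrapid_zero. now apply Cinf_reindex. }
  set (c := (f i t x0 / gauss i t x0)%C).
  set (h := fun (j : I) (u : R) x => (f i t x + (- c) * gauss j u x)%C).
  assert (Hh : Cinf Wrapid h).
  { apply (Cinf_plus Wrapid g (fun j u x => (- c) * gauss j u x)%C Wrapid_add); auto.
    apply (Cinf_tame_rapid (fun _ _ _ => (- c)%C) gauss); auto using Cinf_const, Cinf_gauss. }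
  set (k := hadamard x0 0 (Dx h)).
  assert (E : forall j u x, (RtoC (x - x0) * k j u x)%C = h j u x).
  { intros j u x. rewrite (hadamard_div x0 h j u x) by now apply Cinf_Wrapid_Wloc.
    unfold h at 1. unfold c, gauss. fold k. field. apply cexp_neq_0. }
  assert (Hk : Cinf Wrapid k).
  { intros n. apply (Cn_div x0 n k h); auto. intros m; apply Cn_hadamard, Cinf_Dx, Cinf_Wrapid_Wloc; auto. }
  assert (Hxk : Cinf Wrapid (fun j u x => RtoC (x - x0) * k j u x)%C).
  { apply (Cinf_ext Wrapid h); auto. }
  assert (Hcg : Cinf Wrapid (fun j u x => c * gauss j u x)%C).
  { apply (Cinf_tame_rapid (fun _ _ _ => c) gauss); auto using Cinf_const, Cinf_gauss. }
  assert (Eg : g = fun j u x => (c * gauss j u x + RtoC (x - x0) * k j u x)%C).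
  { unfold g. fext3. rewrite E. unfold h. ring. }
  assert (EF : FT s g = fun j u x =>
    (c * FT s gauss j u x + FT s (fun j u x => RtoC (x - x0) * k j u x)%C j u x)%C).
  { fext3. rewrite Eg, FT_plus by auto. f_equal. apply (FT_scal s (fun _ _ => c)), Cinf_gauss. }
  rewrite EF, FT_plus, FT_FT_vanish, (FT_scal (- s) (fun _ _ => c)), FT_FT_gauss; auto using Cinf_FT, Cinf_gauss.
  - unfold c, gauss. field. apply cexp_neq_0.
  - apply (Cinf_tame_rapid (fun _ _ _ => c) (FT s gauss)); auto using Cinf_const, Cinf_FT, Cinf_gauss.
Qed.
End Fourier.

(** * Schwartz functions and the operator on the Fourier side *)

Definition lift (f : R -> R -> C) : fam unit := fun _ => f.

Ltac fext2 := apply functional_extensionality; intros ?t;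
  apply functional_extensionality; intros ?x.

Lemma cont2_fst f t x : cont2 f -> continuity_2d_pt (fun t x => fst (f t x)) t x.
Proof.
  intros H eps. destruct (H t x eps (cond_pos eps)) as [d [Hd K]].
  exists (mkposreal d Hd). intros u v Hu Hv. eapply Rle_lt_trans; [|apply K; eassumption].
  apply (abs_fst_Cmod (f u v - f t x)%C).
Qed.

Lemma cont2_snd f t x : cont2 f -> continuity_2d_pt (fun t x => snd (f t x)) t x.
Proof.
  intros H eps. destruct (H t x eps (cond_pos eps)) as [d [Hd K]].
  exists (mkposreal d Hd). intros u v Hu Hv. eapply Rle_lt_trans; [|apply K; eassumption].
  apply (abs_snd_Cmod (f u v - f t x)%C).
Qed.

Lemma dt_dx_comm f w : smooth2 f -> dt (dx (Dword w f)) = dx (dt (Dword w f)).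
Proof.
  intros H. set (g := Dword w f).
  assert (Hg := proj2 (H w)). assert (Ht := proj2 (H (true :: w))). assert (Hx := proj2 (H (false :: w))).
  assert (Htx := proj1 (H (true :: false :: w))). assert (Hxt := proj1 (H (false :: true :: w))).
  simpl in Ht, Hx, Htx, Hxt. fold g in Hg, Ht, Hx, Htx, Hxt.
  fext2. apply injective_projections.
  - apply (Schwarz (fun t x => fst (g t x)) t x).
    + exists (mkposreal 1 Rlt_0_1). intros u v _ _.
      split; [exact (proj1 (Hg u v))|split; [exact (proj1 (proj2 (proj2 (Hg u v))))|split]].
      * exact (proj1 (Hx u v)).
      * exact (proj1 (proj2 (proj2 (Ht u v)))).
    + exact (cont2_fst _ t x Htx).
    + exact (cont2_fst _ t x Hxt).
  - apply (Schwarz (fun t x => snd (g t x)) t x).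
    + exists (mkposreal 1 Rlt_0_1). intros u v _ _.
      split; [exact (proj1 (proj2 (Hg u v)))|split; [exact (proj2 (proj2 (proj2 (Hg u v))))|split]].
      * exact (proj1 (proj2 (Hx u v))).
      * exact (proj2 (proj2 (proj2 (Ht u v)))).
    + exact (cont2_snd _ t x Htx).
    + exact (cont2_snd _ t x Hxt).
Qed.

Lemma Dab_Dword f a b : Dab a b f = Dword (repeat true a ++ repeat false b) f.
Proof.
  unfold Dab. induction a; simpl.
  - induction b; simpl; congruence.
  - now rewrite IHa.
Qed.

Lemma dx_Dab f a b : smooth2 f -> dx (Dab a b f) = Dab a (S b) f.
Proof.
  intros H; induction a; [reflexivity|].
  change (Dab (S a) b f) with (dt (Dab a b f)). change (Dab (S a) (S b) f) with (dt (Dab a (S b) f)).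
  rewrite <- IHa, Dab_Dword. symmetry. now apply dt_dx_comm.
Qed.

(** The seminorms control only derivatives in the order of [Dab]; commuting partial derivatives
    carries their bounds to all words, as [Cn] demands. *)
Lemma Dword_Dab f w : smooth2 f -> exists a b, Dword w f = Dab a b f.
Proof.
  intros H; induction w as [|[|] w IH]; simpl.
  - exists O, O; reflexivity.
  - destruct IH as [a [b ->]]. exists (S a), b; reflexivity.
  - destruct IH as [a [b ->]]. exists a, (S b). now apply dx_Dab.
Qed.

Lemma wpow_split x k : (1 + Rabs x) ^ k <= 2 ^ k * (1 + Rabs x ^ k).
Proof.
  assert (Hx := Rabs_pos x). destruct (Rle_dec (Rabs x) 1).
  - apply Rle_trans with (2 ^ k * 1).
    + rewrite Rmult_1_r. apply pow_incr; lra.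
    + apply Rmult_le_compat_l; [apply pow_le; lra|]. assert (H := pow_le (Rabs x) k Hx). lra.
  - apply Rle_trans with (2 ^ k * Rabs x ^ k).
    + rewrite <- Rpow_mult_distr. apply pow_incr; lra.
    + apply Rmult_le_compat_l; [apply pow_le; lra|]. lra.
Qed.

Lemma schwartz_Cinf f : schwartz f -> Cinf Wrapid (lift f).
Proof.
  intros [_ [Hs Hb]] n.
  assert (K : forall n w, Cn Wrapid n (lift (Dword w f))); [|exact (K n nil)].
  clear n. induction n; intros w.
  all: assert (HW : Wrapid (lift (Dword w f))).
  1, 3: intros T k; destruct (Dword_Dab f w Hs) as [a [b ->]];
    destruct (Hb a b O) as [M0 K0], (Hb a b k) as [M1 K1]; exists (2 ^ k * (M0 + M1));
    intros i t x _; unfold lift; specialize (K0 t x); specialize (K1 t x); simpl in K0;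
    (eapply Rle_trans; [apply Rmult_le_compat_r; [apply Cmod_ge_0|apply wpow_split]|]);
    rewrite Rmult_assoc; (apply Rmult_le_compat_l; [apply pow_le; lra|]); lra.
  - split; auto.
  - split; [auto|split; [|split]].
    + intros i t x. destruct (proj2 (Hs w) t x) as [A1 [A2 [A3 A4]]]. split; apply is_dC_dC; split; assumption.
    + exact (IHn (true :: w)).
    + exact (IHn (false :: w)).
Qed.

Lemma Cinf_Dword f w : Cinf Wrapid (lift f) -> Cinf Wrapid (lift (Dword w f)).
Proof.
  intros H; induction w as [|[|] w IH]; [exact H|exact (Cinf_Dt _ _ IH)|exact (Cinf_Dx _ _ IH)].
Qed.

Lemma periodic_dt f : periodic2 f -> periodic2 (dt f).
Proof.
  intros H t x. unfold dt, dC.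
  assert (E : forall p : C -> R, Derive (fun s => p (f s x)) (t + 2 * PI) = Derive (fun s => p (f s x)) t).
  { intros p. transitivity (Derive (fun s => p (f (s + 2 * PI) x)) t).
    - unfold Derive. f_equal. apply Lim_ext. intros h. do 4 f_equal. ring.
    - apply Derive_ext. intros; now rewrite H. }
  now rewrite (E fst), (E snd).
Qed.

Lemma periodic_dx f : periodic2 f -> periodic2 (dx f).
Proof.
  intros H t x. unfold dx. f_equal. apply functional_extensionality; intros; apply H.
Qed.

Lemma periodic_nat {A} (f : R -> A) (H : forall t, f (t + 2 * PI) = f t) n t : f (t + 2 * PI * INR n) = f t.
Proof.
  induction n.
  - simpl. f_equal; ring.
  - rewrite S_INR. replace (t + 2 * PI * (INR n + 1)) with (t + 2 * PI * INR n + 2 * PI) by ring.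
    now rewrite H.
Qed.

Lemma periodic_Z {A} (f : R -> A) (H : forall t, f (t + 2 * PI) = f t) k t : f (t + 2 * PI * IZR k) = f t.
Proof.
  destruct (Z_le_dec 0 k) as [h|h].
  - rewrite <- (Z2Nat.id k h), <- INR_IZR_INZ. now apply periodic_nat.
  - assert (E : IZR k = - INR (Z.to_nat (- k))).
    { rewrite INR_IZR_INZ, Z2Nat.id by lia. rewrite opp_IZR. ring. }
    rewrite E. rewrite <- (periodic_nat f H (Z.to_nat (- k))). f_equal. ring.
Qed.

Lemma modT_bounds t : 0 <= modT t < 2 * PI.
Proof.
  unfold modT. assert (Hp := PI_RGT_0). destruct (base_Int_part (t / (2 * PI))) as [h1 h2].
  set (k := IZR (Int_part (t / (2 * PI)))) in *.
  assert (E : t = 2 * PI * (t / (2 * PI))) by (field; lra).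
  split.
  - rewrite E. nra.
  - rewrite E at 1. nra.
Qed.

Lemma periodic_modT {A} (f : R -> A) (H : forall t, f (t + 2 * PI) = f t) t : f (modT t) = f t.
Proof.
  unfold modT. set (k := Int_part (t / (2 * PI))).
  rewrite <- (periodic_Z f H (- k) t). f_equal. rewrite opp_IZR. ring.
Qed.

Lemma Cinf_schwartz f : periodic2 f -> Cinf Wrapid (lift f) -> schwartz f.
Proof.
  intros Hp H. split; [auto|split].
  - intros w. assert (Hw := Cinf_Dword f w H). split.
    + exact (Cinf0_cont2 (lift (Dword w f)) tt (Cinf_Wrapid_Wloc _ Hw)).
    + intros t x. destruct (is_dC_ex _ _ _ (Cinf_is_dC_t _ _ tt t x Hw)) as [A1 A2].
      destruct (is_dC_ex _ _ _ (Cinf_is_dC_x _ _ tt t x Hw)) as [A3 A4]. auto.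
  - intros a b g. rewrite Dab_Dword. set (w := repeat true a ++ repeat false b).
    assert (Hper : periodic2 (Dword w f)).
    { generalize w. clear - Hp. induction w as [|[|] w IH]; simpl; auto using periodic_dt, periodic_dx. }
    (* [Wrapid] is uniform only for bounded [t]; periodicity reduces to one period. *)
    destruct (Cinf_W _ _ (Cinf_Dword f w H) (2 * PI) g) as [M K]. exists M. intros t x.
    rewrite <- (periodic_modT (fun t => Dword w f t x) (fun t => Hper t x) t).
    assert (Hm := modT_bounds t).
    eapply Rle_trans; [|apply (K tt (modT t) x); rewrite Rabs_right; lra].
    apply Rmult_le_compat_r; [apply Cmod_ge_0|]. apply pow_incr. assert (h := Rabs_pos x). lra.
Qed.

Lemma smooth_T1_Cinf {I} c : smooth_T1 c -> Cinf Wtame (fun (_ : I) t _ => c t).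
Proof.
  intros [_ H]. apply Cinf_xfree; [|intros i t x y; reflexivity].
  assert (Hd : forall m t, is_dC (Nat.iter m dC c) t (Nat.iter (S m) dC c t)).
  { intros m t. apply is_dC_dC. apply (H m). }
  assert (K : forall n m, Cn Wloc n (fun (_ : I) t _ => Nat.iter m dC c t)); [|intros n; exact (K n O)].
  induction n; intros m;
    assert (HW : Wloc (fun (_ : I) t (_ : R) => Nat.iter m dC c t)) by
      (apply (Wloc_of_t (Nat.iter m dC c)); apply (is_dC_ccont _ _ (Hd m))).
  - split; auto.
  - apply (Cn_intro Wloc n _ (fun _ t _ => Nat.iter (S m) dC c t) (fun _ _ _ => RtoC 0)); auto.
    + intros; apply is_dC_const.
    + apply Cn_zero, Wloc_const.
Qed.

Section Operator.
Variables (c q : R -> C).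

Definition lam (t xi : R) : C := ((0, xi) * c t + q t)%C.

Hypotheses (Hc : smooth_T1 c) (Hq : smooth_T1 q).

Lemma Cinf_lam {I} : Cinf Wtame (fun (_ : I) t xi => lam t xi).
Proof.
  apply (Cinf_ext Wtame (fun _ t xi => (0, 1) * RtoC xi * c t + q t)%C).
  - intros; unfold lam. f_equal. f_equal. apply injective_projections; simpl; ring.
  - assert (Ac := smooth_T1_Cinf (I := I) c Hc). assert (Aq := smooth_T1_Cinf (I := I) q Hq). cinf_tac.
Qed.

Lemma Cinf_cdx_qu {I} (u v : fam I) : Cinf Wrapid u -> Cinf Wrapid v -> Cinf Wrapid (fun i t x => c t * u i t x + q t * v i t x)%C.
Proof.
  intros Hu Hv. assert (Ac := smooth_T1_Cinf (I := I) c Hc). assert (Aq := smooth_T1_Cinf (I := I) q Hq).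
  apply (Cinf_plus Wrapid (fun i t x => c t * u i t x)%C (fun i t x => q t * v i t x)%C Wrapid_add).
  - exact (Cinf_tame_rapid (fun _ t _ => c t) u Ac Hu).
  - exact (Cinf_tame_rapid (fun _ t _ => q t) v Aq Hv).
Qed.

Lemma Lop_eq u : Lop c q u = fun t x => (dt u t x + (c t * dx u t x + q t * u t x))%C.
Proof. fext2. unfold Lop. symmetry. apply Cplus_assoc. Qed.

Lemma Cinf_Lop u : Cinf Wrapid (lift u) -> Cinf Wrapid (lift (Lop c q u)).
Proof.
  intros H. rewrite Lop_eq.
  exact (Cinf_plus Wrapid (Dt (lift u)) (fun i t x => c t * Dx (lift u) i t x + q t * lift u i t x)%C Wrapid_add
    (Cinf_Dt _ _ H) (Cinf_cdx_qu _ _ (Cinf_Dx _ _ H) H)).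
Qed.

Lemma FT_coef {I} s (u v : fam I) i t xi : Cinf Wrapid u -> Cinf Wrapid v ->
  FT s (fun i t x => c t * u i t x + q t * v i t x)%C i t xi = (c t * FT s u i t xi + q t * FT s v i t xi)%C.
Proof.
  intros Hu Hv. assert (Ac := smooth_T1_Cinf (I := I) c Hc). assert (Aq := smooth_T1_Cinf (I := I) q Hq).
  rewrite <- (FT_scal s (fun _ t => c t)), <- (FT_scal s (fun _ t => q t)) by auto.
  apply FT_plus.
  - exact (Cinf_tame_rapid (fun _ t _ => c t) u Ac Hu).
  - exact (Cinf_tame_rapid (fun _ t _ => q t) v Aq Hv).
Qed.

Lemma FT_Lop u t xi : Cinf Wrapid (lift u) ->
  FT (-1) (lift (Lop c q u)) tt t xi =
  (Dt (FT (-1) (lift u)) tt t xi + lam t xi * FT (-1) (lift u) tt t xi)%C.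
Proof.
  intros H. rewrite Lop_eq.
  change (lift (fun t x => (dt u t x + (c t * dx u t x + q t * u t x)))%C) with
   (fun i t x => (Dt (lift u) i t x + (c t * Dx (lift u) i t x + q t * lift u i t x)))%C.
  rewrite FT_plus; [|now apply Cinf_Dt|now apply Cinf_cdx_qu; [apply Cinf_Dx|]].
  rewrite FT_coef; [|now apply Cinf_Dx|auto].
  rewrite Dt_FT, FT_Dx by auto. unfold lam.
  replace (- (-1) * xi) with xi by ring. ring.
Qed.

Lemma Lop_FT V t x : Cinf Wrapid V ->
  Lop c q (FT 1 V tt) t x = FT 1 (fun i t xi => Dt V i t xi + lam t xi * V i t xi)%C tt t x.
Proof.
  intros H. rewrite Lop_eq. change (dt (FT 1 V tt)) with (Dt (FT 1 V) tt).
  change (dx (FT 1 V tt)) with (Dx (FT 1 V) tt).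
  rewrite Dt_FT, Dx_FT by auto. rewrite <- FT_coef; auto using Cinf_mul_is.
  rewrite <- FT_plus; auto using Cinf_Dt, Cinf_cdx_qu, Cinf_mul_is.
  f_equal. fext3. unfold mul_is, lam. rewrite Rmult_1_l. ring.
Qed.

Lemma FT_schwartz s V : s * s = 1 -> periodic2 (V tt) -> Cinf Wrapid V -> schwartz (FT s V tt).
Proof.
  intros Hs Hp H. apply Cinf_schwartz.
  - intros t x. unfold FT. apply CIntR_ext. intros; now rewrite Hp.
  - replace (lift (FT s V tt)) with (FT s V); [now apply Cinf_FT|].
    apply functional_extensionality; now intros [].
Qed.

Lemma schwartz_scal a u : schwartz u -> schwartz (fun t x => a * u t x)%C.
Proof.
  intros H. apply Cinf_schwartz.
  - intros t x. now rewrite (proj1 H).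
  - exact (Cinf_tame_rapid (fun _ _ _ => a) (lift u) (Cinf_const a) (schwartz_Cinf u H)).
Qed.

Lemma Lop_scal a u t x : Cinf Wrapid (lift u) -> Lop c q (fun t x => a * u t x)%C t x = (a * Lop c q u t x)%C.
Proof.
  intros H. unfold Lop.
  assert (dt (fun t x => a * u t x)%C t x = (a * dt u t x)%C) as ->.
  { apply dC_is_dC. apply is_dC_scal. exact (Cinf_is_dC_t _ _ tt t x H). }
  assert (dx (fun t x => a * u t x)%C t x = (a * dx u t x)%C) as ->.
  { apply dC_is_dC. apply is_dC_scal. exact (Cinf_is_dC_x _ _ tt t x H). }
  ring.
Qed.

Lemma solve_from_FT f V : schwartz f -> periodic2 (V tt) -> Cinf Wrapid V ->
  (forall t xi, (Dt V tt t xi + lam t xi * V tt t xi)%C = FT (-1) (lift f) tt t xi) ->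
  exists u, schwartz u /\ forall t x, Lop c q u t x = f t x.
Proof.
  intros Hf Hp HV E. assert (Sf := schwartz_Cinf f Hf).
  assert (S1 : schwartz (FT 1 V tt)) by (apply FT_schwartz; auto; ring).
  (* The transforms carry no normalization, so the inversion constant is divided out here. *)
  exists (fun t x => (/ inv_const) * FT 1 V tt t x)%C. split.
  - now apply schwartz_scal.
  - intros t x. rewrite Lop_scal by now apply schwartz_Cinf.
    rewrite Lop_FT by auto.
    replace (fun i t xi => Dt V i t xi + lam t xi * V i t xi)%C with (FT (-1) (lift f)).
    2: { fext3. destruct i. now rewrite E. }
    assert (Hi := FT_inversion (-1) (lift f) tt t x ltac:(ring) Sf).
    replace (- (-1)) with 1 in Hi by ring. rewrite Hi. unfold lift. field. apply inv_const_neq_0.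
Qed.

End Operator.

(** * The differential equation at a fixed frequency *)

Lemma Cinf_smooth2 (f : fam unit) : Cinf Wloc f -> smooth2 (f tt).
Proof.
  intros H w.
  assert (Hw : exists g : fam unit, Cinf Wloc g /\ g tt = Dword w (f tt)).
  { induction w as [|[|] w [g [Hg E]]]; simpl.
    - exists f; auto.
    - exists (Dt g); split; [now apply Cinf_Dt|]. rewrite <- E; reflexivity.
    - exists (Dx g); split; [now apply Cinf_Dx|]. rewrite <- E; reflexivity. }
  destruct Hw as [g [Hg <-]]. split.
  - now apply Cinf0_cont2.
  - intros t x. destruct (is_dC_ex _ _ _ (Cinf_is_dC_t _ _ tt t x Hg)) as [A1 A2].
    destruct (is_dC_ex _ _ _ (Cinf_is_dC_x _ _ tt t x Hg)) as [A3 A4]. auto.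
Qed.

Lemma Dt_Dx (f : fam unit) : Cinf Wloc f -> Dt (Dx f) = Dx (Dt f).
Proof.
  intros H. apply functional_extensionality; intros [].
  exact (dt_dx_comm (f tt) nil (Cinf_smooth2 f H)).
Qed.

Lemma is_dC_real (f : R -> C) t l : is_dC f t l -> is_derive (fun s => fst (f s)) t (fst l).
Proof. intros H; exact (proj1 H). Qed.

Lemma exp_le x y : x <= y -> exp x <= exp y.
Proof.
  intros H. destruct (Rle_lt_or_eq_dec _ _ H) as [h|h]; [left; now apply exp_increasing|rewrite h; lra].
Qed.

Section ODE.
Variables (c q : R -> C).
Hypotheses (Hc : smooth_T1 c) (Hq : smooth_T1 q).

Definition Lam (t xi : R) : C := ((0, xi) * CInt c 0 t + CInt q 0 t)%C.

Lemma smooth_ccont : forall f, smooth_T1 f -> ccont f.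
Proof.
  intros f Hf. exact (Cinf0_ccont_t (fun (_ : unit) t _ => f t) tt 0 (Cinf_Wtame_Wloc _ (smooth_T1_Cinf f Hf))).
Qed.

Lemma Cinf_primT {I} f : smooth_T1 f -> Cinf Wtame (fun (_ : I) t _ => CInt f 0 t).
Proof.
  intros H. apply Cinf_xfree; [|intros i t x y; reflexivity].
  exact (Cinf_prim 0 (fun _ t _ => f t) (Cinf_Wtame_Wloc _ (smooth_T1_Cinf f H))).
Qed.

Lemma Cinf_Lam {I} : Cinf Wtame (fun (_ : I) t xi => Lam t xi).
Proof.
  apply (Cinf_ext Wtame (fun _ t xi => (0, 1) * RtoC xi * CInt c 0 t + CInt q 0 t)%C).
  - intros; unfold Lam. f_equal. f_equal. apply injective_projections; simpl; ring.
  - assert (Ac := Cinf_primT (I := I) c Hc). assert (Aq := Cinf_primT (I := I) q Hq). cinf_tac.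
Qed.

Lemma is_dC_Lam t xi : is_dC (fun t => Lam t xi) t (lam c q t xi).
Proof.
  unfold Lam, lam. apply is_dC_plus; [apply is_dC_scal|]; apply is_dC_CInt; now apply smooth_ccont.
Qed.

Lemma Lam_0 xi : Lam 0 xi = RtoC 0.
Proof. unfold Lam. rewrite !CInt_point. ring. Qed.

Lemma lam_per t xi : lam c q (t + 2 * PI) xi = lam c q t xi.
Proof. unfold lam. now rewrite (proj1 Hc), (proj1 Hq). Qed.

Lemma is_dC_shift (f : R -> C) a t l : is_dC f (t + a) l -> is_dC (fun s => f (s + a)%R) t l.
Proof.
  intros H. eapply is_dC_eq; [apply (is_dC_comp f (fun s => s + a)); [exact H|]|].
  - instantiate (1 := 1). auto_derive; auto.
  - ring.
Qed.

Lemma Lam_shift t xi : Lam (t + 2 * PI) xi = (Lam t xi + Lam (2 * PI) xi)%C.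
Proof.
  assert (E := is_dC_zero_const (fun t => Lam (t + 2 * PI)%R xi - Lam t xi)%C t 0).
  cbv beta in E. rewrite Lam_0, Rplus_0_l in E.
  replace (Lam (t + 2 * PI) xi) with ((Lam (t + 2 * PI) xi - Lam t xi) + Lam t xi)%C by ring.
  rewrite E; [ring|].
  intros u. eapply is_dC_eq; [apply is_dC_minus; [apply (is_dC_shift (fun t => Lam t xi)), is_dC_Lam|apply is_dC_Lam]|].
  rewrite lam_per. ring.
Qed.

Definition is_sol (xi : R) (v g : R -> C) : Prop := forall t, is_dC v t (g t - lam c q t xi * v t)%C.

Lemma is_dC_eLam_sol xi v g t : is_sol xi v g ->
  is_dC (fun t => cexp (Lam t xi) * v t)%C t (cexp (Lam t xi) * g t)%C.
Proof.
  intros H. eapply is_dC_eq; [apply is_dC_mult; [apply is_dC_cexp, is_dC_Lam|apply H]|]. cbv beta; ring.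
Qed.

Lemma sol_unique xi v w g t0 t : is_sol xi v g -> is_sol xi w g -> v t0 = w t0 -> v t = w t.
Proof.
  intros Hv Hw E.
  assert (E1 := is_dC_zero_const (fun t => cexp (Lam t xi) * v t - cexp (Lam t xi) * w t)%C t t0).
  cbv beta in E1.
  assert (E2 : (cexp (Lam t xi) * (v t - w t))%C = RtoC 0).
  { replace (cexp (Lam t xi) * (v t - w t))%C with (cexp (Lam t xi) * v t - cexp (Lam t xi) * w t)%C by ring.
    rewrite E1; [rewrite E; ring|].
    intros u. eapply is_dC_eq; [apply is_dC_minus; apply is_dC_eLam_sol; eassumption|cbv beta; ring]. }
  assert (E3 : (v t - w t)%C = RtoC 0).
  { replace (v t - w t)%C with (/ cexp (Lam t xi) * (cexp (Lam t xi) * (v t - w t)))%C.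
    rewrite E2; ring. field. apply cexp_neq_0. }
  replace (v t) with ((v t - w t) + w t)%C by ring. rewrite E3; ring.
Qed.

(** The translate by one period solves the same equation with the same initial value. *)
Lemma sol_periodic xi v g : (forall t, g (t + 2 * PI) = g t) -> is_sol xi v g -> v (2 * PI) = v 0 ->
  forall t, v (t + 2 * PI) = v t.
Proof.
  intros Hg Hv E t. apply (sol_unique xi (fun t => v (t + 2 * PI)) v g 0 t); auto.
  - intros u. eapply is_dC_eq; [apply is_dC_shift, Hv|]. now rewrite Hg, lam_per.
  - now rewrite Rplus_0_l.
Qed.

(** [kappa] is the value at [t = 0]; it has to be chosen so that the solution is periodic. *)
Definition sol (kappa : R -> C) (G : fam unit) : fam unit := fun i t xi =>
  (cexp (- Lam t xi) * (kappa xi + prim 0 (fun i t xi => cexp (Lam t xi) * G i t xi)%C i t xi))%C.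

Lemma Cinf_eLamG (G : fam unit) : Cinf Wloc G -> Cinf Wloc (fun i t xi => cexp (Lam t xi) * G i t xi)%C.
Proof.
  intros H. apply (Cinf_mul Wloc Wloc Wloc (fun i t xi => cexp (Lam t xi)) G Wloc_add Wloc_mul); auto.
  apply (Cinf0_exp (fun i t xi => Lam t xi)), Cinf_Wtame_Wloc, Cinf_Lam.
Qed.

Lemma sol_is_sol kappa G xi : Cinf Wloc G -> is_sol xi (fun t => sol kappa G tt t xi) (fun t => G tt t xi).
Proof.
  intros H t. unfold sol, prim.
  eapply is_dC_eq.
  - apply is_dC_mult; [apply is_dC_cexp, is_dC_opp, is_dC_Lam|].
    apply is_dC_plus; [apply is_dC_const|].
    apply (is_dC_CInt (fun s => cexp (Lam s xi) * G tt s xi)%C).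
    exact (Cinf0_ccont_t _ tt xi (Cinf_eLamG G H)).
  - cbv beta. set (A := (_ + CInt _ _ _)%C).
    replace (G tt t xi) with ((cexp (- Lam t xi) * cexp (Lam t xi)) * G tt t xi)%C at 2
      by (rewrite cexp_opp; ring). ring.
Qed.

Lemma Cinf_sol kappa G : Cinf Wloc (fun (_ : unit) _ xi => kappa xi) -> Cinf Wloc G -> Cinf Wloc (sol kappa G).
Proof.
  intros Hk H. unfold sol.
  assert (H1 : Cinf Wloc (fun (i : unit) t xi => cexp (- Lam t xi))).
  { apply (Cinf0_exp (fun i t xi => - Lam t xi)%C).
    apply (Cinf_ext Wloc (fun i t xi => (-1) * Lam t xi)%C); [intros; ring|].
    apply Cinf_Wtame_Wloc. assert (HL := Cinf_Lam (I := unit)). cinf_tac. }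
  assert (H2 := Cinf_prim 0 _ (Cinf_eLamG G H)).
  apply (Cinf_mul Wloc Wloc Wloc (fun i t xi => cexp (- Lam t xi))
    (fun i t xi => kappa xi + prim 0 (fun i t xi => cexp (Lam t xi) * G i t xi)%C i t xi)%C Wloc_add Wloc_mul); auto.
  apply (Cinf_plus Wloc (fun _ _ xi => kappa xi)
    (fun i t xi => prim 0 (fun i t xi => cexp (Lam t xi) * G i t xi)%C i t xi) Wloc_add); auto.
Qed.

(** The contribution of the forcing over one turn. At a resonance it has to vanish; elsewhere it
    determines [kappa] through the hypothesis of [sol_per]. *)
Definition period_int (G : fam unit) (xi : R) : C := CInt (fun s => cexp (Lam s xi) * G tt s xi)%C 0 (2 * PI).

Lemma Cinf_freeze0 (t0 : R) (f : fam unit) : Cinf Wloc f -> Cinf Wloc (fun i _ x => f i t0 x).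
Proof. intros H; apply Cinf_freeze; auto using Wloc_freeze, Wloc_const. Qed.

Lemma Cinf_period_int G : Cinf Wloc G -> Cinf Wloc (fun (_ : unit) _ xi => period_int G xi).
Proof.
  intros H. apply (Cinf_ext Wloc (fun i _ xi => prim 0 (fun i t xi => cexp (Lam t xi) * G i t xi)%C i (2 * PI) xi)).
  - intros [] t x. reflexivity.
  - apply Cinf_freeze0. now apply Cinf_prim, Cinf_eLamG.
Qed.

Lemma sol_0 kappa G xi : sol kappa G tt 0 xi = kappa xi.
Proof.
  unfold sol, prim. rewrite CInt_point, Lam_0. replace (- RtoC 0)%C with (RtoC 0) by ring. rewrite cexp_0. ring.
Qed.

Lemma sol_per kappa G : Cinf Wloc G -> periodic2 (G tt) ->
  (forall xi, (cexp (- Lam (2 * PI) xi) * (kappa xi + period_int G xi))%C = kappa xi) ->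
  periodic2 (sol kappa G tt).
Proof.
  intros H Hp HJ t xi.
  apply (sol_periodic xi (fun t => sol kappa G tt t xi) (fun t => G tt t xi)).
  - intros u; apply Hp.
  - now apply sol_is_sol.
  - rewrite sol_0. apply HJ.
Qed.

Lemma sol_eq kappa G t xi : Cinf Wloc G ->
  (Dt (sol kappa G) tt t xi + lam c q t xi * sol kappa G tt t xi)%C = G tt t xi.
Proof.
  intros H. assert (E := dC_is_dC _ _ _ (sol_is_sol kappa G xi H t)).
  change (Dt (sol kappa G) tt t xi) with (dC (fun t => sol kappa G tt t xi) t). rewrite E. ring.
Qed.

Lemma duhamel xi v g x y r M : x <= y -> is_sol xi v g -> (forall t, Cmod (g t) <= M) ->
  (forall s, x <= s <= y -> fst (Lam s xi) <= r) ->
  Cmod (cexp (Lam y xi) * v y - cexp (Lam x xi) * v x) <= 2 * (exp r * M * (y - x)).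
Proof.
  intros Hxy Hs HM Hr.
  apply (is_dC_mvt (fun t => cexp (Lam t xi) * v t)%C (fun t => cexp (Lam t xi) * g t)%C); auto.
  - intros; now apply is_dC_eLam_sol.
  - intros s Hss. rewrite Cmod_mult, Cmod_cexp.
    apply Rmult_le_compat; auto using Cmod_ge_0, exp_le. left; apply exp_pos.
Qed.

(** An a priori estimate for periodic solutions at frequencies [|xi| > r0]; [Zp] and [Zm] are the
    points where the solution is required to vanish for positive and negative frequencies. *)
Definition apriori (r0 : R) (Zp Zm : R -> Prop) : Prop := exists K, forall xi v g M,
  r0 < Rabs xi -> is_sol xi v g -> (forall t, v (t + 2 * PI) = v t) ->
  (0 < xi -> forall t, Zp t -> v t = RtoC 0) -> (xi < 0 -> forall t, Zm t -> v t = RtoC 0) ->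
  (forall t, Cmod (g t) <= M) -> forall t, Cmod (v t) <= K * M.

Definition zcond (r0 : R) (Zp Zm : R -> Prop) (V : fam unit) : Prop :=
  forall t xi, r0 < Rabs xi -> (0 < xi -> Zp t -> V tt t xi = RtoC 0) /\ (xi < 0 -> Zm t -> V tt t xi = RtoC 0).

(** The condition concerns an open set of frequencies, since [r0 < |xi|] is strict and the sign of
    [xi] is fixed; it therefore passes to the derivative in [xi]. *)
Lemma zcond_Dx r0 Zp Zm V : 0 <= r0 -> zcond r0 Zp Zm V -> zcond r0 Zp Zm (Dx V).
Proof.
  intros Hr H t xi Hxi.
  assert (Hloc : forall P : R -> Prop, (forall y, Rabs (y - xi) < Rabs xi - r0 -> P y) -> locally xi P).
  { intros P HP. assert (Hd : 0 < Rabs xi - r0) by lra. exists (mkposreal _ Hd). intros y Hy. apply HP, Hy. }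
  assert (Hy : forall y, Rabs (y - xi) < Rabs xi - r0 -> r0 < Rabs y /\ (0 < xi -> 0 < y) /\ (xi < 0 -> y < 0)).
  { intros y. unfold Rabs. destruct (Rcase_abs (y - xi)), (Rcase_abs xi), (Rcase_abs y); lra. }
  split; intros Hs Hz; apply dC_is_dC; split; simpl;
    (apply is_derive_ext_loc with (fun _ => 0); [|apply is_derive_Rconst]); apply Hloc;
    intros y Hy'; destruct (Hy y Hy') as [h1 [h2 h3]]; destruct (H t y h1) as [K1 K2];
    rewrite ?K1, ?K2 by auto; reflexivity.
Qed.

(** The a priori estimate is linear in [M]; at a single frequency it is applied with
    [M = M1 / (1 + |xi|)^k], which transfers the decay of [G]. Frequencies up to [r0] form a compact
    set, where the local bound on [V] serves. *)
Lemma Wrapid_decay r0 Zp Zm V G : apriori r0 Zp Zm -> Cinf Wloc V -> periodic2 (V tt) -> Wrapid G ->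
  (forall t xi, (Dt V tt t xi + lam c q t xi * V tt t xi)%C = G tt t xi) -> zcond r0 Zp Zm V -> Wrapid V.
Proof.
  intros [K HK] HV Hp HG E Hz T k.
  destruct (HG (2 * PI) k) as [M1 K1]. destruct (Cinf_W _ _ HV T r0) as [M2 K2].
  assert (Hsol : forall xi, is_sol xi (fun t => V tt t xi) (fun t => G tt t xi)).
  { intros xi t. eapply is_dC_eq; [exact (Cinf_is_dC_t _ _ tt t xi HV)|]. rewrite <- E. ring. }
  (* The source inherits periodicity from [V] through the equation, so its bound on one period holds
     for all times. *)
  assert (HGp : forall t xi, G tt (t + 2 * PI) xi = G tt t xi).
  { intros t xi. rewrite <- !E. unfold Dt. rewrite (periodic_dt _ Hp), Hp, lam_per. reflexivity. }
  exists (Rabs K * Rabs M1 + (1 + Rabs r0) ^ k * Rabs M2). intros [] t x Ht.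
  assert (hw := wpow_ge1 x k). assert (hx := Rabs_pos x). assert (h1 := Rle_abs M1). assert (h2 := Rle_abs M2).
  assert (h3 := Rabs_pos K). assert (h4 := Rabs_pos M1). assert (h5 := Rabs_pos M2).
  assert (h6 : 0 <= (1 + Rabs r0) ^ k) by (apply pow_le; assert (h := Rabs_pos r0); lra).
  destruct (Rlt_dec r0 (Rabs x)) as [d|d].
  - assert (HM : forall t, Cmod (G tt t x) <= M1 / (1 + Rabs x) ^ k).
    { intros u. rewrite <- (periodic_modT (fun u => G tt u x) (fun u => HGp u x) u).
      assert (Hm := modT_bounds u). specialize (K1 tt (modT u) x ltac:(rewrite Rabs_right; lra)).
      apply Rmult_le_reg_l with ((1 + Rabs x) ^ k); [lra|].
      replace ((1 + Rabs x) ^ k * (M1 / (1 + Rabs x) ^ k)) with M1 by (field; lra). auto. }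
    assert (HB := HK x (fun t => V tt t x) (fun t => G tt t x) _ d (Hsol x) (fun u => Hp u x)
      (fun h u hu => proj1 (Hz u x d) h hu) (fun h u hu => proj2 (Hz u x d) h hu) HM t).
    cbv beta in HB.
    assert ((1 + Rabs x) ^ k * Cmod (V tt t x) <= K * M1).
    { apply Rle_trans with ((1 + Rabs x) ^ k * (K * (M1 / (1 + Rabs x) ^ k))).
      - apply Rmult_le_compat_l; lra.
      - right; field; lra. }
    assert (K * M1 <= Rabs K * Rabs M1) by (rewrite <- Rabs_mult; apply Rle_abs).
    assert (0 <= (1 + Rabs r0) ^ k * Rabs M2) by now apply Rmult_le_pos. lra.
  - specialize (K2 tt t x Ht ltac:(lra)).
    assert ((1 + Rabs x) ^ k * Cmod (V tt t x) <= (1 + Rabs r0) ^ k * Rabs M2).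
    { apply Rmult_le_compat; auto using Cmod_ge_0; [lra| |lra].
      apply pow_incr. assert (h := Rle_abs r0). lra. }
    assert (0 <= Rabs K * Rabs M1) by now apply Rmult_le_pos. lra.
Qed.

(** The source for [Dx V] is [Dx G - i c V], so [V] must first be known at level [n] ([HVn]). The
    derivative in [t] is read off the equation. *)
Lemma Cn_decay r0 Zp Zm n V G : 0 <= r0 -> apriori r0 Zp Zm -> Cinf Wloc V -> periodic2 (V tt) -> Cn Wrapid n G ->
  (forall t xi, (Dt V tt t xi + lam c q t xi * V tt t xi)%C = G tt t xi) -> zcond r0 Zp Zm V -> Cn Wrapid n V.
Proof.
  intros Hr Ha. revert V G; induction n; intros V G HV Hp HG E Hz;
    assert (HW := Wrapid_decay r0 Zp Zm V G Ha HV Hp (Cn_W _ _ _ HG) E Hz); [split; auto|].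
  assert (HVn : Cn Wrapid n V) by (apply (IHn V G); auto; now apply Cn_S).
  assert (HGn := Cn_S _ _ _ HG). assert (HdG := HG). destruct HdG as [_ [HGd [_ HGx]]].
  assert (Ac := smooth_T1_Cinf (I := unit) c Hc).
  assert (El : Dt V = fun i t xi => (G i t xi + (-1) * lam c q t xi * V i t xi)%C).
  { fext3. destruct i. rewrite <- E. ring. }
  assert (Hl : Cinf Wtame (fun (_ : unit) t xi => (-1) * lam c q t xi)%C).
  { assert (HL := Cinf_lam c q Hc Hq (I := unit)). cinf_tac. }
  split; [auto|split; [exact (Cinf_dif _ _ HV)|split]].
  - rewrite El. apply (Cn_plus Wrapid n G (fun i t xi => (-1) * lam c q t xi * V i t xi)%C Wrapid_add); auto.
    exact (Cn_mul Wtame Wrapid Wrapid n _ V Wrapid_add Wtame_Wrapid (Hl n) HVn).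
  - apply (IHn (Dx V) (fun i t xi => Dx G i t xi + (0, -1) * c t * V i t xi)%C).
    + now apply Cinf_Dx.
    + now apply periodic_dx.
    + apply (Cn_plus Wrapid n (Dx G) (fun i t xi => (0, -1) * c t * V i t xi)%C Wrapid_add); auto.
      assert (Hcc : Cinf Wtame (fun (_ : unit) t (xi : R) => (0, -1) * c t)%C) by cinf_tac.
      exact (Cn_mul Wtame Wrapid Wrapid n _ V Wrapid_add Wtame_Wrapid (Hcc n) HVn).
    + intros t xi. rewrite Dt_Dx by auto.
      assert (Dx (Dt V) tt t xi = (Dx G tt t xi + ((0, -1) * c t * V tt t xi + (-1) * lam c q t xi * Dx V tt t xi))%C) as ->.
      { apply dC_is_dC. rewrite El. apply is_dC_plus; [exact (proj2 (HGd tt t xi))|].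
        apply (is_dC_mult (fun y => (-1) * lam c q t y)%C (fun y => V tt t y)); [|exact (Cinf_is_dC_x _ _ tt t xi HV)].
        unfold lam. eapply is_dC_eq.
        - apply is_dC_scal. apply is_dC_plus; [|apply is_dC_const]. apply is_dC_mult; [|apply is_dC_const].
          apply is_dC_imag, (is_derive_id (K := R_AbsRing)).
        - cbv beta. unfold one; simpl.
          apply injective_projections; simpl; ring. }
      ring.
    + now apply zcond_Dx.
Qed.

End ODE.

(** * The kernel of the transpose, and solvability for b of constant sign *)

Section Annihilator.
Variables (c q : R -> C).
Hypotheses (Hc : smooth_T1 c) (Hq : smooth_T1 q).

Lemma period_int_plus F1 F2 xi : Cinf Wloc F1 -> Cinf Wloc F2 ->
  period_int c q (fun i t x => F1 i t x + F2 i t x)%C xi = (period_int c q F1 xi + period_int c q F2 xi)%C.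
Proof.
  intros H1 H2. unfold period_int. rewrite <- CInt_plus.
  - apply CInt_ext; intros; ring.
  - exact (Cinf0_ccont_t _ tt xi (Cinf_eLamG c q Hc Hq F1 H1)).
  - exact (Cinf0_ccont_t _ tt xi (Cinf_eLamG c q Hc Hq F2 H2)).
Qed.

Lemma period_int_scal a F1 xi : Cinf Wloc F1 -> period_int c q (fun i t x => a * F1 i t x)%C xi = (a * period_int c q F1 xi)%C.
Proof.
  intros H1. unfold period_int. rewrite <- CInt_scal.
  - apply CInt_ext; intros; ring.
  - exact (Cinf0_ccont_t _ tt xi (Cinf_eLamG c q Hc Hq F1 H1)).
Qed.

(** The density [exp (Lam t xi - i x xi)] integrated over one period. It is annihilated by the
    transposed operator as an expression in [t] and [x], but it closes up over the circle only at a
    resonance. *)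
Definition pairing (xi : R) (phi : R -> R -> C) : C := period_int c q (FT (-1) (lift phi)) xi.

Lemma Cinf0_FT phi : Cinf Wrapid (lift phi) -> Cinf Wloc (FT (-1) (lift phi)).
Proof. intros; apply Cinf_Wrapid_Wloc, Cinf_FT; auto; ring. Qed.

Lemma pairing_plus xi f g : schwartz f -> schwartz g ->
  pairing xi (fun t x => f t x + g t x)%C = (pairing xi f + pairing xi g)%C.
Proof.
  intros Hf Hg. apply schwartz_Cinf in Hf, Hg. unfold pairing.
  rewrite <- period_int_plus by now apply Cinf0_FT. f_equal. fext3. destruct i.
  exact (FT_plus (-1) (lift f) (lift g) tt t x Hf Hg).
Qed.

Lemma pairing_scal xi a f : schwartz f -> pairing xi (fun t x => a * f t x)%C = (a * pairing xi f)%C.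
Proof.
  intros Hf. apply schwartz_Cinf in Hf. unfold pairing.
  rewrite <- period_int_scal by now apply Cinf0_FT. f_equal. fext3. destruct i.
  exact (FT_scal (-1) (fun _ _ => a) (lift f) tt t x Hf).
Qed.

Lemma pairing_bound xi : exists B, 0 < B /\ forall f d, schwartz f ->
  (forall t x, (1 + Rabs x) ^ 2 * Cmod (f t x) <= d) -> Cmod (pairing xi f) <= B * d.
Proof.
  destruct (Cinf_W _ _ (Cinf0_exp (fun (_ : unit) t xi => Lam c q t xi) (Cinf_Wtame_Wloc _ (Cinf_Lam c q Hc Hq)))
     (2 * PI) (Rabs xi)) as [B0 HB0].
  assert (Hp := PI_RGT_0).
  assert (h0 := Rabs_pos B0). assert (h1 := Rle_abs B0).
  exists (2 * ((Rabs B0 + 1) * (2 * PI) * (2 * PI))). split; [apply Rmult_lt_0_compat; [lra|]; apply Rmult_lt_0_compat; [apply Rmult_lt_0_compat|]; lra|].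
  intros f d Hf Hd. unfold pairing, period_int. assert (HS := schwartz_Cinf f Hf).
  assert (Hd0 : 0 <= d).
  { eapply Rle_trans; [|apply (Hd 0 0)]. apply Rmult_le_pos; [apply pow_le; assert (h := Rabs_pos 0); lra|apply Cmod_ge_0]. }
  eapply Rle_trans; [apply CInt_bound with (M := (Rabs B0 + 1) * (2 * (d * PI)))|].
  - exact (Cinf0_ccont_t _ tt xi (Cinf_eLamG c q Hc Hq _ (Cinf0_FT f HS))).
  - rewrite Rmin_left, Rmax_right by lra. intros t Ht. rewrite Cmod_mult.
    apply Rmult_le_compat; auto using Cmod_ge_0.
    + eapply Rle_trans; [apply (HB0 tt t xi); [rewrite Rabs_right; lra|lra]|lra].
    + apply CIntR_bound. split; [now apply (kernel_ccont (-1) (lift f) tt t xi)|].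
      intros x. rewrite Cmod_mult, Cmod_eix, Rmult_1_r. apply Hd.
  - rewrite (Rabs_right (2 * PI - 0)) by lra. right; ring.
Qed.

Lemma tempered_pairing xi : tempered (pairing xi).
Proof.
  split; [|split].
  - intros; now apply pairing_plus.
  - intros; now apply pairing_scal.
  - intros f Hf eps Heps. destruct (pairing_bound xi) as [B [HB HBd]].
    (* Since [(1 + |x|)^2 <= 4 (1 + |x|^2)], the seminorms with exponents 0 and 2 together give the
       weighted bound [8 del]; the constant 16 leaves [eps / 2]. *)
    exists 2%nat, (eps / (16 * B)). split; [apply Rdiv_lt_0_compat; lra|].
    intros h Hh Hs.
    assert (Hfh : schwartz (fun t x => h t x + (-1) * f t x)%C).
    { apply Cinf_schwartz.
      - intros t x. now rewrite (proj1 Hh), (proj1 Hf).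
      - apply (Cinf_plus Wrapid (lift h) (fun i t x => (-1) * f t x)%C Wrapid_add); [now apply schwartz_Cinf|].
        exact (Cinf_tame_rapid (fun _ _ _ => (-1)%C) (lift f) (Cinf_const _) (schwartz_Cinf f Hf)). }
    replace (Cminus (pairing xi h) (pairing xi f)) with (pairing xi (fun t x => h t x + (-1) * f t x)%C).
    + eapply Rle_lt_trans; [apply (HBd _ (8 * (eps / (16 * B))) Hfh)|].
      * intros t x.
        assert (A0 := Hs O O O ltac:(lia) ltac:(lia) ltac:(lia) t x).
        assert (A2 := Hs O O 2%nat ltac:(lia) ltac:(lia) ltac:(lia) t x).
        change (Dab 0 0 (fsub h f) t x) with (Cminus (h t x) (f t x)) in A0, A2.
        replace (h t x + -1 * f t x)%C with (Cminus (h t x) (f t x)) by ring.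
        eapply Rle_trans; [apply Rmult_le_compat_r; [apply Cmod_ge_0|apply wpow_split]|].
        simpl in A0, A2 |- *. nra.
      * replace (B * (8 * (eps / (16 * B)))) with (eps / 2) by (field; lra). lra.
    + rewrite (pairing_plus xi h (fun t x => (-1) * f t x)%C).
      * rewrite pairing_scal by auto. ring.
      * auto.
      * apply (schwartz_scal (-1)%C f Hf).
Qed.

(** The integrand is the derivative of [exp Lam] times the transform of [phi], and at a resonance
    that product takes equal values at both ends of the period. *)
Lemma pairing_ker xi : cexp (Lam c q (2 * PI) xi) = RtoC 1 -> in_ker_Lt c q (pairing xi).
Proof.
  intros HE. split; [apply tempered_pairing|].
  intros phi Hphi. assert (HS := schwartz_Cinf phi Hphi). unfold pairing, period_int.
  set (U := FT (-1) (lift phi)). assert (HU := Cinf0_FT phi HS). fold U in HU.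
  assert (Hsol : is_sol c q xi (fun t => U tt t xi) (fun t => FT (-1) (lift (Lop c q phi)) tt t xi)).
  { intros t. eapply is_dC_eq; [exact (Cinf_is_dC_t _ _ tt t xi HU)|].
    rewrite (FT_Lop c q Hc Hq phi t xi HS). fold U. ring. }
  rewrite (CInt_derive (fun t => cexp (Lam c q t xi) * U tt t xi)%C).
  - rewrite HE, Lam_0, cexp_0.
    assert (U tt (2 * PI) xi = U tt 0 xi) as ->; [|ring].
    unfold U, FT, lift. apply CIntR_ext. intros x. rewrite <- (proj1 Hphi 0 x), Rplus_0_l. reflexivity.
  - intros t. exact (is_dC_eLam_sol c q Hc Hq xi _ _ t Hsol).
  - exact (Cinf0_ccont_t _ tt xi (Cinf_eLamG c q Hc Hq _ (Cinf0_FT _ (Cinf_Lop c q Hc Hq phi HS)))).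
Qed.

Lemma annih_compat f xi : in_annih c q f -> cexp (Lam c q (2 * PI) xi) = RtoC 1 ->
  period_int c q (FT (-1) (lift f)) xi = RtoC 0.
Proof. intros [_ H] HE. exact (H _ (pairing_ker xi HE)). Qed.

(** Both positive results are reduced to two tasks: an a priori estimate for large frequencies, and
    a [kappa] that is smooth in [xi], closes up the solution and meets the vanishing condition. *)
Lemma solvable_from_kappa f kappa r0 Zp Zm : schwartz f -> 0 <= r0 -> apriori c q r0 Zp Zm ->
  Cinf Wloc (fun (_ : unit) _ xi => kappa xi) ->
  (forall xi, (cexp (- Lam c q (2 * PI) xi) * (kappa xi + period_int c q (FT (-1) (lift f)) xi))%C = kappa xi) ->
  zcond r0 Zp Zm (sol c q kappa (FT (-1) (lift f))) ->
  exists u, schwartz u /\ forall t x, Lop c q u t x = f t x.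
Proof.
  intros Hf Hr Ha Hk HE Hz. assert (HS := schwartz_Cinf f Hf).
  assert (HF := Cinf0_FT f HS).
  assert (Hp : periodic2 (FT (-1) (lift f) tt)).
  { intros t x. unfold FT, lift. apply CIntR_ext. intros. now rewrite (proj1 Hf). }
  assert (HV := Cinf_sol c q Hc Hq kappa _ Hk HF).
  assert (HVp : periodic2 (sol c q kappa (FT (-1) (lift f)) tt)) by now apply sol_per.
  apply (solve_from_FT c q Hc Hq f (sol c q kappa (FT (-1) (lift f)))); auto.
  - intros n. apply (Cn_decay c q Hc Hq r0 Zp Zm n _ (FT (-1) (lift f))); auto.
    + apply Cinf_FT; auto; ring.
    + intros; now apply sol_eq.
  - intros; now apply sol_eq.
Qed.

(** * [b] of constant sign: the estimate and the choice of [kappa] *)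

Lemma Re_Lam t xi : fst (Lam c q t xi) = - xi * snd (CInt c 0 t) + fst (CInt q 0 t).
Proof. unfold Lam; simpl. ring. Qed.

Lemma Re_lam t xi : fst (lam c q t xi) = - xi * snd (c t) + fst (q t).
Proof. unfold lam; simpl. ring. Qed.

Lemma Re_Lam_mvt xi x y :
  exists z, fst (Lam c q y xi) - fst (Lam c q x xi) = fst (lam c q z xi) * (y - x).
Proof.
  destruct (MVT_gen (fun t => fst (Lam c q t xi)) x y (fun t => fst (lam c q t xi))) as [z [_ E]].
  - intros t _. exact (is_dC_real _ _ _ (is_dC_Lam c q Hc Hq t xi)).
  - intros t _. apply continuity_pt_filterlim. exact (proj1 (is_dC_cont _ _ _ (is_dC_Lam c q Hc Hq t xi))).
  - now exists z.
Qed.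

Lemma periodic_bound f : smooth_T1 f -> exists M, 0 <= M /\ forall t, Cmod (f t) <= M.
Proof.
  intros Hf. destruct (ccont_bounded f 0 (2 * PI) (smooth_ccont f Hf)) as [M HM]. exists M.
  assert (HP := PI_RGT_0). split.
  - eapply Rle_trans; [apply Cmod_ge_0|apply (HM 0); lra].
  - intros t. rewrite <- (periodic_modT f (proj1 Hf) t). apply HM. assert (H := modT_bounds t). lra.
Qed.

Lemma exp_m1 : exp (-1) <= / 2.
Proof.
  replace (-1) with (- (1)) by ring. rewrite exp_Ropp. apply Rinv_le_contravar; [lra|]. assert (H := exp_ineq1_le 1). lra.
Qed.

(** A periodic solution is compared with itself one period away, where [exp Lam] has changed by a
    factor at least [e]. *)
Lemma apriori_sign_pt xi v g M Q : 0 <= Q -> is_sol c q xi v g -> (forall t, v (t + 2 * PI) = v t) ->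
  (forall t, Cmod (g t) <= M) ->
  ((forall t, - Q <= fst (lam c q t xi)) /\ 1 <= fst (Lam c q (2 * PI) xi)) \/
  ((forall t, fst (lam c q t xi) <= Q) /\ fst (Lam c q (2 * PI) xi) <= -1) ->
  forall t, Cmod (v t) <= 8 * PI * exp (2 * PI * Q) * M.
Proof.
  intros HQ Hs Hp HM Hsign t. assert (HP := PI_RGT_0).
  assert (M0 : 0 <= M) by (eapply Rle_trans; [apply Cmod_ge_0|apply (HM 0)]).
  set (r := fst (Lam c q t xi)). assert (hr := exp_pos r).
  assert (Hsh : forall u, fst (Lam c q (u + 2 * PI) xi) = fst (Lam c q u xi) + fst (Lam c q (2 * PI) xi)).
  { intros u. now rewrite Lam_shift. }
  set (A := (exp r * exp (2 * PI * Q) * M * (2 * PI))).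
  (* The one-sided bound on [Re lam] gives [Re Lam <= r + 2 PI Q] on the period before [t] in the
     first case and on the period after [t] in the second. The half on the right is absorbed at the
     end. *)
  assert (H : exp r * Cmod (v t) <= / 2 * (exp r * Cmod (v t)) + 2 * A).
  { destruct Hsign as [[H1 H2]|[H1 H2]].
    - assert (HD := duhamel c q Hc Hq xi v g (t - 2 * PI) t (r + 2 * PI * Q) M ltac:(lra) Hs HM).
      assert (Hv : v (t - 2 * PI) = v t) by (rewrite <- (Hp (t - 2 * PI)); f_equal; ring).
      assert (Hr : fst (Lam c q (t - 2 * PI) xi) = r - fst (Lam c q (2 * PI) xi)).
      { unfold r. assert (h := Hsh (t - 2 * PI)). replace (t - 2 * PI + 2 * PI) with t in h by ring. lra. }
      rewrite Hv in HD.
      assert (E1 : Cmod (cexp (Lam c q (t - 2 * PI) xi) * v t) <= / 2 * (exp r * Cmod (v t))).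
      { rewrite Cmod_mult, Cmod_cexp, Hr. rewrite <- Rmult_assoc. apply Rmult_le_compat_r; [apply Cmod_ge_0|].
        apply Rle_trans with (exp (r + -1)); [apply exp_le; lra|]. rewrite exp_plus.
        assert (h := exp_m1). nra. }
      replace (exp r * Cmod (v t)) with (Cmod (cexp (Lam c q t xi) * v t)) at 1
        by now rewrite Cmod_mult, Cmod_cexp.
      replace (cexp (Lam c q t xi) * v t)%C with
       (cexp (Lam c q (t - 2 * PI) xi) * v t + (cexp (Lam c q t xi) * v t - cexp (Lam c q (t - 2 * PI) xi) * v t))%C by ring.
      eapply Rle_trans; [apply Cmod_triangle|]. apply Rplus_le_compat; auto.
      eapply Rle_trans; [apply HD|].
      + intros s Hss. destruct (Re_Lam_mvt xi s t) as [z h]. fold r in h. assert (hz := H1 z). nra.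
      + right. unfold A. rewrite exp_plus. ring.
    - assert (HD := duhamel c q Hc Hq xi v g t (t + 2 * PI) (r + 2 * PI * Q) M ltac:(lra) Hs HM).
      rewrite Hp in HD.
      assert (E1 : Cmod (cexp (Lam c q (t + 2 * PI) xi) * v t) <= / 2 * (exp r * Cmod (v t))).
      { rewrite Cmod_mult, Cmod_cexp, Hsh. fold r. rewrite <- Rmult_assoc. apply Rmult_le_compat_r; [apply Cmod_ge_0|].
        apply Rle_trans with (exp (r + -1)); [apply exp_le; lra|]. rewrite exp_plus.
        assert (h := exp_m1). nra. }
      replace (exp r * Cmod (v t)) with (Cmod (cexp (Lam c q t xi) * v t)) at 1
        by now rewrite Cmod_mult, Cmod_cexp.
      replace (cexp (Lam c q t xi) * v t)%C with
       (cexp (Lam c q (t + 2 * PI) xi) * v t + - (cexp (Lam c q (t + 2 * PI) xi) * v t - cexp (Lam c q t xi) * v t))%C by ring.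
      eapply Rle_trans; [apply Cmod_triangle|]. rewrite Cmod_opp. apply Rplus_le_compat; auto.
      eapply Rle_trans; [apply HD|].
      + intros s Hss. destruct (Re_Lam_mvt xi t s) as [z h]. fold r in h. assert (hz := H1 z). nra.
      + right. unfold A. rewrite exp_plus. ring. }
  assert (H' : exp r * Cmod (v t) <= exp r * (8 * PI * exp (2 * PI * Q) * M)).
  { replace (exp r * (8 * PI * exp (2 * PI * Q) * M)) with (4 * A) by (unfold A; ring). lra. }
  now apply Rmult_le_reg_l with (exp r).
Qed.

Lemma mean_pos : (exists t, snd (c t) <> 0) -> (forall t, 0 <= snd (c t)) -> 0 < snd (CInt c 0 (2 * PI)).
Proof.
  intros [t0 H0] Hb. assert (HP := PI_RGT_0). simpl.
  set (b := fun t => snd (c t)).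
  assert (Hcb : forall t, continuous b t) by (intros; apply ccont_snd; now apply smooth_ccont).
  set (t1 := modT t0). assert (Ht1 := modT_bounds t0). fold t1 in Ht1.
  assert (Hb1 : 0 < b t1).
  { unfold b, t1. rewrite (periodic_modT c (proj1 Hc)). specialize (Hb t0). lra. }
  destruct (Rle_lt_or_eq_dec 0 (RInt b 0 (2 * PI))) as [h|h]; auto.
  - apply RInt_ge_0; [lra|now apply ex_RInt_cont|intros; apply Hb].
  - exfalso.
    destruct (Hcb t1 (fun y => 0 < y)) as [d Hd].
    { exists (mkposreal _ Hb1). intros y Hy. apply ball_Rabs in Hy; simpl in Hy. lra. }
    set (e := Rmin (d / 2) (2 * PI - t1)).
    assert (He : 0 < e) by (apply Rmin_pos; [assert (hd := cond_pos d); lra|lra]).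
    assert (He1 : e <= d / 2) by apply Rmin_l. assert (He2 : e <= 2 * PI - t1) by apply Rmin_r.
    assert (Hpos : 0 < RInt b t1 (t1 + e)).
    { apply RInt_gt_0; [lra| |intros; apply Hcb]. intros x Hx. apply Hd.
      unfold ball; simpl; unfold AbsRing_ball, abs, minus, plus, opp; simpl.
      assert (hd := cond_pos d). apply Rabs_lt_between. lra. }
    assert (C : forall a b' c', RInt b a b' + RInt b b' c' = RInt b a c').
    { intros; now apply RInt_RChasles. }
    assert (P1 : 0 <= RInt b 0 t1) by (apply RInt_ge_0; [lra|now apply ex_RInt_cont|intros; apply Hb]).
    assert (P2 : 0 <= RInt b (t1 + e) (2 * PI)) by (apply RInt_ge_0; [lra|now apply ex_RInt_cont|intros; apply Hb]).
    assert (E1 := C 0 t1 (2 * PI)). assert (E2 := C t1 (t1 + e) (2 * PI)). lra.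
Qed.

Lemma apriori_sign sg : sg * sg = 1 -> (forall t, 0 <= sg * snd (c t)) -> 0 < sg * snd (CInt c 0 (2 * PI)) ->
  exists r0, 0 <= r0 /\ apriori c q r0 (fun _ => False) (fun _ => False).
Proof.
  intros Hsg Hb Hb0. destruct (periodic_bound q Hq) as [Q [HQ0 HQ]]. assert (HP := PI_RGT_0).
  set (b0 := snd (CInt c 0 (2 * PI))) in *.
  set (Q1 := Rabs (fst (CInt q 0 (2 * PI)))).
  assert (HQ1 := Rabs_pos (fst (CInt q 0 (2 * PI)))). fold Q1 in HQ1.
  assert (HQ2 : - Q1 <= fst (CInt q 0 (2 * PI)) <= Q1) by (apply Rabs_le_between; unfold Q1; lra).
  (* Beyond this frequency [|xi b0|] exceeds [1 + Q1], so [Re Lam] changes by at least 1 over a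
     period whatever [q] contributes. *)
  exists ((1 + Q1) / (sg * b0)). split; [apply Rdiv_le_0_compat; lra|].
  exists (8 * PI * exp (2 * PI * Q)). intros xi v g M Hxi Hs Hp _ _ HM.
  assert (Hlarge : 1 + Q1 < Rabs xi * (sg * b0)).
  { apply Rmult_lt_reg_r with (/ (sg * b0)); [now apply Rinv_0_lt_compat|].
    rewrite (Rmult_assoc (Rabs xi)), Rinv_r, Rmult_1_r by lra. exact Hxi. }
  assert (Hq' : forall t, - Q <= fst (q t) <= Q).
  { intros t. apply Rabs_le_between. eapply Rle_trans; [apply abs_fst_Cmod|apply HQ]. }
  assert (Hx : forall y, xi * y = (xi * sg) * (sg * y)).
  { intros y. replace (xi * sg * (sg * y)) with (sg * sg * (xi * y)) by ring. rewrite Hsg; ring. }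
  assert (Habs : Rabs xi = Rabs (xi * sg)).
  { rewrite Rabs_mult. replace (Rabs sg) with 1; [ring|].
    assert (h : Rabs sg * Rabs sg = 1) by (rewrite <- Rabs_mult, Hsg; apply Rabs_R1).
    assert (h' := Rabs_pos sg). nra. }
  apply (apriori_sign_pt xi v g M Q); auto.
  destruct (Rle_dec (xi * sg) 0) as [n|n].
  - left. rewrite Habs, Rabs_left1 in Hlarge by lra. split.
    + intros t. rewrite Re_lam. specialize (Hq' t). specialize (Hb t).
      replace (- xi * snd (c t)) with (- (xi * snd (c t))) by ring. rewrite Hx. nra.
    + rewrite Re_Lam. fold b0. replace (- xi * b0) with (- (xi * b0)) by ring. rewrite Hx. lra.
  - right. rewrite Habs, Rabs_right in Hlarge by lra. split.
    + intros t. rewrite Re_lam. specialize (Hq' t). specialize (Hb t).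
      replace (- xi * snd (c t)) with (- (xi * snd (c t))) by ring. rewrite Hx. nra.
    + rewrite Re_Lam. fold b0. replace (- xi * b0) with (- (xi * b0)) by ring. rewrite Hx. lra.
Qed.

(** The resonant frequencies are the zeros of [1 - monodromy]. *)
Definition monodromy (xi : R) : C := cexp (- Lam c q (2 * PI) xi).

Lemma is_dC_monodromy xi : is_dC monodromy xi (- ((0, 1) * CInt c 0 (2 * PI)) * monodromy xi)%C.
Proof.
  unfold monodromy. apply is_dC_cexp. apply is_dC_opp. unfold Lam. eapply is_dC_eq.
  - apply is_dC_plus; [|apply is_dC_const]. apply is_dC_mult; [|apply is_dC_const].
    apply is_dC_imag, (is_derive_id (K := R_AbsRing)).
  - cbv beta. unfold one; simpl. apply injective_projections; simpl; ring.
Qed.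

Lemma Cinf_monodromy : Cinf Wloc (fun (_ : unit) _ xi => monodromy xi).
Proof.
  assert (HL : Cinf Wloc (fun (_ : unit) t xi => Lam c q t xi)) by (apply Cinf_Wtame_Wloc, Cinf_Lam; auto).
  apply (Cinf_freeze0 (2 * PI) (fun _ t xi => cexp (- Lam c q t xi))).
  apply (Cinf0_exp (fun i t xi => - Lam c q t xi)%C).
  apply (Cinf_ext Wloc (fun i t xi => (-1) * Lam c q t xi)%C); [intros; ring|].
  assert (H1 := Cinf_Wtame_Wloc _ (Cinf_const (I := unit) (-1)%C)). cinf_tac.
Qed.

(** Solving for [kappa] gives [monodromy J / (1 - monodromy)]. Here [m] is the zero common to
    numerator and denominator: [xi - x0] at a resonance [x0], and 1 if there is none. *)
Lemma kappa_exists (m J J' e' : R -> C) : Cinf Wloc (fun (_ : unit) _ xi => J' xi) ->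
  Cinf Wloc (fun (_ : unit) _ xi => e' xi) -> (forall xi, e' xi <> RtoC 0) ->
  (forall xi, J xi = (m xi * J' xi)%C) -> (forall xi, (1 - monodromy xi)%C = (m xi * e' xi)%C) ->
  exists kappa, Cinf Wloc (fun (_ : unit) _ xi => kappa xi) /\
    forall xi, (monodromy xi * (kappa xi + J xi))%C = kappa xi.
Proof.
  intros HJ He Hn EJ Ee. exists (fun xi => monodromy xi * J' xi * / e' xi)%C. split.
  - assert (H1 := Cinf_monodromy).
    assert (H2 : Cinf Wloc (fun (_ : unit) (_ : R) xi => (/ e' xi)%C)).
    { apply (Cinf0_inv (fun _ _ xi => e' xi)); auto.
      apply (Wloc_of_x (fun xi => / e' xi)%C).
      apply (is_dC_ccont _ (fun xi => - Dx (fun (_ : unit) (_ : R) xi => e' xi) tt 0 xi * (/ e' xi * / e' xi))%C).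
      intros xi. apply is_dC_inv; auto. exact (Cinf_is_dC_x _ _ tt 0 xi He). }
    cinf_tac.
  - intros xi. rewrite EJ.
    replace (monodromy xi * (monodromy xi * J' xi * / e' xi + m xi * J' xi))%C with
     (monodromy xi * J' xi * / e' xi * (monodromy xi + m xi * e' xi))%C.
    + rewrite <- Ee. ring.
    + field. apply Hn.
Qed.

Lemma monodromy_inv xi : monodromy xi = RtoC 1 -> cexp (Lam c q (2 * PI) xi) = RtoC 1.
Proof.
  unfold monodromy. intros H. assert (E := cexp_opp (Lam c q (2 * PI) xi)). rewrite H in E. rewrite <- E. ring.
Qed.

Lemma hadamard_at x0 m f t : hadamard x0 m f tt t x0 = (CInt (fun s => RtoC (s ^ m)) 0 1 * f tt t x0)%C.
Proof.
  unfold hadamard. rewrite Cmult_comm, <- CInt_scal.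
  - apply CInt_ext. intros s. replace (x0 + s * (x0 - x0)) with x0 by ring. ring.
  - intros s. destruct (pow_is_dC m s) as [l Hl]. exact (is_dC_cont _ _ _ Hl).
Qed.

Lemma solvable_sign sg : sg * sg = 1 -> (forall t, 0 <= sg * snd (c t)) -> 0 < sg * snd (CInt c 0 (2 * PI)) ->
  schwartz_globally_solvable c q.
Proof.
  intros Hsg Hb Hb0 f Hf. assert (HfS := proj1 Hf). assert (HS := schwartz_Cinf f HfS).
  destruct (apriori_sign sg Hsg Hb Hb0) as [r0 [Hr Ha]].
  set (F := FT (-1) (lift f)). assert (HF := Cinf0_FT f HS). fold F in HF.
  assert (Hk : exists kappa, Cinf Wloc (fun (_ : unit) _ xi => kappa xi) /\
    forall xi, (monodromy xi * (kappa xi + period_int c q F xi))%C = kappa xi).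
  { set (b0 := snd (CInt c 0 (2 * PI))) in *.
    assert (Hb0' : b0 <> 0) by (intros h; rewrite h in Hb0; lra).
    (* The only frequency with [Re Lam (2 PI) = 0], hence the only candidate for a resonance. *)
    set (x0 := fst (CInt q 0 (2 * PI)) / b0).
    assert (Hne : forall xi, xi <> x0 -> monodromy xi <> RtoC 1).
    { intros xi Hxi HE. apply Hxi. apply (f_equal Cmod) in HE. unfold monodromy in HE.
      rewrite Cmod_cexp, Cmod_1 in HE. rewrite <- exp_0 in HE. apply exp_inv in HE.
      change (fst (- Lam c q (2 * PI) xi)%C) with (- fst (Lam c q (2 * PI) xi)) in HE.
      rewrite Re_Lam in HE. fold b0 in HE. unfold x0. apply Rmult_eq_reg_r with b0; auto.
      field_simplify; auto. lra. }
    set (N := fun (_ : unit) (_ : R) xi => (1 + (-1) * monodromy xi)%C).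
    assert (HN : Cinf Wloc N).
    { assert (H1 := Cinf_monodromy). assert (H2 := Cinf_Wtame_Wloc _ (Cinf_const (I := unit) (-1)%C)).
      assert (H3 := Cinf_Wtame_Wloc _ (Cinf_const (I := unit) (RtoC 1))). unfold N. cinf_tac. }
    assert (HJ := Cinf_period_int c q Hc Hq F HF).
    destruct (classic (monodromy x0 = RtoC 1)) as [HE|HE].
    - assert (HJ0 : period_int c q F x0 = RtoC 0) by (apply annih_compat; auto; now apply monodromy_inv).
      set (J1 := hadamard x0 0 (Dx (fun (_ : unit) (_ : R) xi => period_int c q F xi))).
      set (e1 := hadamard x0 0 (Dx N)).
      assert (EN : forall xi, (1 - monodromy xi)%C = (RtoC (xi - x0) * e1 tt 0%R xi)%C).
      { intros xi. assert (E := hadamard_div x0 N tt 0 xi HN). fold e1 in E. unfold N in E. rewrite HE in E.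
        replace (1 - monodromy xi)%C with (1 + (-1) * monodromy xi)%C by ring. rewrite E. ring. }
      apply (kappa_exists (fun xi => RtoC (xi - x0)) _ (fun xi => J1 tt 0 xi) (fun xi => e1 tt 0 xi)).
      + apply (Cinf_ext Wloc (fun i _ xi => J1 i 0 xi)); [intros []; reflexivity|].
        apply Cinf_freeze0. intros n; apply Cn_hadamard, Cinf_Dx, HJ.
      + apply (Cinf_ext Wloc (fun i _ xi => e1 i 0 xi)); [intros []; reflexivity|].
        apply Cinf_freeze0. intros n; apply Cn_hadamard, Cinf_Dx, HN.
      (* At [x0] the quotient equals the derivative of [1 - monodromy], which is [i] times the
         integral of [c], of nonzero imaginary part [b0] before the factor [i]: the zero is simple.
         Elsewhere there is no resonance. *)
      + intros xi Hz. destruct (Req_dec xi x0) as [h|h].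
        * subst xi. unfold e1 in Hz. rewrite hadamard_at in Hz.
          assert (E1 : CInt (fun s => RtoC (s ^ 0)) 0 1 = RtoC 1).
          { rewrite (CInt_derive (fun s => RtoC s) (fun s => RtoC (s ^ 0))).
            - ring.
            - intros; apply is_dC_id.
            - intros s. destruct (pow_is_dC 0 s) as [l Hl]. exact (is_dC_cont _ _ _ Hl). }
          rewrite E1 in Hz.
          assert (E2 : Dx N tt 0 x0 = ((0, 1) * CInt c 0 (2 * PI) * monodromy x0)%C).
          { apply dC_is_dC. unfold N. eapply is_dC_eq; [apply is_dC_plus; [apply is_dC_const|apply is_dC_scal, is_dC_monodromy]|ring]. }
          rewrite E2, HE in Hz. apply (f_equal fst) in Hz. simpl in Hz. apply Hb0'. unfold b0; simpl. lra.
        * apply (Hne xi h). assert (E := EN xi). rewrite Hz in E.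
          replace (monodromy xi) with (1 - (1 - monodromy xi))%C by ring. rewrite E. ring.
      + intros xi. assert (E := hadamard_div x0 _ tt 0 xi HJ). fold J1 in E. rewrite E, HJ0. ring.
      + apply EN.
    - apply (kappa_exists (fun _ => RtoC 1) _ (fun xi => period_int c q F xi) (fun xi => N tt 0 xi)); auto.
      + intros xi Hz. assert (HE' : monodromy xi = RtoC 1).
        { unfold N in Hz. replace (monodromy xi) with (1 - (1 + (-1) * monodromy xi))%C by ring. rewrite Hz; ring. }
        destruct (Req_dec xi x0); [subst; auto|]. now apply (Hne xi).
      + intros; ring.
      + intros; unfold N; ring. }
  destruct Hk as [kappa [Hk1 Hk2]].
  apply (solvable_from_kappa f kappa r0 (fun _ => False) (fun _ => False)); auto.
  intros t xi _; split; tauto.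
Qed.

End Annihilator.

(** * A smooth step, and solvability for connected sublevel sets *)

(** The power of [/ x] makes the family closed under differentiation up to linear combinations, so
    smoothness is an induction over all [k]. *)
Definition flat (k : nat) (x : R) : R := if Rle_dec x 0 then 0 else (/ x) ^ k * exp (- / x).

Lemma flat_neg k x : x <= 0 -> flat k x = 0.
Proof. intros; unfold flat; destruct (Rle_dec x 0); lra. Qed.

Lemma flat_pos_eq k x : 0 < x -> flat k x = (/ x) ^ k * exp (- / x).
Proof. intros; unfold flat; destruct (Rle_dec x 0); lra. Qed.

Lemma flat_pos k x : 0 < x -> 0 < flat k x.
Proof.
  intros; rewrite flat_pos_eq by auto. apply Rmult_lt_0_compat; [|apply exp_pos].
  now apply pow_lt, Rinv_0_lt_compat.
Qed.

Lemma flat_nonneg k x : 0 <= flat k x.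
Proof. destruct (Rle_dec x 0); [rewrite flat_neg; lra|left; apply flat_pos; lra]. Qed.

Lemma flat_bound k : exists M, 0 <= M /\ forall x, Rabs (flat k x) <= M.
Proof.
  destruct (poly_exp k 1 ltac:(lra)) as [M K]. exists (Rabs M). split; [apply Rabs_pos|]. intros x.
  assert (hM := Rle_abs M).
  rewrite Rabs_right by apply Rle_ge, flat_nonneg.
  destruct (Rle_dec x 0) as [h|h]; [rewrite flat_neg by auto; apply Rabs_pos|].
  rewrite flat_pos_eq by lra. assert (hi := Rinv_0_lt_compat x ltac:(lra)).
  specialize (K (/ x)). rewrite (Rabs_right (/ x)) in K by lra. rewrite Rmult_1_l in K.
  eapply Rle_trans; [|eapply Rle_trans; [exact K|exact hM]].
  apply Rmult_le_compat_r; [left; apply exp_pos|]. apply pow_incr; lra.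
Qed.

Lemma is_derive_flat k x : is_derive (flat k) x (- INR k * flat (S k) x + flat (S (S k)) x).
Proof.
  destruct (Rtotal_order x 0) as [h|[h|h]].
  - rewrite !flat_neg by lra. apply is_derive_ext_loc with (fun _ => 0).
    + exists (mkposreal (- x) ltac:(lra)). intros y Hy. rewrite flat_neg; auto.
      apply ball_Rabs in Hy; simpl in Hy. lra.
    + replace (- INR k * 0 + 0) with 0 by ring. apply is_derive_Rconst.
  - subst x. rewrite !flat_neg by lra. replace (- INR k * 0 + 0) with 0 by ring.
    (* For [y > 0] one has [flat k y = flat (k + 2) y * y ^ 2], so the bound on the function two
       indices up is the quadratic remainder at 0. *)
    destruct (flat_bound (S (S k))) as [M [HM K]].
    apply is_derive_quadratic with M. intros y Hy. rewrite Rplus_0_l, (flat_neg k 0) by lra.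
    destruct (Rle_dec y 0).
    + rewrite flat_neg by auto. replace (0 - 0 - y * 0) with 0 by ring. rewrite Rabs_R0.
      apply Rmult_le_pos; auto. apply pow2_ge_0.
    + specialize (K y). replace (flat k y - 0 - y * 0) with (flat (S (S k)) y * y ^ 2).
      * rewrite Rabs_mult, (Rabs_right (y ^ 2)) by apply Rle_ge, pow2_ge_0.
        apply Rmult_le_compat_r; auto. apply pow2_ge_0.
      * rewrite !flat_pos_eq by lra. simpl. field. lra.
  - apply is_derive_ext_loc with (fun x => (/ x) ^ k * exp (- / x)).
    + exists (mkposreal x h). intros y Hy. rewrite flat_pos_eq; auto.
      apply ball_Rabs in Hy; simpl in Hy. lra.
    + rewrite !flat_pos_eq by auto. auto_derive; [lra|].
      destruct k; simpl; field; lra.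
Qed.

Lemma Cinf_flat {I} k : Cinf Wloc (fun (_ : I) _ x => RtoC (flat k x)).
Proof.
  intros n; revert k; induction n; intros k.
  all: assert (HW : Wloc (fun (_ : I) (_ : R) x => RtoC (flat k x))) by
    (destruct (flat_bound k) as [M [_ K]]; intros T X; exists M; intros; rewrite Cmod_R; auto).
  - split; auto.
  - apply (Cn_intro Wloc n _ (fun _ _ _ => RtoC 0)
      (fun _ _ x => RtoC (- INR k) * RtoC (flat (S k) x) + RtoC (flat (S (S k)) x))%C); auto.
    + intros; apply is_dC_const.
    + intros. eapply is_dC_eq; [apply is_dC_RtoC, is_derive_flat|]. rewrite RtoC_plus, RtoC_mult. ring.
    + apply Cn_zero, Wloc_const.
    + apply (Cn_plus Wloc n (fun _ _ x => RtoC (- INR k) * RtoC (flat (S k) x))%C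
         (fun _ _ x => RtoC (flat (S (S k)) x)) Wloc_add); auto.
      apply (Cn_mul Wloc Wloc Wloc n (fun _ _ _ => RtoC (- INR k)) (fun _ _ x => RtoC (flat (S k) x)) Wloc_add Wloc_mul); auto.
      apply (Cinf_Wtame_Wloc _ (Cinf_const _)).
Qed.

Lemma Cinf_compose {I} (g : R -> C) (Y : I -> R -> R -> R) :
  Cinf Wloc (fun (_ : unit) _ x => g x) -> Cinf Wloc (fun i t x => RtoC (Y i t x)) ->
  Cinf Wloc (fun i t x => g (Y i t x)).
Proof.
  intros Hg HY n; revert g Hg; induction n; intros g Hg.
  all: assert (HW : Wloc (fun i t x => g (Y i t x))).
  1, 3: intros T X; destruct (Cinf_W _ _ HY T X) as [M K]; destruct (Cinf_W _ _ Hg 0 M) as [N L];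
    exists N; intros i t x Ht Hx; specialize (K i t x Ht Hx); rewrite Cmod_R in K;
    apply (L tt 0 (Y i t x)); auto; rewrite Rabs_R0; lra.
  - split; auto.
  - set (g' := fun x => Dx (fun (_ : unit) (_ : R) x => g x) tt 0 x).
    assert (Hd : forall x, is_dC g x (g' x)) by (intros x; exact (Cinf_is_dC_x _ _ tt 0 x Hg)).
    assert (Hg' : Cinf Wloc (fun (_ : unit) (_ : R) x => g' x)).
    { apply (Cinf_ext Wloc (fun i _ x => Dx (fun (_ : unit) (_ : R) x => g x) i 0 x)); [intros []; reflexivity|].
      apply Cinf_freeze0, Cinf_Dx, Hg. }
    set (Yc := fun i t x => RtoC (Y i t x)). fold Yc in HY.
    assert (Hre : forall (y : R -> R) t l, is_dC (fun s => RtoC (y s)) t l -> is_derive y t (fst l) /\ l = RtoC (fst l)).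
    { intros y t l [A1 A2]. split; [exact A1|]. apply injective_projections; [reflexivity|]. simpl in A2 |- *.
      rewrite <- (is_derive_unique _ _ _ A2). apply is_derive_unique, is_derive_Rconst. }
    apply (Cn_intro Wloc n _ (fun i t x => Dt Yc i t x * g' (Y i t x))%C (fun i t x => Dx Yc i t x * g' (Y i t x))%C); auto.
    + intros i t x. destruct (Hre (fun s => Y i s x) t _ (Cinf_is_dC_t _ _ i t x HY)) as [A1 A2].
      eapply is_dC_eq; [exact (is_dC_comp g (fun s => Y i s x) t _ _ (Hd _) A1)|]. rewrite <- A2. reflexivity.
    + intros i t x. destruct (Hre (fun s => Y i t s) x _ (Cinf_is_dC_x _ _ i t x HY)) as [A1 A2].
      eapply is_dC_eq; [exact (is_dC_comp g (fun s => Y i t s) x _ _ (Hd _) A1)|]. rewrite <- A2. reflexivity.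
    + apply (Cn_mul Wloc Wloc Wloc n (Dt Yc) (fun i t x => g' (Y i t x)) Wloc_add Wloc_mul); auto. now apply Cinf_Dt.
    + apply (Cn_mul Wloc Wloc Wloc n (Dx Yc) (fun i t x => g' (Y i t x)) Wloc_add Wloc_mul); auto. now apply Cinf_Dx.
Qed.

(** It serves twice: to pass between negative and positive frequencies in case (i), and as the
    cutoff in [t] of the counterexample. *)
Definition step (x : R) : R := flat 0 (1 + x) / (flat 0 (1 + x) + flat 0 (1 - x)).

Lemma step_denom x : 0 < flat 0 (1 + x) + flat 0 (1 - x).
Proof.
  assert (h1 := flat_nonneg 0 (1 + x)). assert (h2 := flat_nonneg 0 (1 - x)).
  destruct (Rle_dec x 0).
  - assert (h := flat_pos 0 (1 - x) ltac:(lra)). lra.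
  - assert (h := flat_pos 0 (1 + x) ltac:(lra)). lra.
Qed.

Lemma step_low x : x <= -1 -> step x = 0.
Proof. intros; unfold step. rewrite (flat_neg 0 (1 + x)) by lra. unfold Rdiv; ring. Qed.

Lemma step_high x : 1 <= x -> step x = 1.
Proof.
  intros; unfold step. assert (h := step_denom x). rewrite (flat_neg 0 (1 - x)) in * by lra. field. lra.
Qed.

Lemma Cinf_step : Cinf Wloc (fun (_ : unit) _ x => RtoC (step x)).
Proof.
  assert (H1 : forall s, Cinf Wloc (fun (_ : unit) (_ : R) x => RtoC (flat 0 (1 + s * x)))).
  { intros s. apply (Cinf_compose (fun x => RtoC (flat 0 x)) (fun (_ : unit) _ x => 1 + s * x)); [apply Cinf_flat|].
    apply Cinf_Wtame_Wloc. apply (Cinf_ext Wtame (fun (_ : unit) _ x => RtoC 1 + RtoC s * RtoC x)%C).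
    - intros. now rewrite RtoC_plus, RtoC_mult.
    - cinf_tac. }
  assert (A1 := H1 1). assert (A2 := H1 (-1)). clear H1.
  assert (H3 : Cinf Wloc (fun (_ : unit) (_ : R) x => (RtoC (flat 0 (1 + 1 * x)) + RtoC (flat 0 (1 + -1 * x)))%C)) by cinf_tac.
  assert (Hn : forall x, (RtoC (flat 0 (1 + 1 * x)) + RtoC (flat 0 (1 + -1 * x)))%C <> RtoC 0).
  { intros x h. rewrite <- RtoC_plus in h. apply RtoC_inj in h. assert (hh := step_denom x).
    replace (1 + 1 * x) with (1 + x) in h by ring. replace (1 + -1 * x) with (1 - x) in h by ring. lra. }
  assert (H4 : Cinf Wloc (fun (_ : unit) (_ : R) x => (/ (RtoC (flat 0 (1 + 1 * x)) + RtoC (flat 0 (1 + -1 * x))))%C)).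
  { apply (Cinf0_inv (fun _ _ x => (RtoC (flat 0 (1 + 1 * x)) + RtoC (flat 0 (1 + -1 * x)))%C)); auto.
    apply (Wloc_of_x (fun x => / (RtoC (flat 0 (1 + 1 * x)) + RtoC (flat 0 (1 + -1 * x))))%C).
    eapply is_dC_ccont. intros x. apply is_dC_inv; auto. exact (Cinf_is_dC_x _ _ tt 0 x H3). }
  apply (Cinf_ext Wloc (fun (_ : unit) (_ : R) x => RtoC (flat 0 (1 + 1 * x)) *
    / (RtoC (flat 0 (1 + 1 * x)) + RtoC (flat 0 (1 + -1 * x))))%C).
  - intros _ _ x. assert (hh := step_denom x). unfold step.
    replace (1 + 1 * x) with (1 + x) by ring. replace (1 + -1 * x) with (1 - x) by ring.
    rewrite RtoC_div, RtoC_plus by lra. reflexivity.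
  - apply (Cinf_mul Wloc Wloc Wloc (fun (_ : unit) (_ : R) x => RtoC (flat 0 (1 + 1 * x)))
     (fun (_ : unit) (_ : R) x => (/ (RtoC (flat 0 (1 + 1 * x)) + RtoC (flat 0 (1 + -1 * x))))%C) Wloc_add Wloc_mul); auto.
Qed.

(** The points [a] and [b], both outside [S], cut the circle into two open arcs; their periodic
    lifts separate [S]. *)
Lemma not_connected_arcs (S : R -> Prop) a b s1 s2 : (forall t, S (t + 2 * PI) = S t) ->
  a < b < a + 2 * PI -> ~ S a -> ~ S b -> a < s1 < b -> S s1 -> b < s2 < a + 2 * PI -> S s2 ->
  ~ connected_T1 S.
Proof.
  intros Hp Hab Ha Hb Hs1 H1 Hs2 H2 Hcon. apply Hcon. assert (HP := PI_RGT_0).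
  assert (Hopen : forall l r, open_T1 (fun t => exists k, l < t + 2 * PI * IZR k < r)).
  { intros l r. split.
    - intros t. split; intros [k Hk].
      + exists (k - 1)%Z. rewrite minus_IZR. lra.
      + exists (k + 1)%Z. rewrite plus_IZR. lra.
    - intros t [k Hk]. exists (Rmin (t + 2 * PI * IZR k - l) (r - (t + 2 * PI * IZR k))).
      split; [apply Rmin_pos; lra|]. intros s Hs. exists k.
      assert (h1 := Rlt_le_trans _ _ _ Hs (Rmin_l _ _)). assert (h2 := Rlt_le_trans _ _ _ Hs (Rmin_r _ _)).
      apply Rabs_lt_between in h1. apply Rabs_lt_between in h2. lra. }
  exists (fun t => exists k, a < t + 2 * PI * IZR k < b), (fun t => exists k, b < t + 2 * PI * IZR k < a + 2 * PI).
  split; [apply Hopen|split; [apply Hopen|split; [|split; [|split]]]].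
  - intros t Ht. set (k := Int_part ((t - a) / (2 * PI))).
    assert (Hm := modT_bounds (t - a)). unfold modT in Hm. fold k in Hm.
    assert (E : t + 2 * PI * IZR (- k) = (t - a - 2 * PI * IZR k) + a) by (rewrite opp_IZR; ring).
    assert (HS : S (t + 2 * PI * IZR (- k))) by now rewrite (periodic_Z S Hp).
    destruct (Rtotal_order (t + 2 * PI * IZR (- k)) b) as [h|[h|h]].
    + left. exists (- k)%Z. split; [|auto]. destruct (Req_dec (t + 2 * PI * IZR (- k)) a) as [h'|h'].
      * rewrite h' in HS. tauto.
      * lra.
    + rewrite h in HS. tauto.
    + right. exists (- k)%Z. lra.
  - exists s1. split; auto. exists 0%Z. lra.
  - exists s2. split; auto. exists 0%Z. lra.
  - intros t _ [k Hk] [l Hl].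
    assert (0 < 2 * PI * (IZR l - IZR k) < 2 * PI * 1) as [h1 h2] by lra.
    rewrite <- (Rmult_0_r (2 * PI)) in h1.
    apply Rmult_lt_reg_l in h1; [|lra]. apply Rmult_lt_reg_l in h2; [|lra].
    rewrite <- minus_IZR in h1, h2. apply lt_IZR in h1. apply lt_IZR in h2. lia.
Qed.

Lemma CInt_shift f : smooth_T1 f -> forall t, CInt f 0 (t + 2 * PI) = (CInt f 0 t + CInt f 0 (2 * PI))%C.
Proof.
  intros Hf t. assert (Hcf := smooth_ccont f Hf).
  assert (E := is_dC_zero_const (fun t => CInt f 0 (t + 2 * PI)%R - CInt f 0 t)%C t 0).
  cbv beta in E. rewrite CInt_point, Rplus_0_l in E.
  replace (CInt f 0 (t + 2 * PI)) with ((CInt f 0 (t + 2 * PI) - CInt f 0 t) + CInt f 0 t)%C by ring.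
  rewrite E; [ring|].
  intros u. eapply is_dC_eq; [apply is_dC_minus; [apply (is_dC_shift (fun t => CInt f 0 t)); now apply is_dC_CInt|now apply is_dC_CInt]|].
  cbv beta. rewrite (proj1 Hf). ring.
Qed.

Lemma avg_CInt f : CInt f 0 (2 * PI) = (RtoC (2 * PI) * avg f)%C.
Proof.
  assert (HP := PI_RGT_0).
  assert (H : forall a b : R, ((a, b) : C) = (RtoC (2 * PI) * (a / (2 * PI), b / (2 * PI))%R)%C).
  { intros; apply injective_projections; simpl; field; lra. }
  apply H.
Qed.

(** * Unimodality of a periodic function with connected sublevel sets *)

Section Unimodal.
Variable B : R -> R.
Hypotheses (HB : forall t, B (t + 2 * PI) = B t) (HBc : forall t, continuous B t)
  (Hcon : forall r, connected_T1 (fun t => B (modT t) < r)).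

Lemma sublevel_per r t : (B (modT (t + 2 * PI)) < r) = (B (modT t) < r).
Proof. now rewrite !(periodic_modT B HB), HB. Qed.

Lemma exists_min : exists p, forall t, B p <= B t.
Proof.
  assert (HP := PI_RGT_0).
  destruct (continuity_ab_min B 0 (2 * PI)) as [p [Hp _]]; [lra| |].
  - intros t _. apply continuity_pt_filterlim, HBc.
  - exists p. intros t. rewrite <- (periodic_modT B HB t). apply Hp. assert (h := modT_bounds t). lra.
Qed.

Lemma exists_max : exists p, forall t, B t <= B p.
Proof.
  assert (HP := PI_RGT_0).
  destruct (continuity_ab_maj B 0 (2 * PI)) as [p [Hp _]]; [lra| |].
  - intros t _. apply continuity_pt_filterlim, HBc.
  - exists p. intros t. rewrite <- (periodic_modT B HB t). apply Hp. assert (h := modT_bounds t). lra.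
Qed.

(** Otherwise [B] exceeds [B t], and so also [B p], at points [s1] and [s2] on both arcs between [p]
    and [t]; the sublevel set at the smaller of these two values contains [t] and [p] but is cut by
    [s1] and [s2]. *)
Lemma unimodal_min p t : (forall t, B p <= B t) -> p <= t <= p + 2 * PI ->
  (forall s, p <= s <= t -> B s <= B t) \/ (forall s, t <= s <= p + 2 * PI -> B s <= B t).
Proof.
  intros Hp Ht. apply NNPP. intros Hn. apply not_or_and in Hn. destruct Hn as [N1 N2].
  apply not_all_ex_not in N1. destruct N1 as [s1 N1]. apply imply_to_and in N1. destruct N1 as [h1 N1].
  apply not_all_ex_not in N2. destruct N2 as [s2 N2]. apply imply_to_and in N2. destruct N2 as [h2 N2].
  set (r := Rmin (B s1) (B s2)).
  assert (hr : B t < r) by (apply Rmin_glb_lt; lra).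
  assert (hr1 : r <= B s1) by apply Rmin_l. assert (hr2 : r <= B s2) by apply Rmin_r.
  assert (n1 : s1 <> t) by (intros e; rewrite e in N1; lra).
  assert (n2 : s2 <> t) by (intros e; rewrite e in N2; lra).
  assert (n3 : s1 <> p) by (intros e; rewrite e in N1; specialize (Hp t); lra).
  assert (n4 : s2 <> p + 2 * PI) by (intros e; rewrite e, HB in N2; specialize (Hp t); lra).
  revert Hcon. intros Hcon.
  apply (not_connected_arcs (fun t => B (modT t) < r) s1 s2 t (p + 2 * PI)) in Hcon; auto using sublevel_per;
    rewrite ?(periodic_modT B HB), ?HB; try lra.
  specialize (Hp t); lra.
Qed.

(** Dual to [unimodal_min]: now [p] and [t] are the cutting points, outside the sublevel set at the
    value [B t], while [s1] and [s2] lie in it on either side. *)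
Lemma unimodal_max p t : (forall t, B t <= B p) -> p <= t <= p + 2 * PI ->
  (forall s, p <= s <= t -> B t <= B s) \/ (forall s, t <= s <= p + 2 * PI -> B t <= B s).
Proof.
  intros Hp Ht. apply NNPP. intros Hn. apply not_or_and in Hn. destruct Hn as [N1 N2].
  apply not_all_ex_not in N1. destruct N1 as [s1 N1]. apply imply_to_and in N1. destruct N1 as [h1 N1].
  apply not_all_ex_not in N2. destruct N2 as [s2 N2]. apply imply_to_and in N2. destruct N2 as [h2 N2].
  set (r := B t).
  assert (n1 : s1 <> t) by (intros e; rewrite e in N1; lra).
  assert (n2 : s2 <> t) by (intros e; rewrite e in N2; lra).
  assert (n3 : s1 <> p) by (intros e; rewrite e in N1; specialize (Hp t); lra).
  assert (n4 : s2 <> p + 2 * PI) by (intros e; rewrite e, HB in N2; specialize (Hp t); lra).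
  apply (not_connected_arcs (fun t => B (modT t) < r) p t s1 s2) in Hcon; auto using sublevel_per;
    rewrite ?(periodic_modT B HB), ?HB; unfold r; try lra.
  specialize (Hp t); lra.
Qed.

End Unimodal.

(** * Solvability in case (i) *)

Section PartOne.
Variables (c q : R -> C).
Hypotheses (Hc : smooth_T1 c) (Hq : smooth_T1 q).

(** By periodicity [v] vanishes at [p + 2 PI] as well, so [duhamel] may start from either end; the
    end is chosen so that [Re Lam] stays below its value at [t]. *)
Lemma apriori_zero xi p v g M : is_sol c q xi v g -> (forall t, v (t + 2 * PI) = v t) -> v p = RtoC 0 ->
  (forall t, Cmod (g t) <= M) ->
  (forall t, p <= t <= p + 2 * PI ->
    (forall s, p <= s <= t -> fst (Lam c q s xi) <= fst (Lam c q t xi)) \/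
    (forall s, t <= s <= p + 2 * PI -> fst (Lam c q s xi) <= fst (Lam c q t xi))) ->
  forall t, Cmod (v t) <= 4 * PI * M.
Proof.
  intros Hs Hv Hv0 HM Halt t. assert (HP := PI_RGT_0).
  assert (M0 : 0 <= M) by (eapply Rle_trans; [apply Cmod_ge_0|apply (HM 0)]).
  assert (K : forall t, p <= t <= p + 2 * PI -> Cmod (v t) <= 4 * PI * M).
  { clear t. intros t Ht. set (r := fst (Lam c q t xi)). assert (hr := exp_pos r).
    apply Rmult_le_reg_l with (exp r); auto.
    replace (exp r * Cmod (v t)) with (Cmod (cexp (Lam c q t xi) * v t)) by now rewrite Cmod_mult, Cmod_cexp.
    assert (0 <= exp r * M) by (apply Rmult_le_pos; lra).
    destruct (Halt t Ht) as [A|A].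
    - assert (HD := duhamel c q Hc Hq xi v g p t r M ltac:(lra) Hs HM A).
      rewrite Hv0 in HD. replace (cexp (Lam c q t xi) * v t)%C with
        (cexp (Lam c q t xi) * v t - cexp (Lam c q p xi) * RtoC 0)%C by ring. nra.
    - assert (HD := duhamel c q Hc Hq xi v g t (p + 2 * PI) r M ltac:(lra) Hs HM A).
      rewrite Hv, Hv0 in HD. rewrite <- Cmod_opp. replace (- (cexp (Lam c q t xi) * v t))%C with
        (cexp (Lam c q (p + 2 * PI) xi) * RtoC 0 - cexp (Lam c q t xi) * v t)%C by ring. nra. }
  assert (Hm := modT_bounds (t - p)).
  assert (E : v t = v (modT (t - p) + p)).
  { symmetry. rewrite (periodic_modT (fun s => v (s + p))).
    - f_equal; ring.
    - intros s. rewrite <- (Hv (s + p)). f_equal; ring. }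
  rewrite E. apply K. lra.
Qed.

Lemma solvable_connected : avg c = RtoC 0 -> (exists z : C, in_iZ z /\ forall t, q t = z) ->
  (forall r : R, connected_T1 (Omega (fun t => snd (c t)) r)) -> schwartz_globally_solvable c q.
Proof.
  intros Hav [z [[k Hz] Hqz]] Hcon f Hf. assert (HfS := proj1 Hf). assert (HS := schwartz_Cinf f HfS).
  assert (HC0 : CInt c 0 (2 * PI) = RtoC 0) by (rewrite avg_CInt, Hav; ring).
  assert (HQ : forall t, CInt q 0 t = (0, IZR k * t)).
  { intros t. unfold CInt. f_equal.
    - rewrite (RInt_ext _ (fun _ => 0)) by (intros; rewrite Hqz, Hz; reflexivity).
      rewrite RInt_Rconst; simpl; ring.
    - rewrite (RInt_ext _ (fun _ => IZR k)) by (intros; rewrite Hqz, Hz; reflexivity).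
      rewrite RInt_Rconst; simpl; ring. }
  set (B := fun t => snd (CInt c 0 t)).
  assert (HB : forall t, B (t + 2 * PI) = B t).
  { intros t. unfold B. rewrite (CInt_shift c Hc), HC0. simpl. ring. }
  assert (HBc : forall t, continuous B t).
  { intros t. exact (proj2 (is_dC_cont _ _ _ (is_dC_CInt c 0 t (smooth_ccont c Hc)))). }
  assert (HRe : forall t xi, fst (Lam c q t xi) = - xi * B t).
  { intros t xi. rewrite Re_Lam, HQ. simpl. unfold B; simpl. ring. }
  assert (HE : forall xi, cexp (Lam c q (2 * PI) xi) = RtoC 1).
  { intros xi. unfold Lam. rewrite HC0, HQ.
    assert (Hcos : forall t, cos (t + 2 * PI) = cos t) by (intros; rewrite cos_plus, cos_2PI, sin_2PI; ring).
    assert (Hsin : forall t, sin (t + 2 * PI) = sin t) by (intros; rewrite sin_plus, cos_2PI, sin_2PI; ring).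
    unfold cexp; simpl.
    replace (0 * 0 - xi * 0 + 0) with 0 by ring.
    replace (0 * 0 + xi * 0 + IZR k * (2 * PI)) with (0 + 2 * PI * IZR k) by ring.
    rewrite (periodic_Z cos Hcos), (periodic_Z sin Hsin), exp_0, cos_0, sin_0.
    apply injective_projections; simpl; ring. }
  destruct (exists_min B HB HBc) as [pm Hpm]. destruct (exists_max B HB HBc) as [pM HpM].
  set (F := FT (-1) (lift f)). assert (HF := Cinf0_FT f HS). fold F in HF.
  set (P := prim 0 (fun i t xi => cexp (Lam c q t xi) * F i t xi)%C).
  assert (HPs : Cinf Wloc P) by (apply Cinf_prim; now apply Cinf_eLamG).
  (* For [xi >= 1] this is [- P pM], which makes the solution vanish at the maximum of [B], that is
     at the minimum of [Re Lam = - xi B]; for [xi <= -1] it is [- P pm]. The interpolation between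
     is harmless, because with trivial monodromy and vanishing [period_int] every [kappa] gives a
     periodic solution. *)
  set (kappa := fun xi => ((-1) * (RtoC (step xi) * P tt pM xi + (1 + (-1) * RtoC (step xi)) * P tt pm xi))%C).
  apply (solvable_from_kappa c q Hc Hq f kappa 1 (fun t => t = pM) (fun t => t = pm)); auto.
  - lra.
  - exists (4 * PI). intros xi v g M Hxi Hs Hv Hzp Hzm HM.
    destruct (Rlt_dec 0 xi) as [h|h].
    + apply (apriori_zero xi pM v g); auto. intros t Ht.
      destruct (unimodal_max B HB Hcon pM t HpM Ht) as [A|A]; [left|right]; intros s Hss;
        specialize (A s Hss); rewrite !HRe; nra.
    + assert (h' : xi < 0) by (revert Hxi; unfold Rabs; destruct (Rcase_abs xi); lra).
      apply (apriori_zero xi pm v g); auto. intros t Ht.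
      destruct (unimodal_min B HB Hcon pm t Hpm Ht) as [A|A]; [left|right]; intros s Hss;
        specialize (A s Hss); rewrite !HRe; nra.
  - unfold kappa. assert (H1 := Cinf_step).
    assert (H2 : forall t0, Cinf Wloc (fun (_ : unit) (_ : R) xi => P tt t0 xi)).
    { intros t0. apply (Cinf_ext Wloc (fun i _ xi => P i t0 xi)); [intros []; reflexivity|]. now apply Cinf_freeze0. }
    assert (H3 := H2 pM). assert (H4 := H2 pm). clear H2.
    assert (H5 := Cinf_Wtame_Wloc _ (Cinf_const (I := unit) (-1)%C)). assert (H6 := Cinf_Wtame_Wloc _ (Cinf_const (I := unit) (RtoC 1))).
    cinf_tac.
  - intros xi. rewrite (annih_compat c q Hc Hq f xi Hf (HE xi)).
    assert (E := cexp_opp (Lam c q (2 * PI) xi)). rewrite HE in E.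
    replace (cexp (- Lam c q (2 * PI) xi)) with (RtoC 1); [ring|]. rewrite <- E. ring.
  - intros t xi Hxi. split; intros hx ->; unfold sol; fold F P; unfold kappa.
    + rewrite step_high by (rewrite Rabs_right in Hxi; lra). ring.
    + rewrite step_low by (rewrite Rabs_left in Hxi; lra). ring.
Qed.

End PartOne.

(** * Failure of solvability when b changes sign *)

Lemma smooth_T1_of_Cinf f : periodic1 f -> Cinf Wloc (fun (_ : unit) t (_ : R) => f t) -> smooth_T1 f.
Proof.
  intros Hp H. split; auto. intros n.
  assert (K : Cinf Wloc (fun (_ : unit) t (_ : R) => Nat.iter n dC f t)).
  { induction n; [exact H|exact (Cinf_Dt _ _ IHn)]. }
  intros t. exact (is_dC_ex _ _ _ (Cinf_is_dC_t _ _ tt t 0 K)).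
Qed.

(** Differentiation shifts the phase by [PI / 2], so the induction runs over all phases. *)
Lemma Cinf_cos {I} a : Cinf Wloc (fun (_ : I) t (_ : R) => RtoC (cos (t + a))).
Proof.
  intros n; revert a; induction n; intros a.
  all: assert (HW : Wloc (fun (_ : I) t (_ : R) => RtoC (cos (t + a)))) by
    (intros T X; exists 1; intros; rewrite Cmod_R; apply Rabs_le, COS_bound).
  - split; auto.
  - apply (Cn_intro Wloc n _ (fun _ t _ => RtoC (cos (t + (a + PI / 2)))) (fun _ _ _ => RtoC 0)); auto.
    + intros i t x. apply is_dC_RtoC. replace (cos (t + (a + PI / 2))) with (- sin (t + a)).
      * auto_derive; auto. ring.
      * replace (t + (a + PI / 2)) with (PI / 2 + (t + a)) by ring. rewrite <- (Ropp_involutive (cos _)).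
        f_equal. rewrite sin_cos. reflexivity.
    + intros; apply is_dC_const.
    + apply Cn_zero, Wloc_const.
Qed.

Lemma cos_per t : cos (t + 2 * PI) = cos t.
Proof. rewrite cos_plus, cos_2PI, sin_2PI; ring. Qed.

Lemma finite_max (N : nat) (Q : nat -> R -> Prop) : (forall a M M', M <= M' -> Q a M -> Q a M') ->
  (forall a, exists M, Q a M) -> exists M, forall a, (a <= N)%nat -> Q a M.
Proof.
  intros Hm H. induction N.
  - destruct (H O) as [M K]. exists M. intros a Ha. now replace a with O by lia.
  - destruct IHN as [M1 K1], (H (S N)) as [M2 K2]. exists (Rmax M1 M2). intros a Ha.
    destruct (Nat.eq_dec a (S N)) as [->|n].
    + eapply Hm; [apply Rmax_r|auto].
    + eapply Hm; [apply Rmax_l|]. apply K1; lia.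
Qed.

(** The family [H] is bounded in every seminorm uniformly in [n], so the perturbations tend to [f]
    in the Schwartz topology and continuity of [v] applies. This uniformity is the purpose of the
    index in [fam]. *)
Lemma tempered_limit v f (H : fam nat) : tempered v -> schwartz f -> Cinf Wrapid H -> (forall n, periodic2 (H n)) ->
  (forall n, schwartz (fun t x => f t x + RtoC (/ (INR n + 1)) * H n t x)%C /\
     v (fun t x => f t x + RtoC (/ (INR n + 1)) * H n t x)%C = RtoC 0) -> v f = RtoC 0.
Proof.
  intros [_ [_ Hv]] Hf HS Hp Hn.
  assert (Hsmall : forall eps, 0 < eps -> Cmod (v f) < eps).
  { intros eps Heps. destruct (Hv f Hf eps Heps) as [N [del [Hdel K]]].
    set (FD := fun a b => Nat.iter a Dt (Nat.iter b Dx H)).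
    assert (HFD : forall a b, Cinf Wrapid (FD a b)).
    { intros a b. unfold FD. induction a; simpl; [induction b; simpl; auto using Cinf_Dx|auto using Cinf_Dt]. }
    assert (EFD : forall a b n, FD a b n = Dab a b (H n)).
    { intros a b n. unfold FD, Dab. induction a; simpl; [induction b; simpl; [reflexivity|]|].
      - unfold Dx at 1. now rewrite IHb.
      - unfold Dt at 1. now rewrite IHa. }
    assert (HFp : forall a b n, periodic2 (FD a b n)).
    { intros a b n. rewrite EFD. unfold Dab. induction a; simpl; [induction b; simpl; auto using periodic_dx|auto using periodic_dt]. }
    assert (HB : exists M, forall g, (g <= N)%nat -> forall a, (a <= N)%nat -> forall b, (b <= N)%nat ->
      forall n t x, Rabs x ^ g * Cmod (FD a b n t x) <= M).
    { apply (finite_max N (fun g M => forall a, (a <= N)%nat -> forall b, (b <= N)%nat ->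
        forall n t x, Rabs x ^ g * Cmod (FD a b n t x) <= M)).
      { intros; eapply Rle_trans; [|eassumption]; auto. }
      intros g. apply (finite_max N (fun a M => forall b, (b <= N)%nat ->
        forall n t x, Rabs x ^ g * Cmod (FD a b n t x) <= M)).
      { intros; eapply Rle_trans; [|eassumption]; auto. }
      intros a. apply (finite_max N (fun b M => forall n t x, Rabs x ^ g * Cmod (FD a b n t x) <= M)).
      { intros; eapply Rle_trans; [|eassumption]; auto. }
      intros b. destruct (Cinf_W _ _ (HFD a b) (2 * PI) g) as [M KM]. exists M. intros n t x.
      rewrite <- (periodic_modT (fun t => FD a b n t x) (fun t => HFp a b n t x) t).
      assert (Hm := modT_bounds t).
      eapply Rle_trans; [|apply (KM n (modT t) x); rewrite Rabs_right; lra].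
      apply Rmult_le_compat_r; [apply Cmod_ge_0|]. apply pow_incr. assert (h := Rabs_pos x). lra. }
    destruct HB as [M HB]. assert (hM := Rabs_pos M). assert (hM' := Rle_abs M).
    destruct (nfloor_ex (Rabs M / del)) as [n [_ Hn2]]; [now apply Rdiv_le_0_compat|].
    destruct (Hn n) as [S1 V1]. set (d := / (INR n + 1)) in *.
    assert (hn := pos_INR n). assert (Hd : 0 < d) by (apply Rinv_0_lt_compat; lra).
    specialize (K _ S1).
    rewrite V1 in K. replace (Cmod (v f)) with (Cmod (Cminus (RtoC 0) (v f))).
    2:{ rewrite <- Cmod_opp. f_equal. ring. }
    apply K. intros a b g Ha Hb Hg t x.
    assert (E : fsub (fun t x => f t x + RtoC d * H n t x)%C f = fun t x => (RtoC d * H n t x)%C).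
    { apply functional_extensionality; intros u; apply functional_extensionality; intros y. unfold fsub. ring. }
    rewrite E.
    assert (E2 : Dab a b (fun t x => RtoC d * H n t x)%C = fun t x => (RtoC d * FD a b n t x)%C).
    { clear Ha Hb. unfold Dab. induction a; simpl.
      - induction b; simpl; [reflexivity|]. rewrite IHb.
        apply functional_extensionality; intros u; apply functional_extensionality; intros y.
        apply dC_is_dC, is_dC_scal. exact (Cinf_is_dC_x _ _ n u y (HFD O b)).
      - rewrite IHa. apply functional_extensionality; intros u; apply functional_extensionality; intros y.
        apply dC_is_dC, is_dC_scal. exact (Cinf_is_dC_t _ _ n u y (HFD a b)). }
    rewrite E2, Cmod_mult, Cmod_R, (Rabs_right d) by lra.
    specialize (HB g Hg a Ha b Hb n t x).
    apply Rle_trans with (d * Rabs M).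
    - replace (Rabs x ^ g * (d * Cmod (FD a b n t x))) with (d * (Rabs x ^ g * Cmod (FD a b n t x))) by ring.
      apply Rmult_le_compat_l; lra.
    - apply Rmult_le_reg_r with (INR n + 1); [lra|]. unfold d.
      replace (/ (INR n + 1) * Rabs M * (INR n + 1)) with (Rabs M) by (field; lra).
      apply Rmult_le_reg_r with (/ del); [now apply Rinv_0_lt_compat|].
      replace (del * (INR n + 1) * / del) with (INR n + 1) by (field; lra).
      unfold Rdiv in Hn2. lra. }
  apply Cmod_eq_0. apply Rle_antisym; [|apply Cmod_ge_0].
  apply Rnot_lt_le. intros h. specialize (Hsmall _ h). lra.
Qed.

(** * Uniqueness at non-resonant frequencies *)

Section Uniqueness.
Variables (c q : R -> C).
Hypotheses (Hc : smooth_T1 c) (Hq : smooth_T1 q).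

(** [exp Lam (v - w)] is constant; comparing it at 0 and [2 PI] forces either [v 0 = w 0] or trivial
    monodromy. *)
Lemma sol_periodic_unique xi v w g : is_sol c q xi v g -> is_sol c q xi w g ->
  (forall t, v (t + 2 * PI) = v t) -> (forall t, w (t + 2 * PI) = w t) -> monodromy c q xi <> RtoC 1 ->
  forall t, v t = w t.
Proof.
  intros Hv Hw Pv Pw HE t. apply (sol_unique c q Hc Hq xi v w g 0 t Hv Hw).
  assert (E := is_dC_zero_const (fun t => cexp (Lam c q t xi) * v t - cexp (Lam c q t xi) * w t)%C (2 * PI) 0).
  cbv beta in E. rewrite Lam_0, cexp_0 in E.
  assert (P1 := Pv 0). assert (P2 := Pw 0). rewrite Rplus_0_l in P1, P2. rewrite P1, P2 in E.
  assert (E1 : (cexp (Lam c q (2 * PI) xi) * v 0%R - cexp (Lam c q (2 * PI) xi) * w 0%R)%C = (RtoC 1 * v 0%R - RtoC 1 * w 0%R)%C).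
  { apply E. intros u. eapply is_dC_eq; [apply is_dC_minus; apply is_dC_eLam_sol; eassumption|cbv beta; ring]. }
  apply NNPP. intros hn. apply HE.
  assert (E2 := cexp_opp (Lam c q (2 * PI) xi)). fold (monodromy c q xi) in E2.
  set (L := cexp (Lam c q (2 * PI) xi)) in *.
  assert (hd : (v 0 - w 0)%C <> RtoC 0).
  { intros h. apply hn. replace (v 0) with ((v 0%R - w 0%R) + w 0%R)%C by ring. rewrite h. ring. }
  assert (L1 : L = RtoC 1).
  { replace L with ((L * v 0%R - L * w 0%R) / (v 0%R - w 0%R))%C by (field; auto). rewrite E1. field. auto. }
  rewrite L1 in E2. rewrite <- E2. ring.
Qed.

(** If the monodromy were 1 on a half-line, its derivative there would vanish and so would the
    integral of [c]; then [exp (2 PI q_0) = 1] puts [q_0] in [iZ]. *)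
Lemma monodromy_neq_1 : avg c <> RtoC 0 \/ ~ in_iZ (avg q) -> forall r, exists xi, xi < r /\ monodromy c q xi <> RtoC 1.
Proof.
  intros Hor r. apply NNPP. intros Hn. assert (HP := PI_RGT_0).
  assert (H1 : forall xi, xi < r -> monodromy c q xi = RtoC 1).
  { intros xi Hxi. apply NNPP. intros h. apply Hn. exists xi; auto. }
  assert (HC0 : CInt c 0 (2 * PI) = RtoC 0).
  { assert (D : dC (monodromy c q) (r - 1) = RtoC 0).
    { apply dC_is_dC. assert (Hloc : forall p : C -> R, locally (r - 1) (fun y => p (RtoC 1) = p (monodromy c q y))).
      { intros p. exists (mkposreal 1 Rlt_0_1). intros y Hy. rewrite H1; auto.
      apply ball_Rabs in Hy; simpl in Hy. lra. }
      split; simpl.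
      - apply is_derive_ext_loc with (fun _ => fst (RtoC 1)); [apply (Hloc fst)|apply is_derive_Rconst].
      - apply is_derive_ext_loc with (fun _ => snd (RtoC 1)); [apply (Hloc snd)|apply is_derive_Rconst]. }
    rewrite (dC_is_dC _ _ _ (is_dC_monodromy c q (r - 1))) in D. rewrite H1 in D by lra.
    replace (CInt c 0 (2 * PI)) with ((0, 1) * (- ((0, 1) * CInt c 0 (2 * PI)) * 1))%C.
    - rewrite D. ring.
    - apply injective_projections; simpl; ring. }
  destruct Hor as [Hor|Hor]; apply Hor.
  - rewrite avg_CInt in HC0. apply (f_equal (fun z => (/ RtoC (2 * PI) * z)%C)) in HC0.
    rewrite Cmult_assoc, Cinv_l, Cmult_1_l in HC0; [rewrite HC0; ring|].
    intros h; apply RtoC_inj in h; lra.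
  - assert (HE := H1 (r - 1) ltac:(lra)). apply monodromy_inv in HE. unfold Lam in HE. rewrite HC0, avg_CInt in HE.
    replace ((0, (r - 1)%R) * RtoC 0 + RtoC (2 * PI) * avg q)%C with (RtoC (2 * PI) * avg q)%C in HE by ring.
    remember (avg q) as z eqn:Ez; clear Ez. assert (HM := f_equal Cmod HE). rewrite Cmod_cexp, Cmod_1, <- exp_0 in HM.
    apply exp_inv in HM. simpl in HM.
    assert (Hz1 : fst z = 0) by nra.
    assert (Hcos := f_equal fst HE). unfold cexp in Hcos. simpl in Hcos. rewrite Hz1 in Hcos.
    replace (2 * PI * 0 - 0 * snd z) with 0 in Hcos by ring.
    replace (2 * PI * snd z + 0 * 0) with (2 * (PI * snd z)) in Hcos by ring.
    rewrite exp_0, cos_2a_sin in Hcos.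
    assert (Hs : sin (PI * snd z) = 0) by nra.
    apply sin_eq_0_0 in Hs. destruct Hs as [k Hk]. exists k.
    apply injective_projections; simpl; auto. apply Rmult_eq_reg_l with PI; lra.
Qed.

End Uniqueness.

Lemma descent_near f x l k : is_derive f x l -> k * l < 0 -> exists s, 0 < s < 1 /\ f (x + s * k) < f x.
Proof.
  intros H Hk. apply is_derive_Reals in H.
  assert (Hl : 0 < Rabs l) by (apply Rabs_pos_lt; intros e; rewrite e in Hk; lra).
  assert (Hk0 : 0 < Rabs k) by (apply Rabs_pos_lt; intros e; rewrite e in Hk; lra).
  destruct (H (Rabs l) Hl) as [d Hd]. assert (hd := cond_pos d).
  set (s := Rmin (/ 2) (d / (2 * Rabs k))).
  assert (hs : 0 < s) by (apply Rmin_pos; [lra|apply Rdiv_lt_0_compat; lra]).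
  assert (s1 : s <= / 2) by apply Rmin_l.
  assert (s2 : s * Rabs k <= d / 2).
  { apply Rle_trans with (d / (2 * Rabs k) * Rabs k); [apply Rmult_le_compat_r; [lra|apply Rmin_r]|].
    right; field; lra. }
  assert (Hsk : s * k <> 0) by (apply Rmult_integral_contrapositive; split; [lra|intros e; rewrite e in Hk; lra]).
  exists s. split; [lra|].
  specialize (Hd (s * k) Hsk ltac:(rewrite Rabs_mult, (Rabs_right s); lra)).
  set (Q := (f (x + s * k) - f x) / (s * k)) in *.
  assert (E : f (x + s * k) - f x = Q * (s * k)) by (unfold Q; field; split; intros e; apply Hsk; rewrite e; ring).
  assert (Q * k < 0); [|nra].
  apply Rabs_lt_between in Hd. revert Hd. unfold Rabs. destruct (Rcase_abs l); intros; nra.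
Qed.

Lemma cont_lower (f : R -> R) x m : continuous f x -> m < f x ->
  exists d, 0 < d /\ forall y, Rabs (y - x) <= d -> m <= f y.
Proof.
  intros H Hm. assert (He : 0 < f x - m) by lra.
  destruct (H (fun y => m <= y)) as [d Hd].
  - exists (mkposreal _ He). intros y Hy.
      apply ball_Rabs in Hy; simpl in Hy. lra.
  - assert (hd := cond_pos d). exists (d / 2). split; [lra|]. intros y Hy. apply Hd.
    unfold ball; simpl; unfold AbsRing_ball, abs, minus, plus, opp; simpl.
    unfold Rminus in Hy. lra.
Qed.

(** * The dip of the corrected primitive *)

Section Dip.
Variables (tm h : R).
Hypotheses (Hh : 0 < h < PI).

Definition arc : R := (h + PI) / 2.
(** Positive exactly on the arc of the circle opposite to [tm], at distance more than [arc].
    Composing with the cosine makes it periodic at once. *)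
Definition bump (t : R) : R := flat 0 (cos arc - cos (t - tm)).
Definition mass : C := CInt (fun t => RtoC (bump t)) 0 (2 * PI).

(** Equal to [f] on the arc [|t - tm| <= arc], with mean zero: this makes [Lam] periodic. *)
Definition corr (f : R -> C) (t : R) : C := (f t + - (CInt f 0 (2 * PI)%R / mass) * RtoC (bump t))%C.

Lemma Cinf_bump : Cinf Wloc (fun (_ : unit) t (_ : R) => RtoC (bump t)).
Proof.
  apply (Cinf_compose (fun x => RtoC (flat 0 x)) (fun (_ : unit) t _ => cos arc - cos (t - tm))); [apply Cinf_flat|].
  apply (Cinf_ext Wloc (fun _ t _ => RtoC (cos arc) + (-1) * RtoC (cos (t + - tm)))%C).
  - intros. unfold Rminus. rewrite RtoC_plus, RtoC_opp. ring.
  - assert (H1 := Cinf_cos (I := unit) (- tm)). assert (H2 := Cinf_Wtame_Wloc _ (Cinf_const (I := unit) (-1)%C)).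
    assert (H3 := Cinf_Wtame_Wloc _ (Cinf_const (I := unit) (RtoC (cos arc)))). cinf_tac.
Qed.

Lemma smooth_bump : smooth_T1 (fun t => RtoC (bump t)).
Proof.
  apply smooth_T1_of_Cinf; [|apply Cinf_bump]. intros t. unfold bump. do 2 f_equal.
  replace (t + 2 * PI - tm) with (t - tm + 2 * PI) by ring. now rewrite cos_per.
Qed.

Lemma bump_per t : bump (t + 2 * PI) = bump t.
Proof. assert (H := proj1 smooth_bump t). now apply RtoC_inj in H. Qed.

Lemma mass_neq_0 : mass <> RtoC 0.
Proof.
  (* Multiplication by [i] moves the bump to the imaginary part, the one that [mean_pos] speaks
     of. *)
  intros H. apply (f_equal (fun z => snd ((0, 1) * z)%C)) in H.
  assert (HP := PI_RGT_0).
  assert (Hpos : 0 < snd (CInt (fun t => (0, bump t)%R) 0 (2 * PI))).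
  { apply (mean_pos (fun t => (0, bump t)%R)).
    - apply smooth_T1_of_Cinf.
      + intros t. now rewrite bump_per.
      + apply (Cinf_ext Wloc (fun _ t _ => (0, 1) * RtoC (bump t))%C).
        * intros; apply injective_projections; simpl; ring.
        * assert (H1 := Cinf_bump). assert (H2 := Cinf_Wtame_Wloc _ (Cinf_const (I := unit) (0, 1))). cinf_tac.
    - exists (tm + PI). simpl. unfold bump.
      replace (tm + PI - tm) with PI by ring. rewrite cos_PI.
      assert (hp : cos PI < cos arc) by (apply cos_decreasing_1; unfold arc; lra). rewrite cos_PI in hp.
      assert (hf := flat_pos 0 (cos arc - -1) ltac:(lra)). lra.
    - intros t. apply flat_nonneg. }
  simpl in H, Hpos. lra.
Qed.

Lemma smooth_corr f : smooth_T1 f -> smooth_T1 (corr f).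
Proof.
  intros Hf. apply smooth_T1_of_Cinf.
  - intros t. unfold corr. now rewrite (proj1 Hf), bump_per.
  - assert (H1 := Cinf_bump). assert (H2 := Cinf_Wtame_Wloc _ (smooth_T1_Cinf (I := unit) f Hf)).
    assert (H3 := Cinf_Wtame_Wloc _ (Cinf_const (I := unit) (- (CInt f 0 (2 * PI) / mass))%C)). unfold corr. cinf_tac.
Qed.

Lemma corr_mean f : smooth_T1 f -> CInt (corr f) 0 (2 * PI) = RtoC 0.
Proof.
  intros Hf. unfold corr. assert (H1 := smooth_ccont f Hf). assert (H2 := smooth_ccont _ smooth_bump).
  rewrite (CInt_plus f (fun t => - (CInt f 0 (2 * PI)%R / mass) * RtoC (bump t))%C); auto.
  - rewrite CInt_scal by auto. fold mass. field. apply mass_neq_0.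
  - apply (ccont_mult (fun _ => - (CInt f 0 (2 * PI)%R / mass))%C); auto using ccont_const.
Qed.

Lemma corr_eq f t : bump t = 0 -> corr f t = f t.
Proof. intros H. unfold corr. rewrite H. ring. Qed.

Lemma bump_zero t : cos arc <= cos (t - tm) -> bump t = 0.
Proof. intros; apply flat_neg. lra. Qed.

Variable c : R -> C.
Hypotheses (Hc : smooth_T1 c) (Hm : snd (c (tm - h)) < 0) (Hp : 0 < snd (c (tm + h))).

Definition Bcorr (t : R) : R := snd (CInt (corr c) 0 t).

Lemma Bcorr_derive t : is_derive Bcorr t (snd (corr c t)).
Proof. exact (proj2 (is_dC_CInt (corr c) 0 t (smooth_ccont _ (smooth_corr c Hc)))). Qed.

Lemma Bcorr_cont t : continuous Bcorr t.
Proof. exact (is_derive_cont _ _ _ (Bcorr_derive t)). Qed.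

Lemma Bcorr_per t : Bcorr (t + 2 * PI) = Bcorr t.
Proof. unfold Bcorr. rewrite (CInt_shift _ (smooth_corr c Hc)), corr_mean by auto. simpl. ring. Qed.

(** [Bcorr] decreases at [tm - h] and increases at [tm + h]; [descent_near] finds lower points
    inside the arc, so the minimum over it lies strictly below both endpoint values and is attained
    inside. *)
Lemma dip : exists ts beta eps eta, 0 < eps /\ tm - h < ts < tm + h /\ Bcorr ts <= beta - eps /\
  0 < eta /\ eta <= h /\ h + eta <= arc /\
  forall t, Rabs (t - (tm - h)) <= eta \/ Rabs (t - (tm + h)) <= eta -> beta + eps <= Bcorr t.
Proof.
  assert (HP := PI_RGT_0).
  assert (Hcos : cos arc <= cos h).
  { left. apply cos_decreasing_1; unfold arc; lra. }
  assert (D1 := Bcorr_derive (tm - h)). assert (D2 := Bcorr_derive (tm + h)).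
  rewrite corr_eq in D1, D2.
  2:{ apply bump_zero. replace (tm + h - tm) with h by ring. auto. }
  2:{ apply bump_zero. replace (tm - h - tm) with (- h) by ring. rewrite cos_neg. auto. }
  destruct (continuity_ab_min Bcorr (tm - h) (tm + h)) as [ts [Hmin Hts]]; [lra| |].
  { intros t _. apply continuity_pt_filterlim, Bcorr_cont. }
  destruct (descent_near _ _ _ (2 * h) D1 ltac:(nra)) as [z1 [Hz1 L1]].
  destruct (descent_near _ _ _ (- (2 * h)) D2 ltac:(nra)) as [z2 [Hz2 L2]].
  assert (M1 : Bcorr ts <= Bcorr (tm - h + z1 * (2 * h))) by (apply Hmin; split; nra).
  assert (M2 : Bcorr ts <= Bcorr (tm + h + z2 * - (2 * h))) by (apply Hmin; split; nra).
  set (m := Rmin (Bcorr (tm - h)) (Bcorr (tm + h)) - Bcorr ts).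
  assert (Hm0 : 0 < m) by (unfold m; apply Rlt_0_minus, Rmin_glb_lt; lra).
  assert (m1 : m <= Bcorr (tm - h) - Bcorr ts).
  { unfold m. assert (h1 := Rmin_l (Bcorr (tm - h)) (Bcorr (tm + h))). lra. }
  assert (m2 : m <= Bcorr (tm + h) - Bcorr ts).
  { unfold m. assert (h1 := Rmin_r (Bcorr (tm - h)) (Bcorr (tm + h))). lra. }
  destruct (cont_lower Bcorr (tm - h) (Bcorr ts + m / 2) (Bcorr_cont _) ltac:(lra)) as [d1 [P1 K1]].
  destruct (cont_lower Bcorr (tm + h) (Bcorr ts + m / 2) (Bcorr_cont _) ltac:(lra)) as [d2 [P2 K2]].
  (* With these values [beta - eps] is the minimum and [beta + eps] is the minimum plus [m / 2],
     which [cont_lower] guarantees near both ends. The last term of [eta] is [arc - h]. *)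
  exists ts, (Bcorr ts + m / 4), (m / 4), (Rmin (Rmin d1 d2) (Rmin h ((PI - h) / 2))).
  set (eta := Rmin _ _).
  assert (e1 : eta <= Rmin d1 d2) by apply Rmin_l. assert (e2 : eta <= Rmin h ((PI - h) / 2)) by apply Rmin_r.
  assert (e3 := Rmin_l d1 d2). assert (e4 := Rmin_r d1 d2).
  assert (e5 := Rmin_l h ((PI - h) / 2)). assert (e6 := Rmin_r h ((PI - h) / 2)).
  split; [lra|split; [|split; [lra|split; [|split; [lra|split; [unfold arc; lra|]]]]]].
  - destruct (Req_dec ts (tm - h)) as [E|E]; [rewrite E in M1; lra|].
    destruct (Req_dec ts (tm + h)) as [E'|E']; [rewrite E' in M2; lra|]. lra.
  - unfold eta. repeat apply Rmin_pos; lra.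
  - intros t [Ht|Ht].
    + assert (h1 := K1 t ltac:(lra)). lra.
    + assert (h1 := K2 t ltac:(lra)). lra.
Qed.

(** A steep [A] squeezes the transition zone of the cutoff into the [eta]-neighbourhoods of [tm - h]
    and [tm + h], where [Bcorr] is high, puts [ts] on the plateau, and leaves the support of [bump]
    where the cutoff is 0. The scale [d] is the smallest of the three gaps in the cosine. *)
Lemma cutoff_scale ts beta eps eta : tm - h < ts < tm + h -> 0 < eta -> eta <= h -> h + eta <= arc ->
  (forall t, Rabs (t - (tm - h)) <= eta \/ Rabs (t - (tm + h)) <= eta -> beta + eps <= Bcorr t) ->
  exists A, 0 < A /\ 1 <= A * (cos (ts - tm) - cos h) /\ forall t,
    (Rabs (A * (cos (t - tm) - cos h)) <= 1 -> beta + eps <= Bcorr t) /\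
    (-1 < A * (cos (t - tm) - cos h) -> bump t = 0).
Proof.
  intros Hts He1 He2 He3 HB. assert (HP := PI_RGT_0).
  assert (hh : arc < PI) by (unfold arc; lra).
  set (d1 := cos (h - eta) - cos h). set (d2 := cos h - cos (h + eta)). set (d3 := cos (ts - tm) - cos h).
  assert (P1 : 0 < d1) by (apply Rlt_0_minus, cos_decreasing_1; lra).
  assert (P2 : 0 < d2) by (apply Rlt_0_minus, cos_decreasing_1; lra).
  assert (P3 : 0 < d3).
  { apply Rlt_0_minus. destruct (Rle_dec 0 (ts - tm)).
    - apply cos_decreasing_1; lra.
    - rewrite <- (cos_neg (ts - tm)). apply cos_decreasing_1; lra. }
  set (d := Rmin d1 (Rmin d2 d3)).
  assert (P : 0 < d) by (unfold d; repeat apply Rmin_pos; auto).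
  assert (q1 : d <= d1) by apply Rmin_l. assert (q2 : d <= Rmin d2 d3) by apply Rmin_r.
  assert (q3 : d <= d2) by (eapply Rle_trans; [exact q2|apply Rmin_l]).
  assert (q4 : d <= d3) by (eapply Rle_trans; [exact q2|apply Rmin_r]).
  assert (Hi := Rinv_0_lt_compat d P).
  assert (Hdd : 2 / d * d = 2) by (field; lra).
  exists (2 / d). assert (HA : 0 < 2 / d) by (apply Rdiv_lt_0_compat; lra).
  split; [auto|split].
  - fold d3. nra.
  - intros t. set (Y := cos (t - tm) - cos h). split.
    + intros HY.
      assert (HYd : Rabs Y < d).
      { rewrite Rabs_mult, (Rabs_right (2 / d)) in HY by lra.
        apply Rmult_lt_reg_l with (2 / d); auto. lra. }
      (* Passing to the representative in [[-PI, PI)] and then to its absolute value [b] allows the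
         cosine to be inverted by monotonicity. *)
      set (a := modT (t - tm + PI) - PI). assert (Ha := modT_bounds (t - tm + PI)).
      assert (Hca : cos a = cos (t - tm)).
      { assert (E := periodic_modT (fun s => cos (s - PI))). cbv beta in E. unfold a. rewrite E.
        - f_equal; ring.
        - intros s. rewrite <- (cos_per (s - PI)). f_equal; ring. }
      assert (HBa : Bcorr t = Bcorr (a + tm)).
      { assert (E := periodic_modT (fun s => Bcorr (s - PI + tm))). cbv beta in E. unfold a. rewrite E.
        - f_equal; ring.
        - intros s. rewrite <- (Bcorr_per (s - PI + tm)). f_equal; ring. }
      assert (Hb : exists b, 0 <= b <= PI /\ cos b = cos a /\ (a = b \/ a = - b)).
      { destruct (Rle_dec 0 a); [exists a|exists (- a)]; rewrite ?cos_neg; unfold a in *; (split; [lra|split; [auto|lra]]). }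
      destruct Hb as [b [Hb1 [Hb2 Hb3]]].
      unfold Y in HYd. rewrite <- Hca, <- Hb2 in HYd. apply Rabs_lt_between in HYd.
      assert (Hbh : h - eta < b < h + eta).
      { split; apply Rnot_le_lt; intros hb.
        - assert (cos (h - eta) <= cos b) by (destruct (Req_dec b (h - eta)) as [->|]; [lra|left; apply cos_decreasing_1; lra]).
          unfold d1 in q1. lra.
        - assert (cos b <= cos (h + eta)) by (destruct (Req_dec b (h + eta)) as [->|]; [lra|left; apply cos_decreasing_1; lra]).
          unfold d2 in q3. lra. }
      rewrite HBa. apply HB. destruct Hb3 as [->| ->].
      * right. apply Rabs_le. lra.
      * left. apply Rabs_le. lra.
    + intros HY. apply bump_zero.
      assert (HYd : - d < Y).
      { apply Rmult_lt_reg_l with (2 / d); auto. replace (2 / d * - d) with (- (2 / d * d)) by ring. lra. }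
      assert (cos arc <= cos (h + eta)).
      { destruct (Req_dec (h + eta) arc) as [->|]; [lra|]. left. apply cos_decreasing_1; unfold arc in *; lra. }
      unfold Y in HYd. unfold d2 in q3. lra.
Qed.

End Dip.

Lemma sqrt_ge_abs x : Rabs x <= sqrt (1 + x ^ 2) <= 1 + Rabs x.
Proof.
  assert (hx := Rabs_pos x). split.
  - rewrite <- sqrt_Rsqr_abs. apply sqrt_le_1_alt. unfold Rsqr; nra.
  - rewrite <- (sqrt_pow2 (1 + Rabs x)) by lra. apply sqrt_le_1_alt. rewrite <- (pow2_abs x). nra.
Qed.

(** A smooth substitute for [|x|]. The induction is run on the reciprocal, whose derivative is [- x]
    times its cube; the root itself is [1 + x ^ 2] times the reciprocal. *)
Lemma Cinf_sqrt {I} : Cinf Wtame (fun (_ : I) _ x => RtoC (sqrt (1 + x ^ 2))).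
Proof.
  assert (Hpos : forall x, 0 < sqrt (1 + x ^ 2)) by (intros x; apply sqrt_lt_R0; assert (h := pow2_ge_0 x); lra).
  assert (Hr : Cinf Wtame (fun (_ : I) _ x => RtoC (/ sqrt (1 + x ^ 2)))).
  { intros n. assert (HW : Wtame (fun (_ : I) (_ : R) x => RtoC (/ sqrt (1 + x ^ 2)))).
    { intros T. exists 1, O. intros i t x _. rewrite Cmod_R. rewrite pow_O, Rmult_1_r.
      assert (h := Hpos x). rewrite Rabs_right by (apply Rle_ge; left; now apply Rinv_0_lt_compat).
      apply Rmult_le_reg_r with (sqrt (1 + x ^ 2)); [auto|]. rewrite Rinv_l, Rmult_1_l by lra.
      assert (h2 := pow2_ge_0 x). assert (h3 := sqrt_le_1_alt 1 (1 + x ^ 2)). rewrite sqrt_1 in h3. lra. }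
    induction n; [split; auto|].
    apply (Cn_intro Wtame n _ (fun _ _ _ => RtoC 0)
      (fun _ _ x => (RtoC (-1) * RtoC x) * (RtoC (/ sqrt (1 + x ^ 2)) * (RtoC (/ sqrt (1 + x ^ 2)) * RtoC (/ sqrt (1 + x ^ 2)))))%C); auto.
    - intros; apply is_dC_const.
    - intros i t x. rewrite <- !RtoC_mult. apply is_dC_RtoC. assert (h := Hpos x).
      assert (hs : sqrt (1 + x * (x * 1)) * sqrt (1 + x * (x * 1)) = 1 + x * (x * 1)) by (apply sqrt_sqrt; nra).
      simpl in h |- *. auto_derive; [split; [nra|split; auto; lra]|].
      field. lra.
    - apply (Cinf_const (RtoC 0)).
    - apply (Cn_mul Wtame Wtame Wtame n (fun _ _ x => RtoC (-1) * RtoC x)%C _ Wtame_add Wtame_mul).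
      + assert (HH : Cinf Wtame (fun (_ : I) (_ : R) x => RtoC (-1) * RtoC x)%C) by cinf_tac. apply HH.
      + apply (Cn_mul Wtame Wtame Wtame n _ _ Wtame_add Wtame_mul IHn). apply (Cn_mul Wtame Wtame Wtame n _ _ Wtame_add Wtame_mul IHn IHn). }
  apply (Cinf_ext Wtame (fun _ _ x => (RtoC 1 + RtoC x * RtoC x) * RtoC (/ sqrt (1 + x ^ 2)))%C).
  - intros i t x. rewrite <- RtoC_mult, <- RtoC_plus, <- RtoC_mult. f_equal. assert (h := Hpos x).
    apply Rmult_eq_reg_r with (sqrt (1 + x ^ 2)); [|lra].
    rewrite sqrt_sqrt by (assert (h2 := pow2_ge_0 x); lra). field. lra.
  - cinf_tac.
Qed.

Lemma Cinf_coef {I} (a : I -> C) M : (forall i, Cmod (a i) <= M) -> Cinf Wtame (fun i _ _ => a i).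
Proof.
  intros H. apply (Cinf_intro Wtame _ (fun _ _ _ => RtoC 0) (fun _ _ _ => RtoC 0)); try apply Cinf_const.
  - intros T. exists M, O. intros. simpl. rewrite Rmult_1_r. auto.
  - intros; apply is_dC_const.
  - intros; apply is_dC_const.
Qed.

Lemma per_bounded (f : R -> R) : (forall t, f (t + 2 * PI) = f t) -> (forall t, continuous f t) ->
  exists M, 0 <= M /\ forall t, Rabs (f t) <= M.
Proof.
  intros Hp Hc. assert (HP := PI_RGT_0). destruct (cont_bounded f 0 (2 * PI) Hc) as [M K]. exists M. split.
  - eapply Rle_trans; [apply Rabs_pos|apply (K 0); lra].
  - intros t. rewrite <- (periodic_modT f Hp t). apply K. assert (h := modT_bounds t). lra.
Qed.

(** * The counterexample *)

Section Necessity.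
Variables (c q : R -> C) (tm h : R).
Hypotheses (Hc : smooth_T1 c) (Hq : smooth_T1 q) (Hh : 0 < h < PI).

Let c' := corr tm h c.
Let q' := corr tm h q.

Lemma smooth_corr_c : smooth_T1 c'.
Proof. now apply smooth_corr. Qed.

Lemma smooth_corr_q : smooth_T1 q'.
Proof. now apply smooth_corr. Qed.

Lemma Lam_corr_per t xi : Lam c' q' (t + 2 * PI) xi = Lam c' q' t xi.
Proof.
  rewrite (Lam_shift c' q' smooth_corr_c smooth_corr_q). unfold Lam at 2. unfold c', q'. rewrite !corr_mean by auto. ring.
Qed.

(** The quantity [sqrt (1 + xi ^ 2) + xi] lies between 0 and 1 for [xi <= 0] and is at least [2 xi]
    for [xi > 0]: it is a smooth penalty that acts on positive frequencies and leaves the growth at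
    negative ones intact. *)
Definition expo (K beta d t xi : R) : C :=
  (- Lam c' q' t xi + RtoC (- (beta * xi) - K * (sqrt (1 + xi ^ 2) + xi) - d * xi ^ 2))%C.

Lemma Re_expo K beta d t xi : fst (expo K beta d t xi) =
  xi * (Bcorr tm h c t - beta) - fst (CInt q' 0 t) - K * (sqrt (1 + xi ^ 2) + xi) - d * xi ^ 2.
Proof.
  unfold expo. change (fst (- Lam c' q' t xi + RtoC (- (beta * xi) - K * (sqrt (1 + xi ^ 2) + xi) - d * xi ^ 2))%C)
    with (- fst (Lam c' q' t xi) + (- (beta * xi) - K * (sqrt (1 + xi ^ 2) + xi) - d * xi ^ 2)).
  rewrite Re_Lam. unfold Bcorr. fold c'. ring.
Qed.

Lemma Cinf_expo {I} K beta d : Cinf Wtame (fun (_ : I) t xi => expo K beta d t xi).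
Proof.
  apply (Cinf_ext Wtame (fun _ t xi => RtoC (-1) * Lam c' q' t xi + (RtoC (- beta - K) * RtoC xi +
     (RtoC (- K) * RtoC (sqrt (1 + xi ^ 2)) + RtoC (- d) * (RtoC xi * RtoC xi))))%C).
  - intros i t x. unfold expo.
    replace (- (beta * x) - K * (sqrt (1 + x ^ 2) + x) - d * x ^ 2) with
      ((- beta - K) * x + (- K * sqrt (1 + x ^ 2) + - d * (x * x))) by ring.
    rewrite !RtoC_plus, !RtoC_mult. ring.
  - assert (H1 := Cinf_Lam c' q' smooth_corr_c smooth_corr_q (I := I)). assert (H2 := Cinf_sqrt (I := I)). cinf_tac.
Qed.

Lemma is_dC_expo K beta d t xi : is_dC (fun t => expo K beta d t xi) t (- lam c' q' t xi)%C.
Proof.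
  unfold expo. eapply is_dC_eq; [apply is_dC_plus; [apply is_dC_opp, (is_dC_Lam c' q' smooth_corr_c smooth_corr_q)|apply is_dC_const]|ring].
Qed.

Variable A : R.
Hypothesis HA : 0 < A.

Definition profile (t : R) : R := A * (cos (t - tm) - cos h).
Definition rho (t : R) : C := RtoC (step (profile t)).

Lemma Cinf_rho {I} : Cinf Wloc (fun (_ : I) t (_ : R) => rho t).
Proof.
  apply (Cinf_compose (fun x => RtoC (step x)) (fun (_ : I) t _ => profile t)); [apply Cinf_step|].
  apply (Cinf_ext Wloc (fun _ t _ => RtoC A * RtoC (cos (t + - tm)) + RtoC (- A * cos h))%C).
  - intros i t x. unfold profile. rewrite <- RtoC_mult, <- RtoC_plus. f_equal.
    replace (t + - tm) with (t - tm) by ring. ring.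
  - assert (H1 := Cinf_cos (I := I) (- tm)). assert (H2 := Cinf_Wtame_Wloc _ (Cinf_const (I := I) (RtoC A))).
    assert (H3 := Cinf_Wtame_Wloc _ (Cinf_const (I := I) (RtoC (- A * cos h)))). cinf_tac.
Qed.

Lemma rho_per t : rho (t + 2 * PI) = rho t.
Proof.
  unfold rho, profile. do 2 f_equal. replace (t + 2 * PI - tm) with (t - tm + 2 * PI) by ring. now rewrite cos_per.
Qed.

Definition Dset (t : R) : Prop := Rabs (profile t) <= 1.

Lemma profile_cont t : continuous profile t.
Proof. apply (ex_derive_continuous profile). unfold profile. auto_derive; auto. Qed.

Lemma Dset_closed t : ~ Dset t -> locally t (fun s => ~ Dset s).
Proof.
  intros Ht. assert (H1 : 1 < Rabs (profile t)) by (apply Rnot_le_lt, Ht).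
  assert (Hco : continuous (fun t => Rabs (profile t)) t) by (apply (continuous_comp profile Rabs); [apply profile_cont|apply continuous_Rabs]).
  eapply filter_imp; [|apply (Hco (fun y => 1 < y)); exact (open_gt 1 _ H1)].
  intros s Hs hD. unfold Dset in hD. lra.
Qed.

Definition rho1 (t : R) : C := dC rho t.

Lemma is_dC_rho t : is_dC rho t (rho1 t).
Proof. exact (Cinf_is_dC_t _ _ tt t 0 Cinf_rho). Qed.

Lemma rho1_zero t : ~ Dset t -> rho1 t = RtoC 0.
Proof.
  intros Ht. apply dC_is_dC. assert (H1 : 1 < Rabs (profile t)) by (apply Rnot_le_lt, Ht).
  assert (Hl : exists k : C, locally t (fun s => k = rho s)).
  { destruct (Rle_dec 0 (profile t)) as [hy|hy].
    - rewrite Rabs_right in H1 by lra. exists (RtoC 1).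
      eapply filter_imp; [|apply (profile_cont t (fun y => 1 < y)); exact (open_gt 1 _ H1)].
      intros s Hs. unfold rho. rewrite step_high by (left; exact Hs). reflexivity.
    - rewrite Rabs_left in H1 by lra. exists (RtoC 0).
      eapply filter_imp; [|apply (profile_cont t (fun y => y < -1)); apply (open_lt (-1)); lra].
      intros s Hs. unfold rho. rewrite step_low by (left; exact Hs). reflexivity. }
  destruct Hl as [k Hk].
  split; simpl; [apply is_derive_ext_loc with (fun _ => fst k)|apply is_derive_ext_loc with (fun _ => snd k)];
    try apply is_derive_Rconst; (eapply filter_imp; [|exact Hk]); intros s Hs; first [exact (f_equal fst Hs)|exact (f_equal snd Hs)].
Qed.

Lemma Cinf_rho1 {I} : Cinf (Wsupp Dset) (fun (_ : I) t (_ : R) => rho1 t).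
Proof.
  apply Cinf_xfree_supp.
  - apply Dset_closed.
  - exact (Cinf_Dt _ _ Cinf_rho).
  - intros i t x y; reflexivity.
  - intros i t x Ht. now apply rho1_zero.
Qed.

Lemma rho1_per t : rho1 (t + 2 * PI) = rho1 t.
Proof.
  symmetry. unfold rho1. transitivity (dC (fun s => rho (s + 2 * PI)) t).
  - f_equal. apply functional_extensionality; intros; now rewrite rho_per.
  - apply dC_is_dC. apply is_dC_shift. apply is_dC_rho.
Qed.

Variables (K beta : R).

(** [uhat 0] blows up exponentially at the dip of [Bcorr] as [xi] tends to minus infinity, while
    its image [Fhat 0] decays, because [rho1] is supported where [Bcorr] exceeds [beta]. The term in
    [K] takes care of positive frequencies, and [d > 0] is a Gaussian regularization. *)
Definition Fhat (d t xi : R) : C := (rho1 t * cexp (expo K beta d t xi))%C.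
Definition uhat (d t xi : R) : C := (rho t * cexp (expo K beta d t xi))%C.

Lemma expo_per d t xi : expo K beta d (t + 2 * PI) xi = expo K beta d t xi.
Proof. unfold expo. now rewrite Lam_corr_per. Qed.

Lemma Fhat_per d : periodic2 (Fhat d).
Proof. intros t xi. unfold Fhat. now rewrite rho1_per, expo_per. Qed.

Lemma uhat_per d : periodic2 (uhat d).
Proof. intros t xi. unfold uhat. now rewrite rho_per, expo_per. Qed.

Hypothesis Hbump : forall t, -1 < profile t -> bump tm h t = 0.

(** The exponential solves the homogeneous equation with corrected coefficients; these agree with
    [c] and [q] wherever the cutoff is nonzero, so the only source left is the derivative of the
    cutoff. *)
Lemma uhat_sol d xi : is_sol c q xi (fun t => uhat d t xi) (fun t => Fhat d t xi).
Proof.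
  intros t. unfold uhat, Fhat. eapply is_dC_eq.
  - apply is_dC_mult; [apply is_dC_rho|apply is_dC_cexp, is_dC_expo].
  - cbv beta.
    assert (E : (rho t * lam c' q' t xi)%C = (rho t * lam c q t xi)%C).
    { destruct (Rlt_dec (-1) (profile t)) as [hy|hy].
      - unfold lam, c', q'. rewrite !corr_eq by now apply Hbump. reflexivity.
      - unfold rho. rewrite step_low by lra. ring. }
    replace (rho t * (- lam c' q' t xi * cexp (expo K beta d t xi)))%C with
      (- (rho t * lam c' q' t xi) * cexp (expo K beta d t xi))%C by ring.
    rewrite E. ring.
Qed.

Variables (A0 Bm eps : R).
Hypotheses (HA0 : forall t, Rabs (fst (CInt q' 0 t)) <= A0) (HBm : forall t, Rabs (Bcorr tm h c t - beta) <= Bm)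
  (HK : K = Bm + 1) (Heps : 0 < eps) (HD : forall t, Dset t -> beta + eps <= Bcorr tm h c t).

Lemma Bm_pos : 0 <= Bm.
Proof. eapply Rle_trans; [apply Rabs_pos|apply (HBm 0)]. Qed.

Lemma Re_expo_upper d t xi : fst (expo K beta d t xi) <= A0 + Bm * Rabs xi - d * xi ^ 2.
Proof.
  rewrite Re_expo. assert (h1 := HA0 t). apply Rabs_le_between in h1.
  assert (h2 := sqrt_ge_abs xi). assert (h3 := Rle_abs (- xi)). rewrite Rabs_Ropp in h3.
  assert (h4 := Bm_pos).
  assert (xi * (Bcorr tm h c t - beta) <= Bm * Rabs xi).
  { eapply Rle_trans; [apply Rle_abs|]. rewrite Rabs_mult. rewrite Rmult_comm.
    apply Rmult_le_compat_r; auto. apply Rabs_pos. }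
  assert (0 <= K * (sqrt (1 + xi ^ 2) + xi)) by (apply Rmult_le_pos; lra). lra.
Qed.

(** For [xi <= 0] the decay comes from [Bcorr >= beta + eps]; for [xi > 0] the penalty subtracts at
    least [2 (Bm + 1) xi], against a growth of at most [Bm xi]. *)
Lemma Re_expo_D t xi : Dset t -> fst (expo K beta 0 t xi) <= A0 - Rmin eps 1 * Rabs xi.
Proof.
  intros Ht. rewrite Re_expo. assert (h1 := HA0 t). apply Rabs_le_between in h1.
  assert (h2 := sqrt_ge_abs xi). assert (h4 := Bm_pos). assert (h5 := HD t Ht).
  assert (h6 := HBm t). apply Rabs_le_between in h6.
  assert (e1 := Rmin_l eps 1). assert (e2 := Rmin_r eps 1).
  rewrite HK. destruct (Rle_dec xi 0) as [hx|hx].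
  - rewrite Rabs_left1 in * by auto. assert (0 <= (Bm + 1) * (sqrt (1 + xi ^ 2) + xi)) by (apply Rmult_le_pos; lra).
    assert (xi * (Bcorr tm h c t - beta) <= xi * Rmin eps 1) by nra. lra.
  - rewrite Rabs_right in * by lra.
    assert ((Bm + 1) * (xi + xi) <= (Bm + 1) * (sqrt (1 + xi ^ 2) + xi)) by (apply Rmult_le_compat_l; lra).
    assert (xi * (Bcorr tm h c t - beta) <= xi * Bm) by (apply Rmult_le_compat_l; lra).
    assert (Rmin eps 1 * xi <= 1 * xi) by (apply Rmult_le_compat_r; lra).
    assert (0 <= Bm * xi) by (apply Rmult_le_pos; lra).
    lra.
Qed.

Lemma decay_of_linear e a k : 0 < e -> exists M, forall x y, y <= a - e * Rabs x -> (1 + Rabs x) ^ k * exp y <= M.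
Proof.
  intros He. destruct (poly_exp k e He) as [M KM]. exists (exp a * M). intros x y Hy.
  assert (hw := wpow_ge1 x k).
  apply Rle_trans with ((1 + Rabs x) ^ k * exp (a + - (e * Rabs x))).
  - apply Rmult_le_compat_l; [lra|]. apply exp_le. lra.
  - rewrite exp_plus. replace ((1 + Rabs x) ^ k * (exp a * exp (- (e * Rabs x)))) with
      (exp a * ((1 + Rabs x) ^ k * exp (- (e * Rabs x)))) by ring.
    apply Rmult_le_compat_l; [left; apply exp_pos|apply KM].
Qed.

Lemma Cinf_Fhat {I} : Cinf Wrapid (fun (_ : I) t xi => Fhat 0 t xi).
Proof.
  apply (Cinf_mul (Wsupp Dset) (Wrapid_on Dset) Wrapid (fun _ t _ => rho1 t) (fun _ t xi => cexp (expo K beta 0 t xi)) Wrapid_add (Wsupp_Wrapid_on Dset)).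
  - apply Cinf_rho1.
  - apply (Cinf_exp Wtame (Wrapid_on Dset) (fun _ t xi => expo K beta 0 t xi) (Wrapid_on_add Dset) (Wtame_Wrapid_on Dset)).
    + apply Cinf_expo.
    + intros T k. assert (he : 0 < Rmin eps 1) by (apply Rmin_pos; lra).
      destruct (decay_of_linear (Rmin eps 1) A0 k he) as [M KM]. exists M. intros i t xi _ Ht.
      rewrite Cmod_cexp. apply KM. now apply Re_expo_D.
Qed.

Lemma Cinf_uhat d : 0 < d -> Cinf Wrapid (fun (_ : unit) t xi => uhat d t xi).
Proof.
  intros Hd.
  apply (Cinf_tame_rapid (fun _ t _ => rho t) (fun _ t xi => cexp (expo K beta d t xi))).
  - apply Cinf_xfree; [apply Cinf_rho|intros i t x y; reflexivity].
  - apply (Cinf_exp Wtame Wrapid (fun _ t xi => expo K beta d t xi) Wrapid_add Wtame_Wrapid).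
    + apply Cinf_expo.
    (* The constant comes from completing the square in [(Bm + 1) |xi| - d xi ^ 2], which leaves the
       decay [- |xi|]. *)
    + intros T k. destruct (decay_of_linear 1 (A0 + (Bm + 1) ^ 2 / (4 * d)) k ltac:(lra)) as [M KM].
      exists M. intros i t xi _. rewrite Cmod_cexp. apply KM.
      eapply Rle_trans; [apply Re_expo_upper|].
      assert (0 <= d * (Rabs xi - (Bm + 1) / (2 * d)) ^ 2) by (apply Rmult_le_pos; [lra|apply pow2_ge_0]).
      rewrite <- (pow2_abs xi).
      assert (d * (Rabs xi - (Bm + 1) / (2 * d)) ^ 2 = d * Rabs xi ^ 2 - (Bm + 1) * Rabs xi + (Bm + 1) ^ 2 / (4 * d))
        by (field; lra). lra.
Qed.

Definition f_bad : R -> R -> C := FT 1 (fun (_ : unit) t xi => Fhat 0 t xi) tt.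

Lemma schwartz_f_bad : schwartz f_bad.
Proof. apply FT_schwartz; [ring|apply Fhat_per|apply Cinf_Fhat]. Qed.

Definition delta (n : nat) : R := / (INR n + 1).

Lemma delta_pos n : 0 < delta n <= 1.
Proof.
  assert (hn := pos_INR n). unfold delta. split; [apply Rinv_0_lt_compat; lra|].
  rewrite <- Rinv_1 at 2. apply Rinv_le_contravar; lra.
Qed.

(** Difference quotient at [0] of the Gaussian regularization. *)
Definition mfun (n : nat) (xi : R) : R := (exp (- (delta n * xi ^ 2)) - 1) / delta n.

(** The bounds must not see the division by [delta n]: [1 - exp (- y) <= y] gives
    [|mfun n xi| <= xi ^ 2], and in the derivative [-2 xi exp (- delta n xi ^ 2)] the factor
    cancels. *)
Lemma Cinf_mfun : Cinf Wtame (fun n _ xi => RtoC (mfun n xi)).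
Proof.
  assert (He : Cinf Wtame (fun n (_ : R) xi => RtoC (-2) * (RtoC xi * cexp (RtoC (- delta n) * (RtoC xi * RtoC xi))))%C).
  { assert (Hg : Cinf Wtame (fun n (_ : R) xi => RtoC (- delta n) * (RtoC xi * RtoC xi))%C).
    { assert (H1 : Cinf Wtame (fun n (_ _ : R) => RtoC (- delta n))).
      { apply (Cinf_coef (fun n => RtoC (- delta n)) 1). intros n. rewrite Cmod_R, Rabs_Ropp.
        assert (hd := delta_pos n). rewrite Rabs_right; lra. }
      cinf_tac. }
    assert (H2 : Cinf Wtame (fun n (_ : R) xi => cexp (RtoC (- delta n) * (RtoC xi * RtoC xi)))).
    { apply (Cinf_exp Wtame Wtame (fun n (_ : R) xi => RtoC (- delta n) * (RtoC xi * RtoC xi))%C Wtame_add Wtame_mul); auto.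
      intros T. exists 1, O. intros n t xi _. rewrite Cmod_cexp. simpl. rewrite Rmult_1_r, <- exp_0.
      apply exp_le. assert (hd := delta_pos n). nra. }
    cinf_tac. }
  apply (Cinf_intro Wtame _ (fun _ _ _ => RtoC 0)
     (fun n (_ : R) xi => RtoC (-2) * (RtoC xi * cexp (RtoC (- delta n) * (RtoC xi * RtoC xi))))%C); auto using Cinf_const.
  - intros T. exists 1, 2%nat. intros n t xi _. rewrite Cmod_R. unfold mfun.
    assert (hd := delta_pos n).
    assert (h1 : exp (- (delta n * xi ^ 2)) <= 1) by (rewrite <- exp_0; apply exp_le; nra).
    assert (h2 := exp_ineq1_le (- (delta n * xi ^ 2))).
    unfold Rdiv. rewrite Rabs_mult, Rabs_inv, (Rabs_right (delta n)) by lra. rewrite Rabs_left1 by lra.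
    apply Rmult_le_reg_r with (delta n); [lra|]. rewrite Rmult_assoc, Rinv_l, Rmult_1_r by lra.
    assert (hx := Rabs_pos xi). rewrite <- (pow2_abs xi) in *. nra.
  - intros; apply is_dC_const.
  - intros n t xi. assert (hd := delta_pos n).
    assert (E : cexp (RtoC (- delta n) * (RtoC xi * RtoC xi)) = RtoC (exp (- (delta n * xi ^ 2)))).
    { rewrite <- !RtoC_mult. unfold cexp; simpl. rewrite cos_0, sin_0.
      replace (- delta n * (xi * xi)) with (- (delta n * (xi * (xi * 1)))) by ring.
      apply injective_projections; simpl; ring. }
    rewrite E, <- !RtoC_mult. apply is_dC_RtoC. unfold mfun. auto_derive; [lra|].
    simpl. field. lra.
Qed.

Lemma Fhat_delta n t xi :
  (Fhat 0 t xi + RtoC (delta n) * (RtoC (mfun n xi) * Fhat 0 t xi))%C = Fhat (delta n) t xi.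
Proof.
  assert (hd := delta_pos n).
  assert (E : cexp (expo K beta (delta n) t xi) = (RtoC (exp (- (delta n * xi ^ 2))) * cexp (expo K beta 0 t xi))%C).
  { replace (RtoC (exp (- (delta n * xi ^ 2)))) with (cexp (RtoC (- (delta n * xi ^ 2)))).
    - rewrite <- cexp_plus. f_equal. unfold expo.
      replace (- (beta * xi) - K * (sqrt (1 + xi ^ 2) + xi) - delta n * xi ^ 2) with
       (- (delta n * xi ^ 2) + (- (beta * xi) - K * (sqrt (1 + xi ^ 2) + xi) - 0 * xi ^ 2)) by ring.
      rewrite RtoC_plus. ring.
    - unfold cexp. simpl. rewrite cos_0, sin_0. apply injective_projections; simpl; ring. }
  unfold Fhat. rewrite E. unfold mfun.
  rewrite RtoC_div, RtoC_minus by lra. field.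
  intros h0. apply RtoC_inj in h0. lra.
Qed.

(** For positive [d] the function [uhat d] decays rapidly, so its inverse transform is Schwartz and
    its image under [L] is killed by every element of the kernel. These images are
    [f_bad + delta n H_n] with [H_n] bounded, and [tempered_limit] concludes. *)
Lemma annih_f_bad : in_annih c q f_bad.
Proof.
  split; [apply schwartz_f_bad|].
  intros v [Hv Hker].
  set (Hh' := fun n t xi => (RtoC (mfun n xi) * Fhat 0 t xi)%C).
  assert (HH : Cinf Wrapid Hh').
  { exact (Cinf_tame_rapid (fun n _ xi => RtoC (mfun n xi)) (fun n t xi => Fhat 0 t xi) Cinf_mfun Cinf_Fhat). }
  apply (tempered_limit v f_bad (FT 1 Hh')); auto.
  - apply schwartz_f_bad.
  - apply Cinf_FT; [ring|auto].
  - intros n t x. unfold FT. apply CIntR_ext. intros xi. unfold Hh'. now rewrite Fhat_per.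
  - intros n. fold (delta n). assert (hd := delta_pos n).
    set (V := fun (_ : unit) t xi => uhat (delta n) t xi).
    assert (HV : Cinf Wrapid V) by (apply Cinf_uhat; lra).
    assert (HVs : schwartz (FT 1 V tt)) by (apply FT_schwartz; [ring|apply uhat_per|auto]).
    assert (E : (fun t x => f_bad t x + RtoC (delta n) * FT 1 Hh' n t x)%C = Lop c q (FT 1 V tt)).
    { fext2. rewrite (Lop_FT c q Hc Hq) by auto.
      set (Hn := fun (_ : unit) t xi => Hh' n t xi).
      assert (HHn : Cinf Wrapid Hn).
      { exact (Cinf_reindex n Hh' HH). }
      change (FT 1 Hh' n t x) with (FT 1 Hn tt t x). unfold f_bad.
      rewrite <- (FT_scal 1 (fun _ _ => RtoC (delta n))) by auto.
      rewrite <- FT_plus; [|apply Cinf_Fhat|].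
      - f_equal. fext3. unfold Hn, Hh'. rewrite Fhat_delta.
        assert (E := dC_is_dC _ _ _ (uhat_sol (delta n) x0 t0)).
        change (Dt V i t0 x0) with (dC (fun t => uhat (delta n) t x0) t0). rewrite E. unfold V. ring.
      - exact (Cinf_tame_rapid (fun _ _ _ => RtoC (delta n)) Hn (Cinf_const _) HHn). }
    rewrite E. split; [|now apply Hker].
    apply Cinf_schwartz.
    + intros t x. rewrite <- E.
      assert (P1 : f_bad (t + 2 * PI) x = f_bad t x) by apply (proj1 schwartz_f_bad).
      assert (P2 : FT 1 Hh' n (t + 2 * PI) x = FT 1 Hh' n t x).
      { unfold FT. apply CIntR_ext. intros xi. unfold Hh'. now rewrite Fhat_per. }
      now rewrite P1, P2.
    + apply Cinf_Lop; auto. now apply schwartz_Cinf.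
Qed.

Variable ts : R.
Hypotheses (Hts1 : 1 <= profile ts) (Hts2 : Bcorr tm h c ts <= beta - eps).

(** At a non-resonant frequency the transform of any solution equals [inv_const * uhat 0], and at
    [ts] this is unbounded along frequencies tending to minus infinity. *)
Lemma not_solvable_core : avg c <> RtoC 0 \/ ~ in_iZ (avg q) -> ~ schwartz_globally_solvable c q.
Proof.
  intros Hor Hsol. destruct (Hsol f_bad annih_f_bad) as [u [Hu Eu]].
  assert (HS := schwartz_Cinf u Hu). set (U := FT (-1) (lift u)).
  assert (HU : Cinf Wrapid U) by (apply Cinf_FT; auto; ring).
  destruct (Cinf_W _ _ HU (Rabs ts) O) as [M KM].
  assert (HC0 : 0 < Cmod inv_const) by (apply Cmod_gt_0, inv_const_neq_0).
  assert (hB := Bm_pos).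
  (* The threshold makes the exponent [y], at least [- xi eps - A0 - K], exceed
     [M / |inv_const| + 1]; then [exp y >= 1 + y] contradicts the bound [M] on the transform. *)
  destruct (monodromy_neq_1 c q Hor (Rmin 0 (- ((M / Cmod inv_const + A0 + K + 1) / eps)))) as [xi [Hxi HE]].
  assert (Hx0 : xi < 0) by (eapply Rlt_le_trans; [exact Hxi|apply Rmin_l]).
  assert (Hx1 : xi < - ((M / Cmod inv_const + A0 + K + 1) / eps)) by (eapply Rlt_le_trans; [exact Hxi|apply Rmin_r]).
  assert (EF : lift (Lop c q u) = FT 1 (fun (_ : unit) t xi => Fhat 0 t xi)).
  { apply functional_extensionality; intros []. unfold lift. fext2. apply Eu. }
  assert (S1 : is_sol c q xi (fun t => U tt t xi) (fun t => (inv_const * Fhat 0 t xi)%C)).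
  { intros t. eapply is_dC_eq; [exact (Cinf_is_dC_t _ _ tt t xi HU)|].
    assert (E1 := FT_Lop c q Hc Hq u t xi HS). rewrite EF in E1.
    assert (E2 := FT_inversion 1 (fun (_ : unit) t xi => Fhat 0 t xi) tt t xi ltac:(ring) Cinf_Fhat).
    replace (- (1)) with (-1) in E2 by ring.
    rewrite E2 in E1. fold U in E1. rewrite E1. ring. }
  assert (S2 : is_sol c q xi (fun t => (inv_const * uhat 0 t xi)%C) (fun t => (inv_const * Fhat 0 t xi)%C)).
  { intros t. eapply is_dC_eq; [apply is_dC_scal, uhat_sol|cbv beta; ring]. }
  assert (EU := sol_periodic_unique c q Hc Hq xi _ _ _ S1 S2
    (fun t => CIntR_ext _ _ (fun x => f_equal (fun z => (z * eix (-1) x xi)%C) (proj1 Hu t x)))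
    (fun t => f_equal (Cmult inv_const) (uhat_per 0 t xi)) HE ts).
  cbv beta in EU.
  specialize (KM tt ts xi ltac:(lra)). rewrite EU in KM. simpl in KM. rewrite Rmult_1_l in KM.
  unfold uhat in KM. unfold rho in KM. rewrite step_high in KM by auto.
  rewrite !Cmod_mult, Cmod_1, Cmod_cexp, Rmult_1_l, Re_expo in KM.
  set (y := _ - 0 * xi ^ 2) in KM.
  assert (Hy : - xi * eps - A0 - K <= y).
  { unfold y. assert (h1 := HA0 ts). apply Rabs_le_between in h1.
    assert (h2 := sqrt_ge_abs xi). rewrite Rabs_left in h2 by auto.
    assert (K * (sqrt (1 + xi ^ 2) + xi) <= K * 1) by (apply Rmult_le_compat_l; lra).
    assert (- xi * eps <= - xi * (beta - Bcorr tm h c ts)) by (apply Rmult_le_compat_l; lra). lra. }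
  assert (He := exp_ineq1_le y).
  assert (H1 : (M / Cmod inv_const + A0 + K + 1) < - xi * eps).
  { apply Rmult_lt_reg_r with (/ eps); [now apply Rinv_0_lt_compat|].
    rewrite Rmult_assoc, Rinv_r, Rmult_1_r by lra. unfold Rdiv in Hx1 at 1. lra. }
  assert (H2 : M / Cmod inv_const < exp y) by lra.
  apply (Rmult_lt_compat_l (Cmod inv_const)) in H2; auto.
  replace (Cmod inv_const * (M / Cmod inv_const)) with M in H2 by (field; lra). lra.
Qed.

End Necessity.

Lemma not_solvable_sign_change c q : smooth_T1 c -> smooth_T1 q ->
  (exists t, snd (c t) < 0) -> (exists t, 0 < snd (c t)) -> avg c <> RtoC 0 \/ ~ in_iZ (avg q) ->
  ~ schwartz_globally_solvable c q.
Proof.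
  intros Hc Hq [s1 H1] [s2 H2] Hor. assert (HP := PI_RGT_0).
  (* The point where [b] is positive is moved by periods to within one period to the right of [s1];
     the dip is sought on the arc between them, with midpoint [tm] and half-length [h]. *)
  set (s := modT (s2 - s1)). assert (Hs := modT_bounds (s2 - s1)). fold s in Hs.
  assert (E : c (s + s1) = c s2).
  { assert (E := periodic_modT (fun t => c (t + s1))). cbv beta in E. unfold s. rewrite E.
    - f_equal; ring.
    - intros t. rewrite <- (proj1 Hc (t + s1)). f_equal; ring. }
  rewrite <- E in H2.
  assert (Hs0 : 0 < s).
  { destruct (Req_dec s 0) as [h|h]; [|lra]. rewrite h, Rplus_0_l in H2. lra. }
  set (h := s / 2). set (tm := s1 + h).
  assert (Hh : 0 < h < PI) by (unfold h; lra).
  assert (Hm : snd (c (tm - h)) < 0) by (unfold tm; replace (s1 + h - h) with s1 by ring; auto).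
  assert (Hp : 0 < snd (c (tm + h))) by (unfold tm, h; replace (s1 + s / 2 + s / 2) with (s + s1) by field; auto).
  destruct (dip tm h Hh c Hc Hm Hp) as [ts [beta [eps [eta [He [Hts [HB [Heta [Heta1 [Heta2 Hn]]]]]]]]]].
  destruct (cutoff_scale tm h Hh c Hc ts beta eps eta Hts Heta Heta1 Heta2 Hn) as [A [HA [HA1 HA2]]].
  destruct (per_bounded (fun t => fst (CInt (corr tm h q) 0 t))) as [A0 [_ HA0]].
  { intros t. rewrite (CInt_shift _ (smooth_corr tm h q Hq)), corr_mean by auto. simpl. ring. }
  { intros t. exact (proj1 (is_dC_cont _ _ _ (is_dC_CInt _ 0 t (smooth_ccont _ (smooth_corr tm h q Hq))))). }
  destruct (per_bounded (fun t => Bcorr tm h c t - beta)) as [Bm [_ HBm]].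
  { intros t. now rewrite Bcorr_per. }
  { intros t. apply continuous_Rminus; [now apply Bcorr_cont|apply continuous_const]. }
  apply (not_solvable_core c q tm h Hc Hq Hh A (Bm + 1) beta (fun t => proj2 (HA2 t)) A0 Bm eps HA0 HBm eq_refl He
    (fun t => proj1 (HA2 t)) ts HA1 HB Hor).
Qed.

Theorem theorem1p2 (c q : R -> C) :
  smooth_T1 c -> smooth_T1 q ->
  ( (avg c = RtoC 0 ->
     (exists z : C, in_iZ z /\ forall t, q t = z) ->
     (forall r : R, connected_T1 (Omega (fun t => snd (c t)) r)) ->
     schwartz_globally_solvable c q)
  /\
    ((exists t, snd (c t) <> 0) ->
     (avg c <> RtoC 0 \/ ~ in_iZ (avg q)) ->
     (schwartz_globally_solvable c q <->
      ((forall t, 0 <= snd (c t)) \/ (forall t, snd (c t) <= 0)))) ).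
Proof.
  intros Hc Hq. split.
  - now apply solvable_connected.
  - intros Hb Hor. split.
    + intros Hs. apply NNPP. intros Hn. apply not_or_and in Hn. destruct Hn as [N1 N2].
      apply (not_solvable_sign_change c q); auto.
      * apply not_all_ex_not in N1. destruct N1 as [t Ht]. exists t. lra.
      * apply not_all_ex_not in N2. destruct N2 as [t Ht]. exists t. lra.
    + intros [Hp|Hn].
      * apply (solvable_sign c q Hc Hq 1); [ring|intros t; specialize (Hp t); lra|].
        rewrite Rmult_1_l. now apply mean_pos.
      * apply (solvable_sign c q Hc Hq (-1)); [ring|intros t; specialize (Hn t); lra|].
        (* [mean_pos] is stated for a nonnegative imaginary part, so it is applied to [- c]. *)
        set (mc := fun t => (RtoC (-1) * c t)%C).
        assert (Hmc : smooth_T1 mc).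
        { apply smooth_T1_of_Cinf.
          - intros t. unfold mc. now rewrite (proj1 Hc).
          - assert (A1 := Cinf_Wtame_Wloc _ (smooth_T1_Cinf (I := unit) c Hc)).
            assert (A2 := Cinf_Wtame_Wloc _ (Cinf_const (I := unit) (RtoC (-1)))). unfold mc. cinf_tac. }
        assert (E : CInt mc 0 (2 * PI) = (RtoC (-1) * CInt c 0 (2 * PI))%C) by (apply CInt_scal; now apply smooth_ccont).
        assert (H := mean_pos mc Hmc).
        rewrite E in H. destruct Hb as [t0 Ht0].
        assert (0 < snd (RtoC (-1) * CInt c 0 (2 * PI))%C) as Hpos.
        { apply H.
          - exists t0. unfold mc; simpl. lra.
          - intros t. specialize (Hn t). unfold mc; simpl. lra. }
        simpl in Hpos |- *. lra.
Qed.
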